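(* Let $\mathbb{A}$ be an admissible set such that $\omega$ is realizable in $\mathbb{A}$. Let $G<S_{\infty}$ be a closed subgroup, let $X$ be a Polish $G$-space with a basis $\{A_i : i\in\omega\}$, and suppose that the relation $Imp$ is $\Sigma$-definable in $\mathbb{A}$. (1) Let $x\in X$ be codable in $\mathbb{A}$. Then for every $y\in X$, if $x,y$ are in the same $G$-invariant Borel subsets of $X$ which are constructible in $\mathbb{A}$, then for every $\alpha\le o(\mathbb{A})$ they are in the same $G$-invariant $\Sigma^0_{\alpha}$-subsets of $X$. (2) If $x,y\in X$ are both codable in $\mathbb{A}$ and they belong to the same $G$-invariant Borel sets which are constructible in $\mathbb{A}$, then they are in the same $G$-orbit.
   Context: **Group actions.** $S_\infty$ is the group of all permutations of $\omega$ with its usual Polish topology. A Polish $G$-space is a Polish space $X$ with a continuous action of $G$. $[\omega]^{<\omega}$ is the set of finite subsets of $\omega$; $S_{<\infty}$ is the set of all bijections between finite subsets of $\omega$; $S^G_{<\infty}=\{f|_d : f\in G,\ d\in[\omega]^{<\omega}\}$. For $\sigma\in S^G_{<\infty}$, $V^G_\sigma=\{f\in G: f\supseteq\sigma\}$; for finite $d\subseteq\omega$, $V^G_d=V^G_{id_d}$ (pointwise stabilizer of $d$ in $G$). It is assumed throughout that each basic open set $A_l$ is invariant under $V^G_c$ for some finite $c\subseteq\omega$. Borel classes $\Sigma^0_\alpha$ are considered for countable ordinals $\alpha\geq 1$. **Admissible sets.** An admissible set $\mathbb{A}$ is a transitive model of KPU (Kripke–Platek set theory with urelements, in the sense of Barwise),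 regarded as a two-sorted structure in a language $L$ containing $\emptyset,\in$, with the KPU axiom schemes holding with respect to all formulas of $L$. $Ord(\mathbb{A})$ is the class of ordinals of $\mathbb{A}$ and $o(\mathbb{A})$ is the ordinal of $\mathbb{A}$ (least ordinal not in $\mathbb{A}$). $\Sigma$-definable means definable by a $\Sigma$-formula (parameters from $\mathbb{A}$ allowed). $\omega$ is realizable in $\mathbb{A}$ if $\mathbb{A}$ contains a copy of $\langle\omega,<\rangle$ as an element (possibly consisting of urelements). Then $\mathbb{A}$ also contains copies of $[\omega]^{<\omega}$ and $S_{<\infty}$ ordered by inclusion; these sets are identified with their copies. **Multicodes.** In $\mathbb{A}$ define predicates $B_\Sigma,B_\Pi$ by simultaneous induction on ordinals $\alpha>0$: $B_\Sigma(1,u)$ iff $u$ is a function with $dom[u]=\omega$ and $rng[u]\subseteq\{0,1\}$; $B_\Pi(\alpha,u)$ iff $u=(0,u')$ for some $u'$ with $B_\Sigma(\alpha,u')$; for $\alpha>1$, $B_\Sigma(\alpha,u)$ iff $u$ is a function, $dom[u]=\alpha$ if $\alpha$ is limit, $dom[u]=\omega$ if $\alpha$ is a successor, and for every $u'\in rng[u]$ there is $\beta<\alpha$ with $B_\Pi(\beta,u')$ or $B_\Sigma(\beta,u')$. If $B_\Sigma(\alpha,u)$ (resp. $B_\Pi(\alpha,u)$), $u$ is called an $\alpha$-multicode (resp. co-$\alpha$-multicode). For a second countable space $X$ with basis $\{A_i:i\in\omega\}$ and countable $\alpha$, such $u$ determines a Borel set $B_u$: if $B_\Sigma(1,u)$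 then $B_u=\bigcup\{A_n:u(n)=1\}$; if $B_\Pi(\alpha,u)$ with $u=(0,u')$ then $B_u=X\setminus B_{u'}$; if $\alpha>1$ and $B_\Sigma(\alpha,u)$ then $B_u=\bigcup\{B_{u'}:u'\in rng[u]\}$. A Borel set $B\subseteq X$ is constructible in $\mathbb{A}$ (by $u$) if there are $u\in\mathbb{A}$ and a countable ordinal $\alpha\in Ord(\mathbb{A})$ with $\mathbb{A}\models B_\Sigma(\alpha,u)$ or $\mathbb{A}\models B_\Pi(\alpha,u)$, and $B=B_u$. **Codability and $Imp$.** $x\in X$ is codable in $\mathbb{A}$ (with respect to $G$) if $\omega$ is realizable in $\mathbb{A}$ and the function $F_1:S_{<\infty}\to\mathbb{A}$ given by $F_1(\sigma)=\emptyset$ if $\sigma\notin S^G_{<\infty}$ and $F_1(\sigma)=\{l: V^G_\sigma x\cap A_l\neq\emptyset\}$ if $\sigma\in S^G_{<\infty}$ is an element of $\mathbb{A}$. The relation $Imp(c,l,k)$ holds iff $c\in[\omega]^{<\omega}$, $l,k\in\omega$ and $A_k\subseteq V^G_cA_l$. *)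

(* Defs.v *)
From HB Require Import structures.
From mathcomp Require Import all_boot all_order all_algebra generic_quotient.
From mathcomp Require Import all_classical all_reals all_analysis.

Set Implicit Arguments.
Unset Strict Implicit.
Unset Printing Implicit Defensive.

Import Order.TTheory GRing.Theory Num.Theory.
Local Open Scope classical_set_scope.
Local Open Scope quotient_scope.

(** * The universe of sets over a collection [M] of urelements

    [V M] is the cumulative hierarchy over [M]: well-founded trees whose leaves
    are labelled by urelements, modulo bisimulation.  Leibniz equality on [V M]
    is therefore extensional equality of sets (lemma [vext]). *)

Inductive tree (M : Type) : Type :=
| Leaf (m : M)
| Node (T : Type) (f : T -> tree M).

Fixpoint bisim (M : Type) (s t : tree M) : Prop :=
  match s, t with
  | Leaf m, Leaf n => m = n
  | Node T f, Node U g =>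
      (forall i, exists j, bisim (f i) (g j)) /\
      (forall j, exists i, bisim (f i) (g j))
  | _, _ => False
  end.

Section Universe.
Variable M : Type.

HB.instance Definition _ := gen_eqMixin (tree M).
HB.instance Definition _ := gen_choiceMixin (tree M).

Lemma bisim_refl (s : tree M) : bisim s s.
Proof. by elim: s => //= I f IH; split => i; exists i. Qed.

Lemma bisim_sym (s t : tree M) : bisim s t -> bisim t s.
Proof.
elim: s t => [m|I f IH] [n|J g] //= [fg gf]; split.
- by move=> j; have [i /IH ?] := gf j; exists i.
- by move=> i; have [j /IH ?] := fg i; exists j.
Qed.

Lemma bisim_trans (s t u : tree M) : bisim s t -> bisim t u -> bisim s u.
Proof.
elim: s t u => [m|I f IH] [n|J g] [p|K h] //=; first by move=> ->.
move=> [fg gf] [gh hg]; split.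
- move=> i; have [j ij] := fg i; have [k jk] := gh j; exists k.
  exact: IH ij jk.
- move=> k; have [j jk] := hg k; have [i ij] := gf j; exists i.
  exact: IH ij jk.
Qed.

Definition bisimb (s t : tree M) : bool := `[< bisim s t >].

Lemma bisimb_equiv : equiv_class_of bisimb.
Proof.
split.
- by move=> s; apply/asboolP; exact: bisim_refl.
- by move=> s t; apply/asboolP/asboolP; exact: bisim_sym.
- by move=> t s u /asboolP st /asboolP tu; apply/asboolP; exact: bisim_trans tu.
Qed.

Canonical bisim_equiv := EquivRelPack bisimb_equiv.

Definition V := {eq_quot bisim_equiv}.

Definition ur (m : M) : V := \pi_V (Leaf m).

Definition vset (I : Type) (f : I -> V) : V :=
  \pi_V (Node (fun i => repr (f i))).

Definition vmem (x y : V) : Prop :=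
  if repr y is Node T f then exists i, x = \pi_V (f i) else False.

Definition is_ur (x : V) : Prop := exists m, x = ur m.
Definition is_set (x : V) : Prop := ~ is_ur x.

End Universe.

Notation "x ∈ y" := (vmem x y) (at level 70, no associativity).

Section UniverseTheory.
Variable M : Type.
Implicit Types x y z : V M.

Lemma piP (s t : tree M) : (\pi_(V M) s = \pi_(V M) t) <-> bisim s t.
Proof.
by split=> [/eqquotP/asboolP|/asboolP st]; [|exact/eqquotP].
Qed.

Lemma vmem_vset (I : Type) (f : I -> V M) x :
  x ∈ vset f <-> exists i, x = f i.
Proof.
rewrite /vmem /vset; set t := Node _.
have : bisim (repr (\pi_(V M) t)) t by apply/piP; rewrite reprK.
case: (repr _) => [m|J g] //= [gf fg]; split.
- by move=> [j ->]; have [i /piP] := gf j; rewrite reprK; exists i.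
- by move=> [i ->]; have [j /piP] := fg i; rewrite reprK; exists j.
Qed.

Lemma is_set_vset (I : Type) (f : I -> V M) : is_set (vset f).
Proof. by move=> [m /piP]. Qed.

Lemma ur_inj : injective (@ur M).
Proof. by move=> m n /piP. Qed.

Lemma vmem_ur x m : ~ x ∈ ur m.
Proof.
rewrite /vmem /ur; have : bisim (repr (\pi_(V M) (Leaf m))) (Leaf m).
  by apply/piP; rewrite reprK.
by case: (repr _) => [n _ []|T f []].
Qed.

Lemma vext x y : is_set x -> is_set y -> (forall z, z ∈ x <-> z ∈ y) -> x = y.
Proof.
rewrite /is_set /is_ur /vmem -{1 3}[x]reprK -{1 3}[y]reprK.
case: (repr x) => [m []|I f _]; first by exists m.
case: (repr y) => [m []|J g _ fg]; first by exists m.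
apply/piP; split.
- by move=> i; have [j /piP] := (fg (\pi_(V M) (f i))).1 (ex_intro _ i erefl);
    exists j.
- by move=> j; have [i /piP/bisim_sym] :=
    (fg (\pi_(V M) (g j))).2 (ex_intro _ j erefl); exists i.
Qed.

Lemma vmem_wf : well_founded (@vmem M).
Proof.
move=> x; rewrite -[x]reprK; elim: (repr x) => [m|I f IH]; constructor => y.
  by move=> /vmem_ur.
have -> : \pi_(V M) (Node f) = vset (fun i => \pi_(V M) (f i)).
  by apply/piP => /=; split=> i; exists i; apply/piP; rewrite reprK.
by move=> /vmem_vset[i ->].
Qed.

Definition elts x : set (V M) := [set z | z ∈ x].

Definition vimg (T : Type) (f : T -> V M) (P : set T) : V M :=
  vset (fun t : {t : T | P t} => f (sval t)).

Definition vempty : V M := vimg (fun _ : unit => vset (of_void _)) set0.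
Definition vupair x y : V M := vset (fun b : bool => if b then x else y).
Definition vone : V M := vupair vempty vempty.
Definition vpair x y : V M := vupair (vupair x x) (vupair x y).

Definition fun_on (u d : V M) : Prop :=
  [/\ is_set u,
      forall z, z ∈ u -> exists x y, x ∈ d /\ z = vpair x y
    & forall x, x ∈ d -> exists! y, vpair x y ∈ u].

Definition rng (u : V M) : set (V M) := [set y | exists x, vpair x y ∈ u].

Definition vtrans x : Prop := is_set x /\ forall y z, y ∈ x -> z ∈ y -> z ∈ x.

Definition is_ord x : Prop := vtrans x /\ forall y, y ∈ x -> vtrans y.

Definition is_succ x : Prop :=
  exists2 y, is_ord y & forall z, z ∈ x <-> z ∈ y \/ z = y.

Definition is_limit x : Prop := [/\ is_ord x, x <> vempty & ~ is_succ x].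

End UniverseTheory.

Arguments vempty {M}.
Arguments vone {M}.

(** * Two-sorted languages and structures

    Formulas are interpreted in the single domain of all objects; the two sorts
    (urelements, sets) are told apart by the atomic formula [FUr], and the
    quantifiers restricted to one sort are obtained by relativization.
    Variables are de Bruijn indices.  The symbols for the empty set, membership
    and equality are built in; all other symbols come from [language]. *)

Inductive sort := SUr | SSet.

Record language := Language {
  fsym : Type;
  farg : fsym -> seq sort;
  fres : fsym -> sort;
  rsym : Type;
  rarg : rsym -> seq sort }.

Section Syntax.
Variable L : language.

Inductive term : Type :=
| TVar (n : nat)
| TEmpty
| TFun (f : fsym L) (args : 'I_(size (farg f)) -> term).

Inductive formula : Type :=
| FUr (t : term)
| FEq (t u : term)
| FMem (t u : term)
| FRel (r : rsym L) (args : 'I_(size (rarg r)) -> term)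
| FNot (p : formula)
| FAnd (p q : formula)
| FOr (p q : formula)
| FBAll (v : nat) (p : formula)   (* for all x in the variable v *)
| FBEx (v : nat) (p : formula)    (* for some x in the variable v *)
| FAll (p : formula)
| FEx (p : formula).

Fixpoint Delta0 (p : formula) : bool :=
  match p with
  | FUr _ | FEq _ _ | FMem _ _ | FRel _ _ => true
  | FNot p => Delta0 p
  | FAnd p q | FOr p q => Delta0 p && Delta0 q
  | FBAll _ p | FBEx _ p => Delta0 p
  | FAll _ | FEx _ => false
  end.

Fixpoint SigmaF (p : formula) : bool :=
  Delta0 p ||
  match p with
  | FAnd p q | FOr p q => SigmaF p && SigmaF q
  | FBAll _ p | FBEx _ p | FEx p => SigmaF p
  | _ => false
  end.

End Syntax.

Definition scons (T : Type) (x : T) (e : nat -> T) : nat -> T :=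
  fun n => if n is k.+1 then e k else x.

Definition in_sort (M : Type) (A : V M) (s : sort) (x : V M) : Prop :=
  match s with SUr => is_ur x | SSet => x ∈ A end.

Definition well_sorted (M : Type) (A : V M) (s : seq sort)
    (a : 'I_(size s) -> V M) : Prop :=
  forall i : 'I_(size s), in_sort A (nth SUr s i) (a i).

(* A transitive structure over [M]: its urelements are all of [M], its sets are
   the members of [univ].  Ill-sorted applications of a function symbol denote
   the empty set, ill-sorted relational atoms are false. *)
Record structure (M : Type) (L : language) := Structure {
  univ :> V M;
  univ_sets : forall a, a ∈ univ -> is_set a;
  univ_trans : forall a x, a ∈ univ -> x ∈ a -> is_set x -> x ∈ univ;
  univ_empty : vempty ∈ univ;
  fint : forall f : fsym L, ('I_(size (farg f)) -> V M) -> V M;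
  fint_sort : forall (f : fsym L) a,
    well_sorted univ a -> in_sort univ (fres f) (@fint f a);
  fint_junk : forall (f : fsym L) (a : 'I_(size (farg f)) -> V M),
    ~ well_sorted univ a -> @fint f a = vempty;
  rint : forall r : rsym L, ('I_(size (rarg r)) -> V M) -> Prop;
  rint_sort : forall (r : rsym L) a, @rint r a -> well_sorted univ a }.

Arguments fint {M L} s f a.
Arguments rint {M L} s r a.

Section Semantics.
Variables (M : Type) (L : language) (S : structure M L).
Implicit Types (e : nat -> V M).

Definition obj (x : V M) : Prop := is_ur x \/ x ∈ univ S.

Fixpoint eval e (t : term L) : V M :=
  match t with
  | TVar n => e n
  | TEmpty => vempty
  | TFun f args => fint S f (fun i => eval e (args i))
  end.

Fixpoint sat e (p : formula L) : Prop :=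
  match p with
  | FUr t => is_ur (eval e t)
  | FEq t u => eval e t = eval e u
  | FMem t u => eval e t ∈ eval e u
  | FRel r args => rint S r (fun i => eval e (args i))
  | FNot p => ~ sat e p
  | FAnd p q => sat e p /\ sat e q
  | FOr p q => sat e p \/ sat e q
  | FBAll v p => forall x, obj x -> x ∈ e v -> sat (scons x e) p
  | FBEx v p => exists x, [/\ obj x, x ∈ e v & sat (scons x e) p]
  | FAll p => forall x, obj x -> sat (scons x e) p
  | FEx p => exists x, obj x /\ sat (scons x e) p
  end.

(* Valuations of the variables; they also provide the parameters. *)
Definition valuation e : Prop := forall n, obj (e n).

(* The axioms of KPU, the schemes being taken over all formulas of [L]. *)
Record KPU : Prop := {
  kpu_extensionality : forall a b, a ∈ univ S -> b ∈ univ S ->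
    (forall x, obj x -> (x ∈ a <-> x ∈ b)) -> a = b;
  kpu_foundation : forall (p : formula L) e, valuation e ->
    (exists2 a, a ∈ univ S & sat (scons a e) p) ->
    exists a, [/\ a ∈ univ S, sat (scons a e) p &
      forall b, b ∈ univ S -> b ∈ a -> ~ sat (scons b e) p];
  kpu_pair : forall x y, obj x -> obj y ->
    exists a, [/\ a ∈ univ S, x ∈ a & y ∈ a];
  kpu_union : forall a, a ∈ univ S ->
    exists2 b, b ∈ univ S & forall y x, y ∈ a -> x ∈ y -> x ∈ b;
  kpu_separation : forall (p : formula L) e, Delta0 p -> valuation e ->
    forall a, a ∈ univ S ->
    exists2 b, b ∈ univ S &
      forall x, obj x -> (x ∈ b <-> x ∈ a /\ sat (scons x e) p);
  kpu_collection : forall (p : formula L) e, Delta0 p -> valuation e ->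
    forall a, a ∈ univ S ->
    (forall x, x ∈ a -> exists2 y, obj y & sat (scons y (scons x e)) p) ->
    exists2 b, b ∈ univ S &
      forall x, x ∈ a -> exists2 y, y ∈ b & sat (scons y (scons x e)) p }.

(* Transitivity and the embedding in [V M] are part of [structure]. *)
Definition admissible : Prop := KPU.

Definition Sigma_definable3 (P : V M -> V M -> V M -> Prop) : Prop :=
  exists p e, [/\ SigmaF p, valuation e &
    forall x y z, obj x -> obj y -> obj z ->
      (P x y z <-> sat (scons x (scons y (scons z e))) p)].

(* [o] is the least ordinal that is not in [S]. *)
Definition is_ordinal_of (o : V M) : Prop :=
  [/\ is_ord o, ~ o ∈ univ S &
    forall b, is_ord b -> ~ b ∈ univ S -> o = b \/ o ∈ b].

(* [om] realizes omega in [S]: the range of [om] and the image of the order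
   of the natural numbers under [om] are elements of [S]. *)
Definition realizes_omega (om : nat -> V M) : Prop :=
  [/\ injective om,
      vset om ∈ univ S
    & vimg (fun p => vpair (om p.1) (om p.2))
        [set p : nat * nat | (p.1 < p.2)%N] ∈ univ S].

End Semantics.

(** * Multicodes *)

Section Multicodes.
Variables (M : Type) (om : nat -> V M).

Inductive BSigma : V M -> V M -> Prop :=
| BSigma_one u : fun_on u (vset om) ->
    (forall y, rng u y -> y = vempty \/ y = vone) -> BSigma vone u
| BSigma_gt1 a u : is_ord a -> vone ∈ a ->
    (is_limit a /\ fun_on u a) \/ (is_succ a /\ fun_on u (vset om)) ->
    (forall u', rng u u' -> exists2 b, b ∈ a & BPi b u' \/ BSigma b u') ->
    BSigma a u
with BPi : V M -> V M -> Prop :=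
| BPi_compl a u' : BSigma a u' -> BPi a (vpair vempty u').

(* [decodes A u B]: the multicode [u] determines the set [B], i.e. [B = B_u],
   with respect to the basis [A].  The clauses are mutually exclusive. *)
Inductive decodes (X : Type) (A : nat -> set X) : V M -> set X -> Prop :=
| decodes_one u : BSigma vone u ->
    decodes A u (\bigcup_(n in [set n | vpair (om n) vone ∈ u]) A n)
| decodes_compl a u' B : BSigma a u' -> decodes A u' B ->
    decodes A (vpair vempty u') (~` B)
| decodes_gt1 a u (F : V M -> set X) : vone ∈ a -> BSigma a u ->
    (forall u', rng u u' -> decodes A u' (F u')) ->
    decodes A u (\bigcup_(u' in rng u) F u').

Definition constructible (L : language) (S : structure M L)
    (X : topologicalType) (A : nat -> set X) (B : set X) : Prop :=
  <<s open >> B /\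
  exists u a, [/\ obj S u, a ∈ univ S /\ is_ord a, countable (elts a),
    BSigma a u \/ BPi a u & decodes A u B].

End Multicodes.

(* [Sigma0 a B]: [B] is in the Borel class of index the (von Neumann) ordinal
   [a >= 1]. *)
Inductive Sigma0 (M : Type) (X : topologicalType) : V M -> set X -> Prop :=
| Sigma0_open U : open U -> Sigma0 vone U
| Sigma0_bigcup a (F : nat -> set X) : is_ord a -> vone ∈ a ->
    (forall n, exists2 b, b ∈ a & Sigma0 b (~` F n)) ->
    Sigma0 a (\bigcup_n F n).

(** * The permutation group of the natural numbers and its Polish actions *)

(* As a [set_type], [Sinf] carries the subspace topology inherited from the
   space of all functions with the topology of pointwise convergence. *)
Definition Sinf := set_type [set f : {ptws nat -> nat} | bijective f].

HB.instance Definition _ := Topological.on Sinf.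

Definition papp (f : Sinf) : nat -> nat := set_val f.

Lemma papp_bij (f : Sinf) : bijective (papp f).
Proof. by case: f => f hf; exact: set_mem hf. Qed.

Lemma papp_inj : injective papp.
Proof. exact: val_inj. Qed.

Definition mkperm (f : nat -> nat) (hf : bijective f) : Sinf :=
  SigSub (mem_set (hf : [set f : {ptws nat -> nat} | bijective f] f)).

Definition perm_one : Sinf := mkperm (Bijective (frefl id) (frefl id)).

Definition perm_mul (f g : Sinf) : Sinf :=
  mkperm (bij_comp (papp_bij f) (papp_bij g)).

Lemma papp_inv_ex (f : Sinf) :
  exists g : nat -> nat, cancel (papp f) g /\ cancel g (papp f).
Proof. by have [g fg gf] := papp_bij f; exists g. Qed.

Definition perm_invf (f : Sinf) : nat -> nat := sval (cid (papp_inv_ex f)).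

Lemma perm_invK (f : Sinf) :
  cancel (papp f) (perm_invf f) /\ cancel (perm_invf f) (papp f).
Proof. exact: svalP (cid (papp_inv_ex f)). Qed.

Definition perm_inv (f : Sinf) : Sinf :=
  mkperm (Bijective (perm_invK f).2 (perm_invK f).1).

Fact perm_mulA : associative perm_mul.
Proof. by move=> f g h; apply: papp_inj. Qed.
Fact perm_mul1 : left_id perm_one perm_mul.
Proof. by move=> f; apply: papp_inj. Qed.
Fact perm_1mul : right_id perm_one perm_mul.
Proof. by move=> f; apply: papp_inj. Qed.
Fact perm_mulV : left_inverse perm_one perm_inv perm_mul.
Proof. by move=> f; apply: papp_inj; apply/funext => n; exact: (perm_invK f).1. Qed.
Fact perm_Vmul : right_inverse perm_one perm_inv perm_mul.
Proof. by move=> f; apply: papp_inj; apply/funext => n; exact: (perm_invK f).2. Qed.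

HB.instance Definition _ := isGroup.Build Sinf
  perm_mulA perm_mul1 perm_1mul perm_mulV perm_Vmul.

Local Open Scope group_scope.

Definition subgroup (G : set Sinf) : Prop :=
  [/\ G 1, forall f g, G f -> G g -> G (f * g) & forall f, G f -> G f^-1].

Definition polish (R : realType) (X : topologicalType) : Prop :=
  (exists2 D : set X, countable D & dense D) /\
  exists d : X -> X -> R,
    [/\ forall x y, d x y = 0%R <-> x = y,
        forall x y, d x y = d y x,
        forall x y z, (d x z <= d x y + d y z)%R,
        forall x, nbhs x =
          filter_from [set e : R | (0 < e)%R] (fun e => [set y | (d x y < e)%R])
      & forall u : nat -> X,
          (forall e : R, (0 < e)%R -> exists N, forall m n,
             (N <= m)%N -> (N <= n)%N -> (d (u m) (u n) < e)%R) ->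
          exists l : X, u n @[n --> \oo] --> l].

(* [act] is a continuous action of [G] on [X]; the values of [act] outside
   [G] are irrelevant. *)
Record continuous_action (G : set Sinf) (X : topologicalType)
    (act : Sinf -> X -> X) : Prop := {
  action1 : forall x, act 1 x = x;
  actionM : forall f g x, G f -> G g -> act (f * g) x = act f (act g x);
  action_continuous :
    {within G `*` [set: X], continuous (fun p : Sinf * X => act p.1 p.2)} }.

(* Partial maps between subsets of omega are represented by their graphs. *)
Definition Sfin : set (set (nat * nat)) :=
  [set s | [/\ finite_set s,
    forall n m m', s (n, m) -> s (n, m') -> m = m' &
    forall n n' m, s (n, m) -> s (n', m) -> n = n']].

Definition SfinG (G : set Sinf) : set (set (nat * nat)) :=
  [set s | exists f d, [/\ G f, finite_set d &
    s = [set (n, papp f n) | n in d]]].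

Definition VG (G : set Sinf) (s : set (nat * nat)) : set Sinf :=
  [set f | G f /\ forall p, s p -> papp f p.1 = p.2].

Definition id_on (c : set nat) : set (nat * nat) := [set (n, n) | n in c].

Section Actions.
Variables (G : set Sinf) (X : topologicalType) (act : Sinf -> X -> X).
Variable A : nat -> set X.

Definition invariant_under (H : set Sinf) (B : set X) : Prop :=
  forall f x, H f -> B x -> B (act f x).

Definition Imp (c : set nat) (l k : nat) : Prop :=
  finite_set c /\ A k `<=` [set act f a | f in VG G (id_on c) & a in A l].

Section Codes.
Variables (M : Type) (om : nat -> V M).

(* The relation [Imp] on (the copies of) finite sets and natural numbers. *)
Definition Imp_copy (x y z : V M) : Prop :=
  exists c l k, [/\ x = vimg om c, y = om l, z = om k & Imp c l k].

Definition pmap_copy (s : set (nat * nat)) : V M :=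
  vimg (fun p => vpair (om p.1) (om p.2)) s.

Definition F1 (x : X) (s : set (nat * nat)) : V M :=
  if `[< SfinG G s >] then
    vimg om [set l | [set act f x | f in VG G s] `&` A l !=set0]
  else vempty.

Definition F1_graph (x : X) : V M :=
  vimg (fun s : nat * nat -> Prop => vpair (pmap_copy s) (F1 x s)) Sfin.

Definition codable (L : language) (S : structure M L) (x : X) : Prop :=
  realizes_omega S om /\ F1_graph x ∈ univ S.

Definition same_constructible (L : language) (S : structure M L) (x y : X) :=
  forall B : set X, invariant_under G B -> constructible om S A B ->
    (B x <-> B y).

End Codes.
End Actions.

(* Main.v *)
(* For a finite partial injection [s], write [V_s x] for the set of the [f x]
   with [f] in [G] extending [s].  Define decreasing sets [B_a(s)] by recursion:
   [z] is in [B_a(s)] when [z] is in the closure of [V_s x] and, for all [b < a]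
   and all [n], [k], there are [m], [m'] with [z] in [B_b(s + (n,m) + (m',k))].
   As [f B_a(s) = B_a(f s)] for [f] in [G], the set [B_a(0)] is [G]-invariant; it
   contains [x], and since its definition only mentions the orbit of [x], a
   multicode for it is obtained from [F_1] by Sigma-recursion.  Hence
   [y] lies in [B_a(0)] for every countable ordinal [a] of the admissible set.

   (1) Being in the [B_b(0)] for [b < omega * a] makes [x] and [y] equivalent in a
   back-and-forth game of length [a] on cosets of pointwise stabilisers of finite
   sets.  By induction on [a], this game preserves "comeagerly many [f] in the
   stabiliser send the point into [B]" for [B] in [Sigma^0_a]; for invariant
   [B] the quantifier can be dropped.

   (2) If [y] is codable too, then "[y] is not in [B_a(s)]" is Sigma-definable, so
   Sigma-collection bounds the stages at which [y] leaves the sets [B_a(s)].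
   Therefore the [s] with [y] in all [B_a(s)] have the extension property, and a
   union of a chain of them is some [g] in [G] with [g x = y]. *)

Require Import Defs.
From mathcomp Require Import all_boot all_order all_algebra.
From mathcomp Require Import all_classical all_reals all_analysis.

Local Open Scope classical_set_scope.

Set Implicit Arguments.
Unset Strict Implicit.
Unset Printing Implicit Defensive.

(** * Sets over urelements *)

(** One step of the recursion for [Bst] adds one point to the domain and one to the range of a
    partial map, whereas one move of the game names a finite set of arbitrary size. A move therefore
    spends finitely many stages, with no bound fixed in advance, which is the origin of the factor
    [omega]. Only stages [omega * b + i] with [b] below [a] occur, and these belong to the
    admissible set even when [a] is its ordinal. What gets coded is the complement of an
    approximation: at stage 0 it is open, hence has a 1-multicode, and at limits it is a plain
    union, so the rank of the code stays within finite distance of the stage. Constructible sets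
    come from countable ordinals only, and countability is a condition from outside the admissible
    set. A bound produced by collection may be uncountable and has to be replaced by a smaller,
    countable ordinal. Comeagerness is expressed by countable families of dense sets of
    permutations, so that Baire's theorem for [G] becomes a direct construction from the closedness
    of [G]. *)

Lemma countable_setU (T : Type) (A B : set T) :
  countable A -> countable B -> countable (A `|` B).
Proof.
move=> cA cB; rewrite -bigcup2E; apply: bigcup_countable; first exact: countableP.
by move=> [|[|i]] _ //=; exact: countable0.
Qed.

Section SetTheory.
Variable M : Type.
Implicit Types x y z a b u v : V M.

Lemma vmem_vimg (T : Type) (f : T -> V M) (P : set T) y :
  y ∈ vimg f P <-> exists2 t, P t & y = f t.
Proof.
rewrite /vimg vmem_vset; split => [[[t Pt] ->]|[t Pt ->]]; first by exists t.
by exists (exist _ t Pt).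
Qed.

Lemma is_set_vimg (T : Type) (f : T -> V M) (P : set T) : is_set (vimg f P).
Proof. exact: is_set_vset. Qed.

Lemma vmem_vempty x : ~ x ∈ vempty.
Proof. by rewrite /vempty vmem_vimg => -[]. Qed.

Lemma is_set_vempty : is_set (@vempty M).
Proof. exact: is_set_vimg. Qed.

Lemma vmem_vupair x y z : z ∈ vupair x y <-> z = x \/ z = y.
Proof.
rewrite /vupair vmem_vset; split => [[[] ->]|[->|->]]; first by left.
- by right.
- by exists true.
- by exists false.
Qed.

Lemma is_set_vupair x y : is_set (vupair x y).
Proof. exact: is_set_vset. Qed.

Lemma vupair_inj x y x' y' : vupair x y = vupair x' y' ->
  (x = x' /\ y = y') \/ (x = y' /\ y = x').
Proof.
move=> e.
have h z : z = x \/ z = y <-> z = x' \/ z = y'.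
  by rewrite -!vmem_vupair e.
have [hx _] := h x; have [hy _] := h y; have [_ hx'] := h x'; have [_ hy'] := h y'.
case: (hx (or_introl erefl)) => ?; case: (hy (or_intror erefl)) => ?; subst.
- by case: (hy' (or_intror erefl)) => ->; left.
- by left.
- by right.
- by case: (hx' (or_introl erefl)) => ->; left.
Qed.

Lemma vpair_inj x y x' y' : vpair x y = vpair x' y' -> x = x' /\ y = y'.
Proof.
move=> /vupair_inj[[/vupair_inj + /vupair_inj]|[/vupair_inj + /vupair_inj]].
- by case=> -[? _]; case=> -[? ?]; subst.
- by case=> -[? ?]; case=> -[? ?]; subst.
Qed.

Lemma vempty_neq_vpair x y : vempty <> vpair x y.
Proof.
move=> e; apply: (@vmem_vempty (vupair x x)); rewrite e; apply/vmem_vupair; left.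
by [].
Qed.

Lemma vmem_vone x : x ∈ vone <-> x = vempty.
Proof. by rewrite vmem_vupair; split => [[]|->] //; left. Qed.

Lemma vone_neq_vpair x y : vone <> vpair x y.
Proof.
move=> e; have : vupair x x ∈ vone by rewrite e; apply/vmem_vupair; left.
move=> /vmem_vone ex; apply: (@vmem_vempty x); rewrite -ex.
by apply/vmem_vupair; left.
Qed.

Lemma vmem_irrefl x : ~ x ∈ x.
Proof. by elim/(well_founded_ind (@vmem_wf M)): x => x IH xx; exact: (IH x). Qed.

Lemma vmem_asym x y : x ∈ y -> ~ y ∈ x.
Proof.
elim/(well_founded_ind (@vmem_wf M)): x y => x IH y xy yx.
exact: (IH y yx x).
Qed.

(* The index type of the family of elements of [a] lives in the small universe
   of [tree], unlike [{x | x ∈ a}]. *)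
Definition tidx (t : tree M) : Type :=
  match t return Type with Leaf _ => void | Node T _ => T end.

Definition vidx a : Type := tidx (repr a).

Definition vfam a : vidx a -> V M :=
  match repr a as t return tidx t -> V M with
  | Leaf _ => of_void _
  | Node T f => fun i => \pi_(V M)%qT (f i)
  end.

Lemma vmem_vfam a x : x ∈ a <-> exists i, x = @vfam a i.
Proof.
rewrite /vmem /vfam /vidx; case: (repr a) => [m|T f] //.
by split => // -[[]].
Qed.

Definition vunion a : V M :=
  vset (fun p : {i : vidx a & vidx (@vfam a i)} => vfam (projT2 p)).

Lemma vmem_vunion a z : z ∈ vunion a <-> exists2 w, w ∈ a & z ∈ w.
Proof.
rewrite vmem_vset; split => [[[i j] ->]|[w /vmem_vfam[i ->] /vmem_vfam[j ->]]].
  by exists (vfam i); apply/vmem_vfam; [exists i|exists j].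
by exists (existT _ i j).
Qed.

(** Separation in the full universe, for an arbitrary predicate: the result need not belong to an
    admissible set that contains [a], so membership is a separate question at each use. *)
Definition vsep a (P : V M -> Prop) : V M :=
  vimg (@vfam a) [set i | P (vfam i)].

Lemma vmem_vsep a P z : z ∈ vsep a P <-> z ∈ a /\ P z.
Proof.
rewrite vmem_vimg; split => [[i Pi ->]|[/vmem_vfam[i ->] Pi]]; last by exists i.
by split=> //; apply/vmem_vfam; exists i.
Qed.

Definition vrep a (f : V M -> V M) : V M := vset (fun i => f (@vfam a i)).

Lemma vmem_vrep a f z : z ∈ vrep a f <-> exists2 x, x ∈ a & z = f x.
Proof.
rewrite vmem_vset; split => [[i ->]|[x /vmem_vfam[i ->] ->]]; last by exists i.
by exists (vfam i) => //; apply/vmem_vfam; exists i.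
Qed.

Definition vlam a (f : V M -> V M) : V M := vrep a (fun x => vpair x (f x)).

Lemma vmem_vlam a f z : z ∈ vlam a f <-> exists2 x, x ∈ a & z = vpair x (f x).
Proof. exact: vmem_vrep. Qed.

Lemma vpair_vlam a f x y : vpair x y ∈ vlam a f <-> x ∈ a /\ y = f x.
Proof.
rewrite vmem_vrep; split => [[x' xa /vpair_inj[-> ->]]|[xa ->]] //.
by exists x.
Qed.

Lemma eq_vlam a f g : (forall x, x ∈ a -> f x = g x) -> vlam a f = vlam a g.
Proof.
move=> fg; apply: vext; try exact: is_set_vset.
by move=> z; rewrite !vmem_vrep; split => -[x xa ->]; exists x => //; rewrite fg.
Qed.

Definition vcup a b : V M := vunion (vupair a b).

Lemma vmem_vcup a b z : z ∈ vcup a b <-> z ∈ a \/ z ∈ b.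
Proof.
rewrite vmem_vunion; split => [[w /vmem_vupair[->|->]]|[]]; [by left|by right|..].
- by exists a => //; apply/vmem_vupair; left.
- by exists b => //; apply/vmem_vupair; right.
Qed.

Definition vsucc a : V M := vcup a (vupair a a).

Lemma vmem_vsucc a z : z ∈ vsucc a <-> z ∈ a \/ z = a.
Proof.
rewrite vmem_vcup vmem_vupair; split=> [[|[]]|[|]]; try by [left|right].
by move=> ->; right; left.
Qed.

Lemma is_set_vunion a : is_set (vunion a). Proof. exact: is_set_vset. Qed.
Lemma is_set_vsep a P : is_set (vsep a P). Proof. exact: is_set_vimg. Qed.
Lemma is_set_vrep a P : is_set (vrep a P). Proof. exact: is_set_vset. Qed.

Lemma mem_vpair_field x y g : vpair x y ∈ g ->
  x ∈ vunion (vunion g) /\ y ∈ vunion (vunion g).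
Proof.
move=> xyg.
have h : vupair x y ∈ vunion g.
  by apply/vmem_vunion; exists (vpair x y) => //; apply/vmem_vupair; right.
by split; apply/vmem_vunion; exists (vupair x y) => //; apply/vmem_vupair;
  [left|right].
Qed.

Definition vrng g : V M :=
  vsep (vunion (vunion g))
    (fun y => exists2 x, x ∈ vunion (vunion g) & vpair x y ∈ g).

Lemma vmem_vrng g y : y ∈ vrng g <-> exists x, vpair x y ∈ g.
Proof.
rewrite vmem_vsep; split => [[_ [x _ ?]]|[x xyg]]; first by exists x.
by have [? ?] := mem_vpair_field xyg; split=> //; exists x.
Qed.

Lemma vmem_vrng_lam a f y : y ∈ vrng (vlam a f) <-> exists2 x, x ∈ a & y = f x.
Proof.
rewrite vmem_vrng; split => [[x /vpair_vlam[]]|[x xa ->]]; first by exists x.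
by exists x; apply/vpair_vlam.
Qed.

(* [vapp g x] is the value of the function [g] at [x] when that value is a set. *)
Definition vapp g x : V M :=
  vunion (vsep (vunion (vunion g)) (fun y => vpair x y ∈ g)).

Lemma vapp_unique g x y : is_set y -> vpair x y ∈ g ->
  (forall y', vpair x y' ∈ g -> y' = y) -> vapp g x = y.
Proof.
move=> sy xy uy; apply: vext => //; first exact: is_set_vunion.
move=> z; rewrite vmem_vunion; split => [[w /vmem_vsep[_ /uy ->]] //|zy].
exists y => //; apply/vmem_vsep; split=> //; exact: (mem_vpair_field xy).2.
Qed.

Lemma vapp_vlam a f x : x ∈ a -> is_set (f x) -> vapp (vlam a f) x = f x.
Proof.
move=> xa sf; apply: vapp_unique => //; first exact/vpair_vlam.
by move=> y' /vpair_vlam[].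
Qed.

End SetTheory.

(** * Delta0 predicates of environments, and Sigma predicates with a single witness *)

Section Framework.
Variables (M : Type) (L : language) (S : structure M L).
Hypothesis KP : KPU S.
Notation env := (nat -> V M).
Notation obj := (@obj M L S).
Notation val := (@valuation M L S).
Implicit Types (e : env) (x y z a b : V M).

Definition tl (e : env) : env := fun n => e n.+1.

Lemma tl_scons x e : tl (scons x e) = e. Proof. by []. Qed.

Lemma obj_univ a : a ∈ univ S -> obj a. Proof. by right. Qed.

Lemma obj_mem a x : obj a -> x ∈ a -> obj x.
Proof.
case=> [[m ->]|aS xa]; first by move=> h; case: (vmem_ur h).
by have [|xs] := pselect (is_ur x); [left|right; exact: univ_trans aS xa xs].
Qed.

Lemma obj_set a : obj a -> is_set a -> a ∈ univ S.
Proof. by case. Qed.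

Lemma obj_empty : obj vempty. Proof. by right; exact: univ_empty. Qed.

Lemma val_scons x e : obj x -> val e -> val (scons x e).
Proof. by move=> ox ve [|n] /=. Qed.

Lemma val_ren e (r : nat -> nat) : val e -> val (fun n => e (r n)).
Proof. by move=> ve n; exact: ve. Qed.

Fixpoint tren (r : nat -> nat) (t : term L) : term L :=
  match t with
  | TVar n => TVar L (r n)
  | TEmpty => TEmpty L
  | TFun f a => TFun (fun i => tren r (a i))
  end.

Definition rlift (r : nat -> nat) (n : nat) := if n is k.+1 then (r k).+1 else 0.

Fixpoint fren (r : nat -> nat) (p : formula L) : formula L :=
  match p with
  | FUr t => FUr (tren r t)
  | FEq t u => FEq (tren r t) (tren r u)
  | FMem t u => FMem (tren r t) (tren r u)
  | FRel q a => FRel (fun i => tren r (a i))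
  | FNot p => FNot (fren r p)
  | FAnd p q => FAnd (fren r p) (fren r q)
  | FOr p q => FOr (fren r p) (fren r q)
  | FBAll v p => FBAll (r v) (fren (rlift r) p)
  | FBEx v p => FBEx (r v) (fren (rlift r) p)
  | FAll p => FAll (fren (rlift r) p)
  | FEx p => FEx (fren (rlift r) p)
  end.

Lemma eval_tren r e t : Defs.eval S e (tren r t) = Defs.eval S (fun n => e (r n)) t.
Proof.
by elim: t => //= f a IH; congr fint; apply/funext => i; exact: IH.
Qed.

Lemma scons_rlift r x e :
  (fun n => scons x e (rlift r n)) = scons x (fun n => e (r n)).
Proof. by apply/funext => -[]. Qed.

Lemma sat_fren r e p : sat S e (fren r p) <-> sat S (fun n => e (r n)) p.
Proof.
elim: p r e => /= [t|t u|t u|q a|p IH|p IHp q IHq|p IHp q IHq|v p IH|v p IH|p IH|p IH] r e;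
  rewrite ?eval_tren //.
- by under eq_fun do rewrite eval_tren.
- by rewrite IH.
- by rewrite IHp IHq.
- by rewrite IHp IHq.
- by split => h x ox xv; move: (h x ox xv); rewrite IH scons_rlift.
- by split => -[x [ox xv h]]; exists x; split=> //; move: h; rewrite IH scons_rlift.
- by split => h x ox; move: (h x ox); rewrite IH scons_rlift.
- by split => -[x [ox h]]; exists x; split=> //; move: h; rewrite IH scons_rlift.
Qed.

Lemma Delta0_fren r p : Delta0 (fren r p) = Delta0 p.
Proof. by elim: p r => //= [p IHp q IHq|p IHp q IHq] r; rewrite IHp IHq. Qed.

(** A semantic form of Delta0 definability: closure properties are proved for predicates of
    environments, and later definitions never have to be written as formulas with de Bruijn
    indices. *)
Definition D0 (P : env -> Prop) : Prop :=
  exists2 p, Delta0 p & forall e, val e -> (P e <-> sat S e p).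

Lemma D0_iff P Q : (forall e, val e -> (P e <-> Q e)) -> D0 Q -> D0 P.
Proof.
by move=> PQ [p Dp hp]; exists p => // e ve; rewrite PQ // hp.
Qed.

Lemma D0_ren P (r : nat -> nat) : D0 P -> D0 (fun e => P (fun n => e (r n))).
Proof.
move=> [p Dp hp]; exists (fren r p); first by rewrite Delta0_fren.
by move=> e ve; rewrite sat_fren hp //; exact: val_ren.
Qed.

Lemma D0_mem i j : D0 (fun e => e i ∈ e j).
Proof. by exists (FMem (TVar L i) (TVar L j)). Qed.

Lemma D0_eq i j : D0 (fun e => e i = e j).
Proof. by exists (FEq (TVar L i) (TVar L j)). Qed.

Lemma D0_ur i : D0 (fun e => is_ur (e i)).
Proof. by exists (FUr (TVar L i)). Qed.

Lemma D0_not P : D0 P -> D0 (fun e => ~ P e).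
Proof. by move=> [p Dp hp]; exists (FNot p) => // e ve; rewrite hp. Qed.

Lemma D0_and P Q : D0 P -> D0 Q -> D0 (fun e => P e /\ Q e).
Proof.
move=> [p Dp hp] [q Dq hq]; exists (FAnd p q); first by rewrite /= Dp.
by move=> e ve /=; rewrite hp // hq.
Qed.

Lemma D0_or P Q : D0 P -> D0 Q -> D0 (fun e => P e \/ Q e).
Proof.
move=> [p Dp hp] [q Dq hq]; exists (FOr p q); first by rewrite /= Dp.
by move=> e ve /=; rewrite hp // hq.
Qed.

Lemma D0_bex i (P : env -> V M -> Prop) : D0 (fun e => P (tl e) (e 0)) ->
  D0 (fun e => exists2 x, x ∈ e i & P e x).
Proof.
move=> [p Dp hp]; exists (FBEx i p) => // e ve /=; split.
- move=> [x xe Px]; have ox := obj_mem (ve i) xe; exists x; split=> //.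
  by apply/hp => //; exact: val_scons.
- move=> [x [ox xe /hp Px]]; exists x => //; apply: Px; exact: val_scons.
Qed.

Lemma D0_ball i (P : env -> V M -> Prop) : D0 (fun e => P (tl e) (e 0)) ->
  D0 (fun e => forall x, x ∈ e i -> P e x).
Proof.
move=> [p Dp hp]; exists (FBAll i p) => // e ve /=; split.
- move=> h x ox xe; apply/hp; [exact: val_scons|exact: h].
- move=> h x xe; have ox := obj_mem (ve i) xe.
  by have /hp := h _ ox xe; apply; exact: val_scons.
Qed.

(** An environment has infinitely many entries and leaves no room for parameters at its end, so
    variables and parameters are interleaved. *)
Definition mix (e p : env) : env := fun n => if odd n then p n./2 else e n./2.

Lemma mix_even e p n : mix e p n.*2 = e n.
Proof. by rewrite /mix odd_double doubleK. Qed.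

Lemma mix_odd e p n : mix e p n.*2.+1 = p n.
Proof. by rewrite /mix /= odd_double /= uphalf_double. Qed.

Lemma val_mix e p : val e -> val p -> val (mix e p).
Proof. by move=> ve vp n; rewrite /mix; case: ifP. Qed.

Lemma mix_evenE e p : (fun n => mix e p n.*2) = e.
Proof. by apply/funext => n; rewrite mix_even. Qed.

Lemma mix_oddE e p : (fun n => mix e p n.*2.+1) = p.
Proof. by apply/funext => n; rewrite mix_odd. Qed.

(* [Q w e p]: [w] is the witness, [e] the variables and [p] the parameters. *)
Definition S1 (P : env -> Prop) : Prop :=
  exists (Q : V M -> env -> env -> Prop) (p : env),
  [/\ val p, D0 (fun e => Q (e 0) (fun n => tl e n.*2) (fun n => tl e n.*2.+1)) &
    forall e, val e -> (P e <-> exists2 w, obj w & Q w e p)].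

Lemma S1_iff P Q : (forall e, val e -> (P e <-> Q e)) -> S1 Q -> S1 P.
Proof.
by move=> PQ [R [p [vp DR hR]]]; exists R, p; split=> // e ve; rewrite PQ // hR.
Qed.

Lemma val_empty : val (fun=> vempty).
Proof. by move=> n; exact: obj_empty. Qed.

Lemma D0_S1 P : D0 P -> S1 P.
Proof.
move=> DP; exists (fun _ e _ => P e), (fun=> vempty); split.
- exact: val_empty.
- exact: (D0_ren (fun n => n.*2.+1) DP).
- move=> e ve; split => [|[]//]; exists vempty => //; exact: obj_empty.
Qed.

Lemma S1_ren P (r : nat -> nat) : S1 P -> S1 (fun e => P (fun n => e (r n))).
Proof.
move=> [Q [p [vp DQ hQ]]]; exists (fun w e p => Q w (fun n => e (r n)) p), p.
split=> //; last by move=> e ve; rewrite hQ //; exact: val_ren.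
(* Slot 0 is the witness, after which variables and parameters alternate; [s] renames variables
   only. *)
pose s n := if n is k.+1 then
  if odd k then k.+1 else (r k./2).*2.+1 else 0.
apply: D0_iff (D0_ren s DQ) => e ve.
have -> : (fun n => tl (fun n0 => e (s n0)) n.*2) = (fun n => tl e (r n).*2).
  by apply/funext => n; rewrite /tl /s odd_double doubleK.
have -> // : (fun n => tl (fun n0 => e (s n0)) n.*2.+1) = (fun n => tl e n.*2.+1).
by apply/funext => n; rewrite /tl /s /= odd_double.
Qed.

Lemma S1_const (P : env -> Prop) c : obj c -> S1 P -> S1 (fun e => P (scons c e)).
Proof.
move=> oc [Q [p [vp DQ hQ]]].
exists (fun w e p => Q w (scons (p 0) e) (tl p)), (scons c p); split.
- exact: val_scons.
- pose s n := if n is k.+1 then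
    if odd k then k.+3 else (if k./2 is j.+1 then j.*2.+1 else 2) else 0.
  apply: D0_iff (D0_ren s DQ) => e ve.
  have -> : (fun n => tl (fun n0 => e (s n0)) n.*2) =
     scons (tl e 1) (fun n => tl e n.*2).
    apply/funext => n; rewrite /tl /s odd_double doubleK; by case: n.
  have -> // : (fun n => tl (fun n0 => e (s n0)) n.*2.+1) =
     tl (fun n => tl e n.*2.+1).
  by apply/funext => n; rewrite /tl /s /= odd_double.
- by move=> e ve; rewrite hQ //; exact: val_scons.
Qed.

Lemma pair_univ x y : obj x -> obj y -> exists2 a, a ∈ univ S &
  x ∈ a /\ y ∈ a.
Proof. by move=> ox oy; have [a [? ? ?]] := kpu_pair KP ox oy; exists a. Qed.

Lemma S1_merge (P1 P2 : env -> Prop) : S1 P1 -> S1 P2 ->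
  exists (Q1 Q2 : V M -> env -> env -> Prop) (p : env), [/\ val p,
   D0 (fun e => Q1 (e 0) (fun n => tl e n.*2) (fun n => tl e n.*2.+1)),
   D0 (fun e => Q2 (e 0) (fun n => tl e n.*2) (fun n => tl e n.*2.+1)),
   forall e, val e -> (P1 e <-> exists2 w, obj w & Q1 w e p) &
   forall e, val e -> (P2 e <-> exists2 w, obj w & Q2 w e p)].
Proof.
move=> [Q1 [p1 [vp1 D1 h1]]] [Q2 [p2 [vp2 D2 h2]]].
exists (fun w e p => Q1 w e (fun n => p n.*2)),
  (fun w e p => Q2 w e (fun n => p n.*2.+1)), (mix p1 p2).
split.
- exact: val_mix.
- pose s n := if n is k.+1 then if odd k then k./2.*2.*2.+2 else k.+1 else 0.
  apply: D0_iff (D0_ren s D1) => e ve.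
  have -> : (fun n => tl (fun n0 => e (s n0)) n.*2) = (fun n => tl e n.*2).
    by apply/funext => n; rewrite /tl /s odd_double.
  have -> // : (fun n => tl (fun n0 => e (s n0)) n.*2.+1) =
     (fun n => tl e n.*2.*2.+1).
  by apply/funext => n; rewrite /tl /s /= odd_double /= uphalf_double.
- pose s n := if n is k.+1 then if odd k then k./2.*2.+1.*2.+2 else k.+1 else 0.
  apply: D0_iff (D0_ren s D2) => e ve.
  have -> : (fun n => tl (fun n0 => e (s n0)) n.*2) = (fun n => tl e n.*2).
    by apply/funext => n; rewrite /tl /s odd_double.
  have -> // : (fun n => tl (fun n0 => e (s n0)) n.*2.+1) =
     (fun n => tl e n.*2.+1.*2.+1).
  by apply/funext => n; rewrite /tl /s /= odd_double /= uphalf_double.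
- by move=> e ve; rewrite h1 // mix_evenE.
- by move=> e ve; rewrite h2 // mix_oddE.
Qed.

(** The common witness is any set having both witnesses as members; the quantifiers that retrieve
    them are then bounded. *)
Lemma S1_and P1 P2 : S1 P1 -> S1 P2 -> S1 (fun e => P1 e /\ P2 e).
Proof.
move=> H1 H2; have [Q1 [Q2 [p [vp D1 D2 h1 h2]]]] := S1_merge H1 H2.
exists (fun w e p => (exists2 x, x ∈ w & Q1 x e p) /\ exists2 x, x ∈ w & Q2 x e p), p.
have s0 : D0 (fun e => Q1 (e 0) (fun n => tl (tl e) n.*2) (fun n => tl (tl e) n.*2.+1)).
  exact: (D0_ren (fun n => if n is k.+1 then k.+2 else 0) D1).
have s1 : D0 (fun e => Q2 (e 0) (fun n => tl (tl e) n.*2) (fun n => tl (tl e) n.*2.+1)).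
  exact: (D0_ren (fun n => if n is k.+1 then k.+2 else 0) D2).
split=> //.
- by apply: D0_and; apply: (D0_bex 0).
- move=> e ve; rewrite h1 // h2 //; split.
  + move=> [[w1 o1 q1] [w2 o2 q2]]; have [a aS [w1a w2a]] := pair_univ o1 o2.
    by exists a; [exact: obj_univ|split; [exists w1|exists w2]].
  + move=> [w ow [[x xw q1] [y yw q2]]].
    by split; [exists x|exists y] => //; exact: obj_mem ow _.
Qed.

Lemma S1_or P1 P2 : S1 P1 -> S1 P2 -> S1 (fun e => P1 e \/ P2 e).
Proof.
move=> H1 H2; have [Q1 [Q2 [p [vp D1 D2 h1 h2]]]] := S1_merge H1 H2.
exists (fun w e p => Q1 w e p \/ Q2 w e p), p; split=> //; first exact: D0_or.
move=> e ve; rewrite h1 // h2 //; split.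
- by move=> [[w o q]|[w o q]]; exists w => //; [left|right].
- by move=> [w o [q|q]]; [left|right]; exists w.
Qed.

Lemma S1_ex (P : env -> V M -> Prop) : S1 (fun e => P (tl e) (e 0)) ->
  S1 (fun e => exists2 x, obj x & P e x).
Proof.
move=> [Q [p [vp DQ hQ]]].
exists (fun w e p => exists2 x, x ∈ w & exists2 v, v ∈ w & Q v (scons x e) p), p.
split=> //.
- apply: (D0_bex 0); apply: (D0_bex 1).
  pose s n := if n is k.+1 then
    if odd k then k.+3 else (if k./2 is j.+1 then j.*2.+3 else 1) else 0.
  apply: D0_iff (D0_ren s DQ) => e ve.
  have -> : (fun n => tl (fun n0 => e (s n0)) n.*2) =
     scons (tl e 0) (fun n => tl (tl (tl e)) n.*2).
    by apply/funext => n; rewrite /tl /s odd_double doubleK; case: n.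
  have -> // : (fun n => tl (fun n0 => e (s n0)) n.*2.+1) =
     (fun n => tl (tl (tl e)) n.*2.+1).
  by apply/funext => n; rewrite /tl /s /= odd_double.
- move=> e ve; split.
  + move=> [x ox Px].

    have := (hQ (scons x e) (val_scons ox ve)).1 Px => -[v ov qv].
    have [a aS [xa va]] := pair_univ ox ov.
    by exists a; [exact: obj_univ|exists x => //; exists v].
  + move=> [w ow [x xw [v vw q]]]; have ox := obj_mem ow xw; exists x => //.
    apply: (hQ (scons x e) (val_scons ox ve)).2.
    by exists v => //; exact: obj_mem ow vw.
Qed.

End Framework.

(** * Sigma-definability in an admissible set *)

Section Framework2.
Variables (M : Type) (L : language) (S : structure M L).
Hypothesis KP : KPU S.
Notation env := (nat -> V M).
Notation obj := (@obj M L S).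
Notation val := (@valuation M L S).
Notation S1 := (@S1 M L S).
Notation D0 := (@D0 M L S).
Implicit Types (e : env) (x y z a b : V M).

Lemma D0_coll (R : env -> Prop) e a : D0 R -> val e -> a ∈ univ S ->
  (forall x, x ∈ a -> exists2 y, obj y & R (scons y (scons x e))) ->
  exists2 b, b ∈ univ S &
    forall x, x ∈ a -> exists2 y, y ∈ b & R (scons y (scons x e)).
Proof.
move=> [p Dp hp] ve aS h.
have [|b bS hb] := kpu_collection KP Dp ve aS.
  move=> x xa; have ox := obj_mem (obj_univ aS) xa.
  have [y oy Ry] := h _ xa; exists y => //.
  by apply/hp => //; exact: val_scons oy (val_scons ox ve).
exists b => // x xa; have ox := obj_mem (obj_univ aS) xa.
have [y yb Ry] := hb _ xa; exists y => //.
by apply/hp => //; exact: val_scons (obj_mem (obj_univ bS) yb) (val_scons ox ve).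
Qed.

Lemma D0_sep (R : env -> Prop) e a : D0 R -> val e -> a ∈ univ S ->
  vsep a (fun x => R (scons x e)) ∈ univ S.
Proof.
move=> [p Dp hp] ve aS.
have [b bS hb] := kpu_separation KP Dp ve aS.
suff -> : vsep a (fun x => R (scons x e)) = b by [].
apply: vext; [exact: is_set_vsep|exact: univ_sets bS|].
move=> z; rewrite vmem_vsep; split=> [[za Rz]|zb].
- have oz := obj_mem (obj_univ aS) za.
  by apply/hb => //; split=> //; apply/hp => //; exact: val_scons.
- have oz := obj_mem (obj_univ bS) zb.
  by have [/(_ zb)[za /hp Rz] _] := hb _ oz; split=> //; apply: Rz; exact: val_scons.
Qed.

(** Delta0 collection gathers the witnesses for all members of [e i] in one set, which is the new
    witness. Urelements are treated apart, since collection speaks of sets. *)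
Lemma S1_ball_var i (P : env -> V M -> Prop) : S1 (fun e => P (tl e) (e 0)) ->
  S1 (fun e => forall x, x ∈ e i -> P e x).
Proof.
move=> [Q [p [vp DQ hQ]]].
pose R (E : env) := Q (E 0) (scons (E 1) (fun n => tl (tl E) n.*2))
  (fun n => tl (tl E) n.*2.+1).
have DR : D0 R.
  pose s n := if n is k.+1 then
    if odd k then k.+2 else (if k./2 is j.+1 then j.*2.+2 else 1) else 0.
  apply: D0_iff (D0_ren s DQ) => e ve; rewrite /R.
  have -> : (fun n => tl (fun n0 => e (s n0)) n.*2) =
     scons (e 1) (fun n => tl (tl e) n.*2).
    by apply/funext => n; rewrite /tl /s odd_double doubleK; case: n.
  have -> // : (fun n => tl (fun n0 => e (s n0)) n.*2.+1) =
     (fun n => tl (tl e) n.*2.+1).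
  by apply/funext => n; rewrite /tl /s /= odd_double.
exists (fun w e p => forall x, x ∈ e i -> exists2 v, v ∈ w & Q v (scons x e) p), p.
split=> //.
- apply: (D0_ball i.*2.+1); apply: (D0_bex 1).
  pose s n := match n with 0 => 0 | 1 => 1 | k.+2 => k.+3 end.
  exact: (D0_iff _ (D0_ren s DR)).
- move=> e ve; split.
  + move=> h.
    have [[m em]|eS] := ve i.
      by exists vempty => [|x]; [exact: obj_empty|rewrite em => h'; case: (vmem_ur h')].
    have [|b bS hb] := D0_coll DR (val_mix ve vp) eS.
      move=> x xe; have ox := obj_mem (ve i) xe.
      have /(hQ (scons x e) (val_scons ox ve))[w ow q] := h x xe.
      by exists w => //; rewrite /R /= !tl_scons mix_evenE mix_oddE.
    exists b; first exact: obj_univ.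
    move=> x /hb[v vb]; rewrite /R /= !tl_scons mix_evenE mix_oddE; by exists v.
  + move=> [w ow h] x xe; have ox := obj_mem (ve i) xe.
    have [v vw q] := h x xe.
    apply/(hQ (scons x e) (val_scons ox ve)).
    by exists v => //; exact: obj_mem ow vw.
Qed.

Lemma union_univ a : a ∈ univ S -> vunion a ∈ univ S.
Proof.
move=> aS; have [b bS hb] := kpu_union KP aS.
have D : D0 (fun e => exists2 w, w ∈ e 1 & e 0 ∈ w).
  apply: (D0_bex 1 (P := fun e w => e 0 ∈ w)); exact: (D0_mem S 1 0).
have ve : val (scons a (fun=> vempty)).
  by apply: val_scons; [exact: obj_univ|move=> n; exact: obj_empty].
have := D0_sep D ve bS => /=.
congr (_ ∈ _); apply: vext; [exact: is_set_vsep|exact: is_set_vunion|].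
move=> z; rewrite vmem_vsep vmem_vunion; split=> [[]//|]; split=> //.
by case: H => w wa zw; exact: hb zw.
Qed.

(** Sigma-collection in its strong form: as [b] contains nothing but values, the image of a set
    under a Sigma function can be identified with [b] exactly. *)
Lemma S1_coll (P : env -> V M -> V M -> Prop) e a :
  S1 (fun e => P (tl (tl e)) (e 1) (e 0)) -> val e -> a ∈ univ S ->
  (forall x, x ∈ a -> exists2 y, obj y & P e x y) ->
  exists b, [/\ b ∈ univ S, forall x, x ∈ a -> exists2 y, y ∈ b & P e x y &
    forall y, y ∈ b -> exists2 x, x ∈ a & P e x y].
Proof.
move=> [Q [p [vp DQ hQ]]] ve aS h.
pose R (E : env) := exists2 y, y ∈ E 0 & exists2 w, w ∈ E 0 &
  Q w (scons y (scons (E 1) (fun n => tl (tl E) n.*2)))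
  (fun n => tl (tl E) n.*2.+1).
pose R0 (E : env) := Q (E 0) (scons (E 1) (scons (E 2) (fun n => tl (tl (tl E)) n.*2)))
  (fun n => tl (tl (tl E)) n.*2.+1).
have DR0 : D0 R0.
  pose s n := if n is k.+1 then
    if odd k then k.+3 else (match k./2 with 0 => 1 | 1 => 2 | j.+2 => j.*2.+3 end) else 0.
  apply: D0_iff (D0_ren s DQ) => E vE; rewrite /R0.
  have -> : (fun n => tl (fun n0 => E (s n0)) n.*2) =
     scons (E 1) (scons (E 2) (fun n => tl (tl (tl E)) n.*2)).
    by apply/funext => n; rewrite /tl /s odd_double doubleK; case: n => [|[]].
  have -> // : (fun n => tl (fun n0 => E (s n0)) n.*2.+1) =
     (fun n => tl (tl (tl E)) n.*2.+1).
  by apply/funext => n; rewrite /tl /s /= odd_double.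
have DR : D0 R.
  apply: (D0_bex 0 (P := fun E y => exists2 w, w ∈ E 0 &
     Q w (scons y (scons (E 1) (fun n => tl (tl E) n.*2)))
       (fun n => tl (tl E) n.*2.+1))).
  apply: (D0_bex 1).
  pose s n := match n with 0 => 0 | 1 => 1 | k.+2 => k.+3 end.
  exact: (D0_iff _ (D0_ren s DR0)).
have [|B BS hB] := D0_coll DR (val_mix ve vp) aS.
  move=> x xa; have ox := obj_mem (obj_univ aS) xa.
  have [y oy /(hQ (scons y (scons x e)))] := h x xa.
  move=> /(_ (val_scons oy (val_scons ox ve)))[w ow q].
  have [t tS [yt wt]] := pair_univ KP oy ow.
  exists t; first exact: obj_univ.
  by exists y => //; exists w => //=; rewrite !tl_scons mix_evenE mix_oddE.
(* Collection was applied to sets holding both a value and its witness. Their union [c] bounds both,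
   so the condition for being a value becomes Delta0 and can be separated. *)
pose c := vunion B; have cS : c ∈ univ S by exact: union_univ.
pose R1 (E : env) := exists2 x, x ∈ E 1 & exists2 w, w ∈ E 2 &
   Q w (scons (E 0) (scons x (fun n => tl (tl (tl E)) n.*2)))
       (fun n => tl (tl (tl E)) n.*2.+1).
have DR1 : D0 R1.
  apply: (D0_bex 1 (P := fun E x => exists2 w, w ∈ E 2 &
   Q w (scons (E 0) (scons x (fun n => tl (tl (tl E)) n.*2)))
       (fun n => tl (tl (tl E)) n.*2.+1))).
  apply: (D0_bex 3).
  pose s n := match n with 0 => 0 | 1 => 2 | 2 => 1 | k.+3 => k.+1.+4 end.
  exact: (D0_iff _ (D0_ren s DR0)).
have vac : val (scons a (scons c (mix e p))).
  by do 2!(apply: val_scons; first exact: obj_univ); exact: val_mix.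
exists (vsep c (fun y => R1 (scons y (scons a (scons c (mix e p)))))); split.
- exact: D0_sep.
- move=> x xa; have [t tB [y yt [w wt q]]] := hB x xa.
  have yc : y ∈ c by apply/vmem_vunion; exists t.
  have wc : w ∈ c by apply/vmem_vunion; exists t.
  move: q => /=; rewrite !tl_scons mix_evenE mix_oddE => q.
  have [ox oy] := (obj_mem (obj_univ aS) xa, obj_mem (obj_univ cS) yc).
  exists y.
    apply/vmem_vsep; split=> //; exists x => //; exists w => //=.
    by rewrite !tl_scons mix_evenE mix_oddE.
  apply/(hQ (scons y (scons x e))); first exact: val_scons oy (val_scons ox ve).
  by exists w => //; exact: obj_mem (obj_univ cS) wc.
- move=> y /vmem_vsep[yc [x /= xa [w wc q]]].
  have [ox oy] := (obj_mem (obj_univ aS) xa, obj_mem (obj_univ cS) yc).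
  move: q; rewrite !tl_scons mix_evenE mix_oddE => q.
  exists x => //; apply/(hQ (scons y (scons x e))); first exact: val_scons oy (val_scons ox ve).
  by exists w => //; exact: obj_mem (obj_univ cS) wc.
Qed.

Definition SF (f : env -> V M) : Prop :=
  (forall e, val e -> obj (f e)) /\ S1 (fun e => e 0 = f (tl e)).

Lemma S1_eqv i j : S1 (fun e => e i = e j). Proof. exact/D0_S1/D0_eq. Qed.
Lemma S1_memv i j : S1 (fun e => e i ∈ e j). Proof. exact/D0_S1/D0_mem. Qed.
Lemma S1_neqv i j : S1 (fun e => e i <> e j).
Proof. exact/D0_S1/D0_not/D0_eq. Qed.
Lemma S1_nmemv i j : S1 (fun e => ~ e i ∈ e j).
Proof. exact/D0_S1/D0_not/D0_mem. Qed.

Lemma SF_ren f (r : nat -> nat) : SF f -> SF (fun e => f (fun n => e (r n))).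
Proof.
move=> [oF Sf]; split=> [e ve|]; first by apply: oF; exact: val_ren.
exact: (S1_ren (rlift r) Sf).
Qed.

Lemma SF_var i : SF (fun e => e i).
Proof. by split=> //; exact: S1_eqv. Qed.

Lemma SF_const c : obj c -> SF (fun=> c).
Proof.
move=> oc; split=> //.
exact: (S1_const (P := fun e => e 1 = e 0) oc (S1_eqv 1 0)).
Qed.

(** The value of [g] is named by an existential quantifier. As [g] is total and single-valued, this
    serves negated atoms as well as positive ones. *)
Lemma S1_sub (P : env -> V M -> Prop) g : SF g ->
  S1 (fun e => P (tl e) (e 0)) -> S1 (fun e => P e (g e)).
Proof.
move=> [og Sg] SP.
have := S1_ex (P := fun e x => x = g e /\ P e x) KP (S1_and KP Sg SP).
apply: S1_iff => e ve; split=> [Pg|[x _ [-> //]]].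
by exists (g e) => //; exact: og.
Qed.

Lemma SF_sub (F : env -> V M -> V M) g : SF g ->
  SF (fun e => F (tl e) (e 0)) -> SF (fun e => F e (g e)).
Proof.
move=> SG [oF SF']; split.
  move=> e ve; exact: (oF (scons (g e) e) (val_scons (SG.1 _ ve) ve)).
apply: (S1_sub (P := fun e x => e 0 = F (tl e) x)).
  exact: (SF_ren succn SG).
exact: (S1_ren (fun n => match n with 0 => 1 | 1 => 0 | k.+2 => k.+2 end) SF').
Qed.

Lemma SF_app1 (f : V M -> V M) g : SF (fun e => f (e 0)) -> SF g ->
  SF (fun e => f (g e)).
Proof. by move=> Hf Hg; exact: (SF_sub (F := fun e x => f x)). Qed.

Lemma SF_app2 (f : V M -> V M -> V M) g h : SF (fun e => f (e 0) (e 1)) ->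
  SF g -> SF h -> SF (fun e => f (g e) (h e)).
Proof.
move=> Hf Hg Hh; apply: (SF_sub (F := fun e x => f x (h e))) => //.
apply: (SF_sub (F := fun e x => f (e 0) x)); first exact: (SF_ren succn Hh).
exact: (SF_ren (fun n => match n with 0 => 1 | _ => 0 end) Hf).
Qed.

Lemma S1_mem f g : SF f -> SF g -> S1 (fun e => f e ∈ g e).
Proof.
move=> Hf Hg; apply: (S1_sub (P := fun e x => x ∈ g e)) => //.
apply: (S1_sub (P := fun e x => e 0 ∈ x)); first exact: (SF_ren succn Hg).
exact: S1_memv.
Qed.

Lemma S1_nmem f g : SF f -> SF g -> S1 (fun e => ~ f e ∈ g e).
Proof.
move=> Hf Hg; apply: (S1_sub (P := fun e x => ~ x ∈ g e)) => //.
apply: (S1_sub (P := fun e x => ~ e 0 ∈ x)); first exact: (SF_ren succn Hg).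
exact: S1_nmemv.
Qed.

Lemma S1_eq f g : SF f -> SF g -> S1 (fun e => f e = g e).
Proof.
move=> Hf Hg; apply: (S1_sub (P := fun e x => x = g e)) => //.
apply: (S1_sub (P := fun e x => e 0 = x)); first exact: (SF_ren succn Hg).
exact: S1_eqv.
Qed.

Lemma S1_neq f g : SF f -> SF g -> S1 (fun e => f e <> g e).
Proof.
move=> Hf Hg; apply: (S1_sub (P := fun e x => x <> g e)) => //.
apply: (S1_sub (P := fun e x => e 0 <> x)); first exact: (SF_ren succn Hg).
exact: S1_neqv.
Qed.

Lemma S1_set f : SF f -> S1 (fun e => is_set (f e)).
Proof.
move=> Hf; apply: (S1_sub (P := fun e x => is_set x)) => //.
exact/D0_S1/D0_not/D0_ur.
Qed.

Lemma S1_bex (P : env -> V M -> Prop) g : SF g ->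
  S1 (fun e => P (tl e) (e 0)) -> S1 (fun e => exists2 x, x ∈ g e & P e x).
Proof.
move=> Hg HP.
have := S1_ex (P := fun e x => x ∈ g e /\ P e x) KP (S1_and KP _ HP).
move=> /(_ (S1_mem (SF_var 0) (SF_ren succn Hg))).
apply: S1_iff => e ve; split=> [[x xg Px]|[x _ [xg Px]]]; exists x => //.
exact: obj_mem (Hg.1 _ ve) xg.
Qed.

Lemma S1_ball (P : env -> V M -> Prop) g : SF g ->
  S1 (fun e => P (tl e) (e 0)) -> S1 (fun e => forall x, x ∈ g e -> P e x).
Proof.
move=> Hg HP; apply: (S1_sub (P := fun e a => forall x, x ∈ a -> P e x)) => //.
apply: (S1_ball_var 0 (P := fun e x => P (tl e) x)).
exact: (S1_ren (rlift succn) HP).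
Qed.

Lemma SF_upair f g : SF f -> SF g -> SF (fun e => vupair (f e) (g e)).
Proof.
apply: SF_app2; split.
- move=> e ve; have [a aS [xa ya]] := pair_univ KP (ve 0) (ve 1).
  have D : D0 (fun e => e 0 = e 1 \/ e 0 = e 2) by apply: D0_or; exact: D0_eq.
  right; have := D0_sep D ve aS.
  suff -> : vsep a (fun x => scons x e 0 = scons x e 1 \/ scons x e 0 = scons x e 2) =
     vupair (e 0) (e 1) by [].
  apply: vext; [exact: is_set_vsep|exact: is_set_vupair|].
  move=> z; rewrite vmem_vsep vmem_vupair /=; split=> [[]//|].
  by move=> [->|->]; split=> //; [left|right].
- have H : S1 (fun e => [/\ is_set (e 0), e 1 ∈ e 0, e 2 ∈ e 0 &
     forall z, z ∈ e 0 -> z = e 1 \/ z = e 2]).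
    have := S1_and KP (S1_set (SF_var 0)) (S1_and KP (S1_memv 1 0)
      (S1_and KP (S1_memv 2 0) (S1_ball (P := fun e z => z = e 1 \/ z = e 2)
        (SF_var 0) (S1_or (S1_eqv 0 2) (S1_eqv 0 3))))).
    by apply: S1_iff => e ve; split=> [[]|[? [? []]]].
  apply: S1_iff H => e ve; rewrite /tl; split.
    move=> ->; split; [exact: is_set_vupair|..].
    - by apply/vmem_vupair; left.
    - by apply/vmem_vupair; right.
    - by move=> z /vmem_vupair.
  move=> [s0 m1 m2 h]; apply: vext => //; first exact: is_set_vupair.
  move=> z; rewrite vmem_vupair; split; first exact: h.
  by move=> [->|->].
Qed.

Lemma SF_pair f g : SF f -> SF g -> SF (fun e => vpair (f e) (g e)).
Proof. by move=> Hf Hg; apply: SF_upair; exact: SF_upair. Qed.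

Lemma vunion_ur (m : M) : vunion (ur m) = vempty.
Proof.
apply: vext; [exact: is_set_vunion|exact: is_set_vempty|].
move=> z; rewrite vmem_vunion; split=> [[w h _]|h]; [case: (vmem_ur h)|case: (vmem_vempty h)].
Qed.

Lemma SF_union f : SF f -> SF (fun e => vunion (f e)).
Proof.
apply: (SF_app1 (f := @vunion M)); split.
- move=> e ve; case: (ve 0) => [[m ->]|eS].
    by rewrite vunion_ur; exact: obj_empty.
  by apply: obj_univ; exact: union_univ.
- have H : S1 (fun e => [/\ is_set (e 0),
      forall z, z ∈ e 0 -> exists2 w, w ∈ e 1 & z ∈ w &
      forall w, w ∈ e 1 -> forall z, z ∈ w -> z ∈ e 0]).
    have := S1_and KP (S1_set (SF_var 0)) (S1_and KP
      (S1_ball (P := fun e z => exists2 w, w ∈ e 1 & z ∈ w) (SF_var 0)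
         (S1_bex (P := fun e w => e 0 ∈ w) (SF_var 2) (S1_memv 1 0)))
      (S1_ball (P := fun e w => forall z, z ∈ w -> z ∈ e 0) (SF_var 1)
         (S1_ball (P := fun e z => z ∈ e 1) (SF_var 0) (S1_memv 0 2)))).
    by apply: S1_iff => e ve; split=> [[]|[? []]].
  apply: S1_iff H => e ve; rewrite /tl; split.
    move=> ->; split; [exact: is_set_vunion|..].
    - by move=> z /vmem_vunion.
    - by move=> w we z zw; apply/vmem_vunion; exists w.
  move=> [s0 h1 h2]; apply: vext => //; first exact: is_set_vunion.
  move=> z; rewrite vmem_vunion; split; first exact: h1.
  by move=> [w we zw]; exact: h2 zw.
Qed.

Lemma vrep_ur (m : M) (f : V M -> V M) : vrep (ur m) f = vempty.
Proof.
apply: vext; [exact: is_set_vrep|exact: is_set_vempty|].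
move=> z; rewrite vmem_vrep; split=> [[w h _]|h]; [case: (vmem_ur h)|case: (vmem_vempty h)].
Qed.

Lemma SF_rep (F : env -> V M -> V M) g : SF (fun e => F (tl e) (e 0)) -> SF g ->
  SF (fun e => vrep (g e) (F e)).
Proof.
move=> HF Hg; have HF' := HF; case: HF' => oF SF'.
split.
- move=> e ve; case: (Hg.1 _ ve) => [[m ->]|gS].
    by rewrite vrep_ur; exact: obj_empty.
  have [x xa|b [bS h1 h2]] := S1_coll (P := fun e x y => y = F e x) SF' ve gS.
  + exists (F e x) => //; have ox := obj_mem (obj_univ gS) xa.
    exact: (oF (scons x e) (val_scons ox ve)).
  + right; suff -> : vrep (g e) (F e) = b by [].
    apply: vext; [exact: is_set_vrep|exact: univ_sets bS|].
    move=> z; rewrite vmem_vrep; split=> [[x xg ->]|/h2 //].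
    by have [y yb <-] := h1 _ xg.
- have H : S1 (fun e => [/\ is_set (e 0),
      forall z, z ∈ e 0 -> exists2 x, x ∈ g (tl e) & z = F (tl e) x &
      forall x, x ∈ g (tl e) -> exists2 z, z ∈ e 0 & z = F (tl e) x]).
    have Hg' := SF_ren succn Hg.
    have := S1_and KP (S1_set (SF_var 0)) (S1_and KP
      (S1_ball (P := fun e z => exists2 x, x ∈ g (tl e) & z = F (tl e) x) (SF_var 0)
         (S1_bex (P := fun e x => e 0 = F (tl (tl e)) x) (SF_ren succn Hg')
           (S1_eq (SF_var 1) (SF_ren (fun n => if n is k.+1 then k.+3 else 0) HF))))
      (S1_ball (P := fun e x => exists2 z, z ∈ e 0 & z = F (tl e) x) Hg'
         (S1_bex (P := fun e z => z = F (tl (tl e)) (e 0)) (SF_var 1)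
            (S1_eq (SF_var 0) (SF_ren (fun n => if n is k.+1 then k.+3 else 1) HF))))).
    by apply: S1_iff => e ve; split=> [[]|[? []]].
  apply: S1_iff H => e ve; split.
    move=> ->; split; [exact: is_set_vrep|..].
    - by move=> z /vmem_vrep.
    - by move=> w we; exists (F (tl e) w) => //; apply/vmem_vrep; exists w.
  move=> [s0 h1 h2]; apply: vext => //; first exact: is_set_vrep.
  move=> z; rewrite vmem_vrep; split; first exact: h1.
  by move=> [w we ->]; have [? ? <-] := h2 _ we.
Qed.

(** Delta predicates: definition by cases and separation need both a predicate and its negation to
    be Sigma. *)
Definition Del P := S1 P /\ S1 (fun e => ~ P e).

Lemma SF_if P f g : Del P -> SF f -> SF g ->
  SF (fun e => if `[<P e>] then f e else g e).
Proof.
move=> [HP HnP] Hf Hg; split.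
  by move=> e ve; case: ifP => _; [exact: Hf.1|exact: Hg.1].
have H := S1_or (S1_and KP (S1_ren succn HP) (S1_eq (SF_var 0) (SF_ren succn Hf)))
  (S1_and KP (S1_ren succn HnP) (S1_eq (SF_var 0) (SF_ren succn Hg))).
apply: S1_iff H => e ve; case: (asboolP (P (tl e))) => p; split.
- by move=> ->; left.
- by move=> [[]|[]].
- by move=> ->; right.
- by move=> [[]|[]].
Qed.

(** Reduces Delta-separation to replacement and union, by sending each element to its singleton or
    to the empty set. *)
Lemma vsepE a P : vsep a P =
  vunion (vrep a (fun x => if `[<P x>] then vupair x x else vempty)).
Proof.
apply: vext; [exact: is_set_vsep|exact: is_set_vunion|].
move=> z; rewrite vmem_vsep vmem_vunion; split=> [[za Pz]|[w /vmem_vrep[x xa ->]]].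
  exists (vupair z z); last by apply/vmem_vupair; left.
  by apply/vmem_vrep; exists z => //; case: asboolP.
case: asboolP => [Px|_ /vmem_vempty//].
by move=> /vmem_vupair[->|->].
Qed.

Lemma SF_sep (P : env -> V M -> Prop) g : Del (fun e => P (tl e) (e 0)) -> SF g ->
  SF (fun e => vsep (g e) (P e)).
Proof.
move=> HP Hg; under eq_fun do rewrite vsepE.
apply: SF_union; apply: SF_rep => //; apply: SF_if => //.
- by apply: SF_upair; exact: SF_var.
- by apply: SF_const; exact: obj_empty.
Qed.

Lemma Del_mem f g : SF f -> SF g -> Del (fun e => f e ∈ g e).
Proof. by split; [exact: S1_mem|exact: S1_nmem]. Qed.

Lemma Del_eq f g : SF f -> SF g -> Del (fun e => f e = g e).
Proof. by split; [exact: S1_eq|exact: S1_neq]. Qed.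

Lemma Del_not P : Del P -> Del (fun e => ~ P e).
Proof.
move=> [HP HnP]; split=> //; apply: S1_iff HP => e _; split=> [/notP//|].
by move=> p np; exact: np.
Qed.

Lemma Del_and P Q : Del P -> Del Q -> Del (fun e => P e /\ Q e).
Proof.
move=> [HP HnP] [HQ HnQ]; split; first exact: S1_and.
apply: S1_iff (S1_or HnP HnQ) => e _; exact: not_andP.
Qed.

Lemma Del_or P Q : Del P -> Del Q -> Del (fun e => P e \/ Q e).
Proof.
move=> [HP HnP] [HQ HnQ]; split; first exact: S1_or.
apply: S1_iff (S1_and KP HnP HnQ) => e _; exact: not_orP.
Qed.

Lemma Del_bex (P : env -> V M -> Prop) g : SF g ->
  Del (fun e => P (tl e) (e 0)) -> Del (fun e => exists2 x, x ∈ g e & P e x).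
Proof.
move=> Hg [HP HnP]; split; first exact: S1_bex.
apply: S1_iff (S1_ball (P := fun e x => ~ P e x) Hg HnP) => e _.
split=> [h x xg Px|h [x xg Px]]; last exact: h Px.
by apply: h; exists x.
Qed.

Lemma Del_ball (P : env -> V M -> Prop) g : SF g ->
  Del (fun e => P (tl e) (e 0)) -> Del (fun e => forall x, x ∈ g e -> P e x).
Proof.
move=> Hg [HP HnP]; split; first exact: S1_ball.
apply: S1_iff (S1_bex (P := fun e x => ~ P e x) Hg HnP) => e _.
split=> [/existsNP[x /not_implyP[]]|[x xg nP] h]; first by exists x.
exact/nP/h.
Qed.

End Framework2.

Section Framework3.
Variables (M : Type) (L : language) (S : structure M L).
Hypothesis KP : KPU S.
Notation env := (nat -> V M).
Notation obj := (@obj M L S).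
Notation val := (@valuation M L S).
Notation S1 := (@S1 M L S).
Notation SF := (@SF M L S).
Notation Del := (@Del M L S).
Implicit Types (e : env) (x y z a b : V M).

Lemma SF_app3 (f : V M -> V M -> V M -> V M) g h k :
  SF (fun e => f (e 0) (e 1) (e 2)) ->
  SF g -> SF h -> SF k -> SF (fun e => f (g e) (h e) (k e)).
Proof.
move=> Hf Hg Hh Hk; apply: (SF_sub KP (F := fun e x => f x (h e) (k e))) => //.
apply: (SF_sub KP (F := fun e x => f (e 0) x (k (tl e)))).
  exact: (SF_ren succn Hh).
apply: (SF_sub KP (F := fun e x => f (e 1) (e 0) x)).
  exact: (SF_ren (fun n => n.+2) Hk).
exact: (SF_ren (fun n => match n with 0 => 2 | 1 => 1 | _ => 0 end) Hf).
Qed.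

Lemma SF_lam (F : env -> V M -> V M) g : SF g -> SF (fun e => F (tl e) (e 0)) ->
  SF (fun e => vlam (g e) (F e)).
Proof.
move=> Hg HF; apply: (SF_rep KP (F := fun e x => vpair x (F e x))) => //.
apply: SF_pair => //; exact: SF_var.
Qed.

Lemma SF_cup f g : SF f -> SF g -> SF (fun e => vcup (f e) (g e)).
Proof. by move=> Hf Hg; apply: SF_union => //; exact: SF_upair. Qed.

Lemma SF_succ f : SF f -> SF (fun e => vsucc (f e)).
Proof. by move=> Hf; apply: SF_cup => //; exact: SF_upair. Qed.

Lemma SF_rng f : SF f -> SF (fun e => vrng (f e)).
Proof.
apply: (SF_app1 KP (f := @vrng M)).
have U k : SF (fun e => vunion (vunion (e k))).
  by do 2!apply: SF_union => //; exact: SF_var.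
apply: (SF_sep KP (P := fun e y =>
   exists2 x, x ∈ vunion (vunion (e 0)) & vpair x y ∈ e 0)); last exact: (U 0).
apply: (Del_bex KP (P := fun e x => vpair x (e 0) ∈ tl e 0)); first exact: (U 1).
by apply: Del_mem => //; [apply: SF_pair => //|]; exact: SF_var.
Qed.

Lemma SF_app f g : SF f -> SF g -> SF (fun e => vapp (f e) (g e)).
Proof.
apply: (SF_app2 KP (f := @vapp M)).
apply: SF_union => //.
apply: (SF_sep KP (P := fun e y => vpair (e 1) y ∈ e 0)).
  by apply: Del_mem => //; [apply: SF_pair => //|]; exact: SF_var.
by do 2!apply: SF_union => //; exact: SF_var.
Qed.

End Framework3.

(** Proves definability by following the shape of a term or predicate; [tac] is tried first and
    supplies the functions already known to be Sigma. *)
Ltac sdef_with tac := repeat (cbn beta; first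
  [ tac
  | match goal with KP : KPU _ |- _ => first
    [ apply: (SF_pair KP) | apply: (SF_upair KP) | apply: (SF_lam KP)
    | apply: (SF_cup KP) | apply: (SF_succ KP) | apply: (SF_rng KP)
    | apply: (SF_app KP) | apply: (SF_union KP) | apply: (SF_rep KP)
    | apply: (SF_sep KP) | apply: (SF_if KP)
    | apply: (S1_and KP) | apply: S1_or | apply: (S1_bex KP) | apply: (S1_ball KP)
    | apply: (S1_mem KP) | apply: (S1_eq KP) | apply: (S1_nmem KP)
    | apply: (S1_neq KP) | apply: (S1_set KP) | apply: (S1_ex KP)
    | apply: (Del_and KP) | apply: (Del_or KP) | apply: Del_not
    | apply: (Del_bex KP) | apply: (Del_ball KP) | apply: (Del_mem KP)
    | apply: (Del_eq KP) ] end
  | by apply: SF_var | (apply: SF_const; solve [assumption | exact: obj_empty])]).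

(** * Definition by Sigma-recursion along a well-founded predecessor function *)

Section Recursion.
Variables (M : Type) (L : language) (S : structure M L).
Hypothesis KP : KPU S.
Notation env := (nat -> V M).
Notation obj := (@obj M L S).
Notation val := (@valuation M L S).
Notation S1 := (@S1 M L S).
Notation SF := (@SF M L S).
Implicit Types (e : env) (x y z a b c w : V M).

Variables (F : V M -> V M -> V M -> V M) (pred : V M -> V M).
Hypothesis pred_wf : well_founded (fun y x => y ∈ pred x).

(** Predecessors are given by [pred] instead of membership because the copy of omega may consist of
    urelements, whose order is not membership. *)
Definition vrec_body c x (h : forall y, y ∈ pred x -> V M) : V M :=
  F c x (vlam (pred x)
    (fun y => if pselect (y ∈ pred x) is left yx then h y yx else vempty)).

Definition vrec c : V M -> V M := Fix pred_wf (fun=> V M) (@vrec_body c).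

Lemma vrecE c x : vrec c x = F c x (vlam (pred x) (vrec c)).
Proof.
rewrite {1}/vrec Fix_eq => [|{}x h h' hh'].
  rewrite {1}/vrec_body; congr F; apply: eq_vlam => y yx.
  by case: pselect.
rewrite /vrec_body; congr F; apply: eq_vlam => y yx.
by case: pselect.
Qed.

Hypothesis HF : SF (fun e => F (e 0) (e 1) (e 2)).
Hypothesis Hpred : SF (fun e => pred (e 0)).

(** A pair in an approximation is justified by a table [g] of earlier values contained in the same
    approximation. Functionality is not demanded, so unions of approximations are approximations; it
    follows afterwards, in [approxP]. *)
Let stage c w q := exists2 x, obj x & exists2 v, obj v & exists2 g, obj g &
  q = vpair x v /\ (v = F c x g /\ (is_set g /\
  ((forall r, r ∈ g -> r ∈ w /\
     exists2 y, y ∈ pred x & exists2 v', obj v' & r = vpair y v') /\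
   forall y, y ∈ pred x -> exists2 v', obj v' & vpair y v' ∈ g))).

Let approx c w := forall q, q ∈ w -> stage c w q.

Let S1_approx : S1 (fun e => approx (e 0) (e 1)).
Proof.
rewrite /approx /stage.
sdef_with ltac:(first [apply: (SF_app3 KP HF) | apply: (SF_app1 KP Hpred)]).
Qed.

Let approxP c w x v : approx c w -> vpair x v ∈ w -> v = vrec c x.
Proof.
move=> aw; elim/(well_founded_ind pred_wf): x v => x IH v xv.
have [x' _ [v' _ [g _ []]]] := aw _ xv.
move=> /vpair_inj[<- <-] {x' v'} [-> [sg [g1 g2]]].
rewrite vrecE; congr F; apply: vext => //; first exact: is_set_vrep.
have gE r : r ∈ g -> exists2 y, y ∈ pred x & r = vpair y (vrec c y).
  move=> rg; have [rw [y yx [u _ ru]]] := g1 _ rg.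
  by exists y => //; rewrite ru -(IH y yx u) // -ru.
move=> z; rewrite vmem_vlam; split; first exact: gE.
move=> [y yx ->]; have [u _ ug] := g2 _ yx.
by have [y' _ /vpair_inj[<- <-]] := gE _ ug.
Qed.

Let approx_ex c : obj c -> forall x, obj x -> obj (vrec c x) /\
  exists2 w, obj w & approx c w /\ vpair x (vrec c x) ∈ w.
Proof.
move=> oc; elim/(well_founded_ind pred_wf) => x IH ox.
have op : obj (pred x).
  by have := Hpred.1 (fun=> x); apply => n.
have opy y : y ∈ pred x -> obj y by exact: obj_mem.
pose e := scons c (fun=> x).
have ve : val e by case.
have [W [oW aW hW]] : exists W, [/\ obj W, approx c W &
    forall y, y ∈ pred x -> vpair y (vrec c y) ∈ W].
  case: (op) => [[m em]|pS].
    exists vempty; rewrite em; split; [exact: obj_empty|..].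
    - by move=> q qe; case: (vmem_vempty qe).
    - by move=> q qe; case: (vmem_ur qe).
  pose P e y w := approx (e 0) w /\ exists2 v, obj v & vpair y v ∈ w.
  have SP : S1 (fun e => P (tl (tl e)) (e 1) (e 0)).
    rewrite /P; sdef_with ltac:(exact: (S1_ren (fun n => if n is 0 then 2 else 0) S1_approx)).
  have [y yx|b [bS h1 h2]] := S1_coll KP SP ve pS.
    have [oy [w ow [aw yw]]] := IH y yx (opy y yx).
    by exists w => //; split => //; exists (vrec c y).
  exists (vunion b); split.
  - by right; exact: union_univ.
  - move=> q /vmem_vunion[w wb qw].
    have [y yx [aw _]] := h2 _ wb.
    have [u ou [v ov [g og [qe [ve' [sg [g1 g2]]]]]]] := aw _ qw.
    exists u => //; exists v => //; exists g => //; do 3!split=> //.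
    split=> // r /g1[rw hr]; split=> //; apply/vmem_vunion; by exists w.
  - move=> y yx; have [w wb [aw [v ov yv]]] := h1 _ yx.
    by apply/vmem_vunion; exists w => //; rewrite -(approxP aw yv).
have sub z : z ∈ vlam (pred x) (vrec c) -> z ∈ W.
  by move=> /vmem_vlam[y yx ->]; exact: hW.
have og : obj (vlam (pred x) (vrec c)).
  pose e1 := scons W (scons (pred x) (fun=> vempty)).
  have ve1 : val e1 by case=> [|[|n]] //=; exact: obj_empty.
  have sg : SF (fun e => vsep (e 0) (fun r => exists2 y, y ∈ e 1 &
    exists2 v, v ∈ vunion (vunion (e 0)) & r = vpair y v)) by sdef_with fail.
  have := sg.1 _ ve1.
  congr obj; apply: vext; [exact: is_set_vsep|exact: is_set_vrep|].
  move=> z; rewrite vmem_vsep /=; split.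
    move=> [zW [y yx [v _ zyv]]]; rewrite zyv; apply/vpair_vlam; split=> //.
    by apply: (approxP aW); rewrite -zyv.
  move=> zl; split; first exact: sub.
  move: zl => /vmem_vlam[y yx ->]; exists y => //; exists (vrec c y) => //.
  exact: (mem_vpair_field (hW _ yx)).2.
have ov : obj (vrec c x).
  rewrite vrecE; have := HF.1 (scons c (scons x (fun=> vlam (pred x) (vrec c)))).
  by apply; case=> [|[|n]].
split=> //; pose p := vpair x (vrec c x).
have oW' : obj (vcup W (vupair p p)).
  have sg : SF (fun e => vcup (e 0) (vupair (vpair (e 1) (e 2)) (vpair (e 1) (e 2)))).
    by sdef_with fail.
  have := sg.1 (scons W (scons x (fun=> vrec c x))).
  by apply; case=> [|[|n]].
have pW : p ∈ vcup W (vupair p p).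
  by apply/vmem_vcup; right; apply/vmem_vupair; left.
exists (vcup W (vupair p p)) => //; split=> //.
move=> q /vmem_vcup[/aW|qp].
  move=> [u ou [v ov' [g og' [qe [ve' [sg [g1 g2]]]]]]].
  exists u => //; exists v => //; exists g => //; do 3!split=> //.
  by split=> // r /g1[rw hr]; split=> //; apply/vmem_vcup; left.
have -> : q = p by case: (vmem_vupair p p q).1.
exists x => //; exists (vrec c x) => //; exists (vlam (pred x) (vrec c)) => //.
split=> //; split; first by rewrite -vrecE.
split; first exact: is_set_vrep.
split=> [r rl|y yx].
  split; first by apply/vmem_vcup; left; exact: sub.
  move: rl => /vmem_vlam[y yx ->]; exists y => //; exists (vrec c y) => //.
  by have [] := IH y yx (opy y yx).
exists (vrec c y); first by have [] := IH y yx (opy y yx).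
exact/vpair_vlam.
Qed.

Lemma SF_vrec : SF (fun e => vrec (e 0) (e 1)).
Proof.
split; first by move=> e ve; have [] := approx_ex (ve 0) (ve 1).
have H : S1 (fun e => exists2 w, obj w & approx (e 1) w /\ vpair (e 2) (e 0) ∈ w).
  sdef_with ltac:(exact: (S1_ren (fun n => if n is 0 then 2 else 0) S1_approx)).
apply: S1_iff H => e ve; split=> [->|[w ow [aw xw]]].
  by have [_] := approx_ex (ve 1) (ve 2).
exact: approxP aw xw.
Qed.

End Recursion.

(** * Permutations and Baire category *)

Section Permutations.
Local Open Scope group_scope.

Lemma pappM (f g : Sinf) n : papp (f * g) n = papp f (papp g n).
Proof. by []. Qed.

Lemma pappV (f : Sinf) n : papp f^-1 (papp f n) = n.
Proof. exact: (perm_invK f).1. Qed.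

Lemma pappKV (f : Sinf) n : papp f (papp f^-1 n) = n.
Proof. exact: (perm_invK f).2. Qed.

Lemma papp_injective (f : Sinf) : injective (papp f).
Proof. exact: can_inj (pappV f). Qed.

(** The sets of functions agreeing with [g] on an initial segment generate a filter converging
    pointwise to [g], so one of them lies inside any neighbourhood. *)
Lemma Sinf_nbhs (g : Sinf) (W : set Sinf) : nbhs g W ->
  exists N, forall f : Sinf, (forall n, (n < N)%N -> papp f n = papp g n) -> W f.
Proof.
case=> _ [[B oB <-] Bg BW].
pose F : set_system {ptws nat -> nat} := filter_from [set: nat]
  (fun N => [set h | forall n, (n < N)%N -> h n = papp g n]).
have FF : Filter F.
  apply: filter_from_filter; first by exists 0.
  move=> i j _ _; exists (maxn i j) => // h hh; split=> n ni; apply: hh.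
    by rewrite leq_max ni.
  by rewrite leq_max ni orbT.
have cF : {ptws, F --> papp g}.
  apply/pointwise_cvgP => t W' /nbhs_singleton W't.
  by exists t.+1 => // h /= ->.
have : nbhs (papp g : {ptws nat -> nat}) B by apply: open_nbhs_nbhs.
move=> /cF[N _ NB]; exists N => f fg; apply: BW; exact: NB.
Qed.

End Permutations.

(** * Actions of closed subgroups and the category quantifier *)

Section Actions.
Local Open Scope group_scope.
Variables (G : set Sinf) (Gsub : subgroup G) (Gcl : closed G).
Variables (X : topologicalType) (act : Sinf -> X -> X).
Hypothesis actC : continuous_action G act.

Let G1 : G 1. Proof. by case: Gsub. Qed.
Let GM f g : G f -> G g -> G (f * g). Proof. by case: Gsub => _ + _; exact. Qed.
Let GV f : G f -> G f^-1. Proof. by case: Gsub => _ _; exact. Qed.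

(** [G] is closed among permutations, not among all functions, so a pointwise limit has to be onto
    before closedness applies: this is why preimages are required to stabilise too. *)
Lemma perm_limit (f : nat -> Sinf) (g : nat -> nat) : (forall i, G (f i)) ->
  (forall i j, (i < j)%N -> papp (f j) i = g i) ->
  (forall n, exists m N, forall j, (N <= j)%N -> papp (f j) m = n) ->
  exists2 h, G h & forall n, papp h n = g n.
Proof.
move=> Gf fg fs.
have gi : injective g.
  move=> i j gij; apply: (@papp_injective (f (maxn i j).+1)).
  by rewrite !fg ?ltnS ?leq_maxl ?leq_maxr.
have gs n : exists m, g m = n.
  have [m [N h]] := fs n; exists m; rewrite -(fg m (maxn m.+1 N)) ?leq_maxl //.
  by rewrite h // leq_maxr.
pose g' n := sval (cid (gs n)).
have gg' : cancel g' g by move=> n; rewrite /g'; case: cid.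
have g'g : cancel g g' by move=> n; apply: gi; rewrite gg'.
exists (mkperm (Bijective g'g gg')) => //.
rewrite (closure_id G).1 //= => W /Sinf_nbhs[N hN].
by exists (f N); split=> //; apply: hN => n nN; rewrite fg.
Qed.

Definition Vst (c : seq nat) : set Sinf :=
  [set f | G f /\ forall n, n \in c -> papp f n = n].

Lemma Vst_G c f : Vst c f -> G f. Proof. by case. Qed.

Lemma Vst1 c : Vst c 1. Proof. by split. Qed.

Lemma VstM c f g : Vst c f -> Vst c g -> Vst c (f * g).
Proof.
move=> [Gf fc] [Gg gc]; split=> [|n nc]; first exact: GM.
by rewrite pappM gc // fc.
Qed.

Lemma VstS c c' : {subset c <= c'} -> Vst c' `<=` Vst c.
Proof. by move=> cc' f [Gf fc]; split=> // n /cc'; exact: fc. Qed.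

Lemma actM f g x : G f -> G g -> act (f * g) x = act f (act g x).
Proof. exact: actionM. Qed.

Lemma actK f x : G f -> act f^-1 (act f x) = x.
Proof. by move=> Gf; rewrite -actM ?mulVg ?(action1 actC) //; exact: GV. Qed.

Let act_cvg g x (U : set X) : G g -> open U -> U (act g x) ->
  exists2 W : set Sinf * set X, nbhs g W.1 /\ nbhs x W.2 &
    forall h z, G h -> W.1 h -> W.2 z -> U (act h z).
Proof.
move=> Gg oU Ugx; have /subspace_continuousP := action_continuous actC.
move=> /(_ (g, x) (conj Gg I) U) [|W nW sW]; first exact: open_nbhs_nbhs.
exists W => // h z Gh Wh Wz.
by apply: (sW (h, z)).
Qed.

Lemma act_near g x (U : set X) : G g -> open U -> U (act g x) ->
  exists c, forall k, Vst c k -> U (act k (act g x)).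
Proof.
move=> Gg oU Ugx; have [[W1 W2] [/= n1 n2] h] := act_cvg Gg oU Ugx.
(* [k * g] agrees with [g] below [N] as soon as [k] fixes the images under [g] of the numbers below
   [N]. *)
have [N hN] := Sinf_nbhs n1; exists [seq papp g n | n <- iota 0 N] => k [Gk kc].
rewrite -actM //; apply: h; [exact: GM| |exact: nbhs_singleton].
apply: hN => n nN; rewrite pappM kc //; apply: map_f.
by rewrite mem_iota.
Qed.

Lemma act_closure g (E : set X) z : G g -> closure E z ->
  closure (act g @` E) (act g z).
Proof.
move=> Gg Ez W; rewrite nbhsE => -[U [oU Uz] UW].
have [[W1 W2] [/= n1 n2] h] := act_cvg Gg oU Uz.
have [w [Ew ww]] := Ez _ n2; exists (act g w); split; first by exists w.
by apply: UW; apply: h => //; exact: nbhs_singleton.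
Qed.

Definition orb c u : set X := [set act f u | f in Vst c].

Lemma orb_trans c u v w : orb c u v -> orb c v w -> orb c u w.
Proof.
move=> [f Vf <-] [g Vg <-]; exists (g * f); first exact: VstM.
by rewrite actM //; [exact: Vst_G Vg|exact: Vst_G Vf].
Qed.

Lemma orb_closure c u v f : Vst c f -> closure (orb c u) v ->
  closure (orb c u) (act f v).
Proof.
move=> Vf /(act_closure (Vst_G Vf)); apply: closure_subset.
move=> _ [w uw <-]; apply: orb_trans uw _; by exists f.
Qed.

(* Vaught's category quantifier: [act f u] is in [B] for comeagerly many [f] in
   [Vst c].  The sets [h * (k * f)], with [h] in [Vst c''], form a basis. *)
Definition ddense c (d : set Sinf) : Prop :=
  forall f c', Vst c f -> {subset c <= c'} -> exists k c'',
    [/\ Vst c' k, {subset c' <= c''} & forall h, Vst c'' h -> d (h * (k * f))].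

Definition frc c u (B : set X) : Prop := exists D : set (set Sinf),
  [/\ countable D, forall d, D d -> ddense c d &
      forall f, Vst c f -> (forall d, D d -> d f) -> B (act f u)].

Lemma frcS c u B C : B `<=` C -> frc c u B -> frc c u C.
Proof. by move=> BC [D [cD dD h]]; exists D; split=> // f Vf /h-/(_ Vf)/BC. Qed.

Lemma frc_full c u (B : set X) : (forall f, Vst c f -> B (act f u)) -> frc c u B.
Proof. by move=> h; exists set0; split=> // f Vf _; exact: h. Qed.

(** A comeager set stays comeager in every basic open coset [Vst c' * f]; right translation by [f]
    carries the witnessing family to [Vst c']. *)
Lemma frc_sub c u B f c' : frc c u B -> Vst c f -> {subset c <= c'} ->
  frc c' (act f u) B.
Proof.
move=> [D [cD dD h]] Vf cc'.
exists [set [set k | d (k * f)] | d in D]; split.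
- exact: card_le_trans (card_image_le _ _) cD.
- move=> _ [d Dd <-] g c1 Vg c1c.
  have [k [c2 [Vk c12 hk]]] := dD _ Dd (g * f) c1 (VstM (VstS cc' Vg) Vf)
    (fun n nc => c1c _ (cc' _ nc)).
  by exists k, c2; split=> // h' Vh'; rewrite /= -!mulgA; exact: hk.
- move=> g Vg hg; rewrite -actM; [|exact: Vst_G Vg|exact: Vst_G Vf].
  apply: h; first by apply: VstM => //; exact: VstS cc' _ Vg.
  by move=> d Dd; apply: (hg [set k | d (k * f)]); exists d.
Qed.

Lemma frc_bigcap c u (F : nat -> set X) : (forall n, frc c u (F n)) ->
  frc c u (\bigcap_n F n).
Proof.
move=> /choice[D hD]; exists (\bigcup_n D n); split.
- by apply: bigcup_countable => // n _; case: (hD n).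
- by move=> d [n _ Dd]; case: (hD n) => _ h _; exact: h.
- move=> f Vf hf n _; case: (hD n) => _ _; apply=> // d Dd; apply: hf.
  by exists n.
Qed.

Lemma baire c u B : frc c u B -> exists2 f, Vst c f & B (act f u).
Proof.
move=> [D [/countable_injP[e einj] dD hB]].
pose T := (Sinf * seq nat)%type.
pose ok (s : T) := Vst c s.1 /\ {subset c <= s.2}.
(* Step [i] meets the dense set numbered [i] and freezes both [i] and its current image. Later
   factors act on the left and fix these two points, so the image and the preimage of [i] no longer
   change. *)
pose next i (s s' : T) := [/\ ok s', {subset s.2 <= s'.2},
   exists2 k, Vst s.2 k & s'.1 = k * s.1,
   i \in s'.2 /\ papp s'.1 i \in s'.2 &
   forall d, D d -> e d = i -> forall h, Vst s'.2 h -> d (h * s'.1)].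
have step (p : nat * T) : exists s', ok p.2 -> next p.1 p.2 s'.
  have [[Vs cs]|] := pselect (ok p.2); last by exists p.2.
  case: p Vs cs => i [f c1] /= Vs cs.
  have [k [c2 [Vk c12 hk]]] : exists k c2, [/\ Vst c1 k, {subset c1 <= c2} &
     forall d, D d -> e d = i -> forall h, Vst c2 h -> d (h * (k * f))].
    have [[d [Dd di]]|no] := pselect (exists d, D d /\ e d = i).
      have [k [c2 [? ? hk]]] := dD _ Dd f c1 Vs cs; exists k, c2; split=> //.
      move=> d' Dd' d'i; have -> // : d' = d.
      by apply: einj; rewrite ?inE // di.
    exists 1, c1; split=> //.
    by move=> d Dd di; case: no; exists d.
  exists (k * f, [:: i, papp (k * f) i & c2]) => _.
  have c23 : {subset c2 <= [:: i, papp (k * f) i & c2]}.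
    by move=> n nc; rewrite !inE nc !orbT.
  split=> /=.
  - split; first by apply: VstM => //; exact: VstS cs _ Vk.
    by move=> n /cs/c12/c23.
  - by move=> n /c12/c23.
  - by exists k.
  - by rewrite !inE !eqxx orbT.
  - move=> d Dd di h Vh; apply: hk => //; exact: VstS Vh.
have [F hF] := choice step.
pose s := fix s i := if i is j.+1 then F (j, s j) else ((1 : Sinf), c).
have oks i : ok (s i).
  elim: i => [|i IH]; first by split=> //; exact: Vst1.
  by have [] := hF (i, s i) IH.
have nx i : next i (s i) (s i.+1) by exact: (hF (i, s i) (oks i)).
have mono i j : (i <= j)%N -> {subset (s i).2 <= (s j).2} /\
   exists2 k, Vst (s i).2 k & (s j).1 = k * (s i).1.
  elim: j => [|j IH]; first rewrite leqn0 => /eqP->.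
    by split=> [n|] //; exists 1; [exact: Vst1|rewrite mul1g].
  rewrite leq_eqVlt => /predU1P[->|/IH[sub [k Vk sk]]].
    by split=> [n|] //; exists 1; [exact: Vst1|rewrite mul1g].
  have [_ sub' [k' Vk' sk'] _ _] := nx j; split; first by move=> n /sub/sub'.
  exists (k' * k); last by rewrite sk' sk mulgA.
  by apply: VstM => //; exact: VstS sub _ Vk'.
have [g Gg gE] : exists2 g, G g & forall n, papp g n = papp (s n.+1).1 n.
  apply: (perm_limit (f := fun i => (s i).1)).
  - by move=> i; case: (oks i) => /Vst_G.
  - move=> i j ij; have [_ [k [_ Vk] ->]] := mono _ _ ij.
    by rewrite pappM Vk //; have [_ _ _ []] := nx i.
  - move=> n; exists (papp (s n.+1).1^-1 n), n.+1 => j nj.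
    have [_ [k [_ Vk] ->]] := mono _ _ nj.
    by rewrite pappM pappKV Vk //; have [_ _ _ []] := nx n.
have gs i : exists2 h, Vst (s i).2 h & g = h * (s i).1.
  exists (g * (s i).1^-1); last by rewrite -mulgA mulVg mulg1.
  split=> [|n ni]; first by apply: GM => //; apply: GV; case: (oks i) => /Vst_G.
  rewrite pappM gE; set m := papp _ n.
  have [_ [k [_ kc]]] := mono _ _ (leq_maxl i m.+1).
  have [_ [k' [_ kc']]] := mono _ _ (leq_maxr i m.+1).
  move=> E1 E2; have : papp (s (maxn i m.+1)).1 m = papp (s m.+1).1 m.
    by rewrite E1 pappM kc' //; have [_ _ _ []] := nx m.
  move=> <-; rewrite E2 pappM pappKV kc //.
have Vg : Vst c g.
  have [h Vh ->] := gs 0; apply: VstM; last by case: (oks 0).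
  by apply: VstS Vh; case: (oks 0).
exists g => //; apply: hB => // d Dd.
have [_ _ _ _ /(_ d Dd erefl) hd] := nx (e d).
by have [h Vh ->] := gs (e d).+1; exact: hd.
Qed.

Lemma frc_baireN c u B : frc c u B -> ~ frc c u (~` B).
Proof.
move=> [D [cD dD h]] [D' [cD' dD' h']].
have [|f Vf []//] := @baire c u (B `&` ~` B).
exists (D `|` D'); split.
- exact: countable_setU.
- by move=> d [/dD|/dD'].
- move=> f Vf hf; split; [apply: h|apply: h'] => // d dd; apply: hf;
  by [left|right].
Qed.

(* The cosets [Vst c'' * g] are countably many, which lets one glue local
   comeagreness. *)
Lemma frc_local c u B :
  (forall f c', Vst c f -> {subset c <= c'} -> exists k c'',
     [/\ Vst c' k, {subset c' <= c''} & frc c'' (act (k * f) u) B]) ->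
  frc c u B.
Proof.
move=> loc.
(* The coset [Vst c' * g] consists of the members of [G] sending [g^-1 n] to [n] for [n] in [c'].
   This finite list labels it, so there are countably many cosets, and one witnessing family is
   chosen for each label. *)
pose wit (s : seq (nat * nat)) (p : Sinf * seq nat * set (set Sinf)) :=
  let: (g, c', D) := p in
  [/\ Vst c g, {subset c <= c'}, s = [seq (papp g^-1 n, n) | n <- c'],
      countable D /\ (forall d, D d -> ddense c' d) &
      forall f, Vst c' f -> (forall d, D d -> d f) -> B (act f (act g u))].
have /choice[w hw] s : exists p, (exists p', wit s p') -> wit s p.
  have [[p hp]|no] := pselect (exists p, wit s p).
    by exists p.
  by exists (1, [::], set0) => /no.
pose ext (s : seq (nat * nat)) : set Sinf := [set f | forall p, p \in s -> papp f p.1 = p.2].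
pose good s := exists p, wit s p.
pose d0 : set Sinf := [set f | exists2 s, good s & ext s f].
pose Ds (s : seq (nat * nat)) : set (set Sinf) :=
  [set [set f | ext s f -> d (f * (w s).1.1^-1)] | d in (w s).2].
(* [d0] says that some good coset contains the permutation; a member of [Ds s] imposes its dense set
   only inside the coset labelled [s]. *)
exists (d0 |` \bigcup_(s in good) Ds s); split.
- apply: countable_setU; first exact: countable1.
  apply: bigcup_countable => [|s /hw]; first exact: countableP.
  rewrite /Ds; case: (w s) => -[g c'] D [_ _ _ [cD _] _] /=.
  exact: card_le_trans (card_image_le _ _) cD.
- move=> d [->|[s gs [d' + <-]]].
  + move=> f c' Vf cc'; have [k [c'' [Vk c12 [D [cD dD h]]]]] := loc f c' Vf cc'.
    exists k, c''; split=> // h' Vh'.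
    exists [seq (papp (k * f)^-1 n, n) | n <- c''].
      exists (k * f, c'', D); split=> //.
        by apply: VstM => //; exact: VstS cc' _ Vk.
      by move=> n /cc'/c12.
    move=> _ /mapP[n nc ->] /=.
    by rewrite pappM pappKV; case: Vh' => _; exact.
  + have := hw _ gs; case: (w s) => -[g c'] D [Vg cc' sE [_ dD] _] /= Dd'.
    move=> f c1 Vf cc1.
    have [sf|/existsNP[p /not_implyP[ps nfp]]] := pselect (ext s f).
    * have Vfg : Vst c' (f * g^-1).
        split=> [|n nc]; first by apply: GM; [exact: Vst_G Vf|exact/GV/Vst_G/Vg].
        by rewrite pappM (sf (papp g^-1 n, n)) // sE; apply/mapP; exists n.
      have [|k [c2 [Vk c12 hk]]] := dD _ Dd' (f * g^-1) (c' ++ c1) Vfg.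
        by move=> n nc; rewrite mem_cat nc.
      exists k, c2; split.
      - by apply: VstS Vk => n nc; rewrite mem_cat nc orbT.
      - by move=> n nc; apply: c12; rewrite mem_cat nc orbT.
      - by move=> h Vh _; have := hk h Vh; rewrite !mulgA.
    (* Outside the coset the condition is vacuous, and fixing the wrong value of [f] at [p.1] keeps
       all refinements outside. *)
    * exists 1, (papp f p.1 :: c1); split; first exact: Vst1.
      - by move=> n nc; rewrite inE nc orbT.
      - move=> h [_ Vh] /(_ _ ps); rewrite mul1g pappM Vh ?mem_head //.
- move=> f Vf hf.
  have [s gs sf] : d0 f by apply: hf; left.
  have := hw _ gs.
  have : forall d, (w s).2 d -> d (f * (w s).1.1^-1).
    move=> d wd; have : [set f | ext s f -> d (f * (w s).1.1^-1)] f.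
      by apply: hf; right; exists s => //; exists d.
    by apply.
  case: (w s) => -[g c'] D /= hd [Vg cc' sE _ hB].
  have Vfg : Vst c' (f * g^-1).
    split=> [|n nc]; first by apply: GM; [exact: Vst_G Vf|exact/GV/Vst_G/Vg].
    by rewrite pappM (sf (papp g^-1 n, n)) // sE; apply/mapP; exists n.
  have := hB _ Vfg hd.
  rewrite -actM; [|exact: Vst_G Vfg|exact: Vst_G Vg].
  by rewrite -mulgA mulVg mulg1.
Qed.

(** Every basic coset contains a smaller one that decides [E], with one of [E] and its complement
    comeager there. *)
Definition baire_property (E : set X) : Prop := forall c u, exists f c',
  [/\ Vst c f, {subset c <= c'} & frc c' (act f u) E \/ frc c' (act f u) (~` E)].

Lemma baire_property_open U : open U -> baire_property U.
Proof.
move=> oU c u.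
have [[f [Vf Uf]]|no] := pselect (exists f, Vst c f /\ U (act f u)).
  have [c' hc'] := act_near (Vst_G Vf) oU Uf.
  exists f, (c ++ c'); split=> // [n nc|]; first by rewrite mem_cat nc.
  left; apply: frc_full => k Vk; apply: hc'.
  by apply: VstS Vk => n nc; rewrite mem_cat nc orbT.
exists 1, c; split=> //.
right; apply: frc_full => f Vf Uf; apply: no; exists f; split=> //.
by rewrite (action1 actC) in Uf.
Qed.

(** If no coset forced any [F n], deciding would always force the complement. These local facts glue
    by [frc_local], and the countable intersection of the complements would be forced. *)
Lemma frc_bigcup_ex c u (F : nat -> set X) :
  (forall n, baire_property (~` F n)) -> ~ frc c u (~` \bigcup_n F n) ->
  exists f c' n, [/\ Vst c f, {subset c <= c'} & frc c' (act f u) (F n)].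
Proof.
move=> bp; apply: contra_notP => no; rewrite setC_bigcup.
apply: frc_bigcap => n; apply: frc_local => f c' Vf cc'.
have [k [c'' [Vk c12 H]]] := bp n c' (act f u).
have Vk' : Vst c k by exact: VstS cc' _ Vk.
rewrite -actM in H; [|exact: Vst_G Vk|exact: Vst_G Vf].
exists k, c''; split=> //; case: H => //; rewrite setCK => H; case: no.
exists (k * f), c'', n; split=> //; first exact: VstM.
by move=> m /cc'/c12.
Qed.

Lemma baire_property_bigcup (F : nat -> set X) :
  (forall n, baire_property (~` F n)) -> baire_property (\bigcup_n F n).
Proof.
move=> bp c u.
have [|] := pselect (frc c u (~` \bigcup_n F n)).
  move=> H; exists 1, c; split=> //.
  by right; rewrite (action1 actC).
move=> /(frc_bigcup_ex bp)[f [c' [n [Vf cc' H]]]].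
exists f, c'; split=> //; left; apply: frcS H => x Fx; by exists n.
Qed.

(** * Back-and-forth games and Borel classes *)

Section Game.
Variable M : Type.

Lemma Sigma0_inv (a : V M) (B : set X) : Sigma0 a B ->
  (a = vone /\ open B) \/
  exists F : nat -> set X, B = \bigcup_n F n /\
    forall n, exists2 b, b ∈ a & Sigma0 b (~` F n).
Proof. by case=> [U oU|{}a F _ _ hF]; [left|right; exists F]. Qed.

Lemma Sigma0_baire (a : V M) (B : set X) : Sigma0 a B -> baire_property B.
Proof.
elim/(well_founded_ind (@vmem_wf M)): a B => a IH B.
case/Sigma0_inv => [[_ oB]|[F [-> hF]]]; first exact: baire_property_open.
by apply: baire_property_bigcup => n; have [b ba] := hF n; exact: IH.
Qed.

(** The closure clause is one-sided because the approximations know the orbit of [x] but not that of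
    [y]. The opposite direction is recovered one move later, using regularity of the space. *)
Inductive game : V M -> seq nat -> X -> X -> Prop :=
| Game a c u v : closure (orb c u) v ->
    (forall b c', b ∈ a -> {subset c <= c'} ->
      (forall u', orb c u u' -> exists2 v', orb c v v' & game b c' u' v') /\
      (forall v', orb c v v' -> exists2 u', orb c u u' & game b c' u' v')) ->
    game a c u v.

Hypothesis reg : forall (U : set X) z, open U -> U z ->
  exists W, [/\ open W, W z & closure W `<=` U].

Lemma game_inv a c u v : game a c u v -> closure (orb c u) v /\
    (forall b c', b ∈ a -> {subset c <= c'} ->
      (forall u', orb c u u' -> exists2 v', orb c v v' & game b c' u' v') /\
      (forall v', orb c v v' -> exists2 u', orb c u u' & game b c' u' v')).
Proof. by case. Qed.

Lemma open_local c u f (U : set X) : open U -> Vst c f -> U (act f u) ->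
  exists2 c', {subset c <= c'} & forall k, Vst c' k -> U (act k (act f u)).
Proof.
move=> oU Vf Uf; have [c' hc'] := act_near (Vst_G Vf) oU Uf.
exists (c ++ c') => [n nc|k Vk]; first by rewrite mem_cat nc.
by apply: hc'; apply: VstS Vk => n nc; rewrite mem_cat nc orbT.
Qed.

Lemma frc_open_contra c u f (U : set X) : open U -> Vst c f -> U (act f u) ->
  ~ frc c u (~` U).
Proof.
move=> oU Vf Uf fU; have [c' cc' hc'] := open_local oU Vf Uf.
have [k Vk] := baire (frc_sub fU Vf cc').
by apply; exact: hc'.
Qed.

(** A set may be undecided by a coset, so the claim only excludes opposite decisions. Both
    polarities are carried along because the pieces of a [Sigma0] union are complements of sets of
    lower class. *)
Lemma game_transfer (a : V M) c u v (B : set X) : game a c u v -> Sigma0 a B ->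
  ~ (frc c u B /\ frc c v (~` B)) /\ ~ (frc c u (~` B) /\ frc c v B).
Proof.
elim/(well_founded_ind (@vmem_wf M)): a c u v B => a IH c u v B.
move=> /game_inv[cl st] /Sigma0_inv[[a1 oB]|[F [-> hF]]]; split=> -[f1 f2].
- have [f Vf Bf] := baire f1.
  (* The single move available when [a] is [vone] is spent here: a coset of [f] keeps the orbit of
     [act f u] in [W], so the reply lies in the closure of [W], hence in [B]. *)
  have [W [oW Wf clW]] := reg oB Bf.
  have [c' cc' hc'] := open_local oW Vf Wf.
  have ea : vempty ∈ a.
    by rewrite a1; apply/(vmem_vset (fun b : bool => if b then vempty else vempty)); exists true.
  have [forth _] := st vempty c' ea cc'.
  have [|v' [h Vh <-] /game_inv[clv _]] := forth (act f u); first by exists f.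
  apply: frc_open_contra oB Vh _ f2; apply: clW; apply: closure_subset clv.
  by move=> _ [k Vk <-]; exact: hc'.
- have [f Vf Bf] := baire f2.
  have nB : nbhs (act f v) B by exact: open_nbhs_nbhs.
  have [_ [[k Vk <-] Bk]] := orb_closure Vf cl nB.
  exact: frc_open_contra oB Vk Bk f1.
- have bp n : baire_property (~` F n) by have [b _ /Sigma0_baire] := hF n.
  have [f [c' [n [Vf cc' Fn]]]] := frc_bigcup_ex bp (frc_baireN f1).
  have [b ba sF] := hF n.
  have [forth _] := st b c' ba cc'.
  have [|v' [h Vh <-] g] := forth (act f u); first by exists f.
  have [_] := IH b ba _ _ _ _ g sF; apply; rewrite setCK; split=> //.
  apply: frcS (frc_sub f2 Vh cc') => x; rewrite setC_bigcup; exact.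
- have bp n : baire_property (~` F n) by have [b _ /Sigma0_baire] := hF n.
  have [f [c' [n [Vf cc' Fn]]]] := frc_bigcup_ex bp (frc_baireN f2).
  have [b ba sF] := hF n.
  have [_ back] := st b c' ba cc'.
  have [|u' [h Vh <-] g] := back (act f v); first by exists f.
  have [+ _] := IH b ba _ _ _ _ g sF; apply; rewrite setCK; split=> //.
  apply: frcS (frc_sub f1 Vh cc') => x; rewrite setC_bigcup; exact.
Qed.

Lemma game_invariant (a : V M) u v (B : set X) : game a [::] u v -> Sigma0 a B ->
  invariant_under act G B -> (B u <-> B v).
Proof.
move=> g sB iB; have [h1 h2] := game_transfer g sB.
have fB w : B w -> frc [::] w B.
  by move=> Bw; apply: frc_full => f /Vst_G Gf; exact: iB.
have fnB w : ~ B w -> frc [::] w (~` B).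
  move=> nBw; apply: frc_full => f /Vst_G Gf Bf; apply: nBw.
  by rewrite -(actK w Gf); apply: iB => //; exact: GV.
split=> [Bu|Bv]; apply: contrapT => nB.
- by apply: h1; split; [exact: fB|exact: fnB].
- by apply: h2; split; [exact: fnB|exact: fB].
Qed.

End Game.
End Actions.

(** * Approximations to an orbit *)

Section Polish.
Import Order.TTheory GRing.Theory Num.Theory.

Lemma polish_regular (R : realType) (X : topologicalType) : polish R X ->
  forall (U : set X) z, open U -> U z ->
  exists W, [/\ open W, W z & closure W `<=` U].
Proof.
move=> [_ [d [d0 ds dt nb _]]] U z oU Uz.
have := open_nbhs_nbhs (conj oU Uz); rewrite nb => -[r /= r0 rU].
have r20 : (0 < r / 2)%R by rewrite divr_gt0.
have ballN w : nbhs w [set v | (d w v < r / 2)%R] by rewrite nb; exists (r / 2)%R.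
exists [set v | (d z v < r / 2)%R]°; split; first exact: open_interior.
- exact: ballN.
- move=> w /(_ _ (ballN w))[v [/interior_subset /= zv wv]].
  apply: rU; apply: le_lt_trans (dt _ v _) _.
  by rewrite (splitr r) ltrD // ds.
Qed.

Lemma polish_separated (R : realType) (X : topologicalType) : polish R X ->
  forall z y : X, z <> y -> exists W, [/\ open W, W z & ~ closure W y].
Proof.
move=> pX z y zy; have [_ [d [d0 ds dt nb _]]] := pX.
have dz w : (0 <= d w y)%R.
  have := dt w y w; rewrite (d0 w w).2 // (ds y w) -mulr2n => h.
  by rewrite -(pmulrn_lge0 _ (n := 2)) // h.
have r0 : (0 < d z y)%R.
  by rewrite lt_neqAle dz andbT eq_sym; apply/eqP => /d0.
have nz : nbhs z [set v | (d z v < d z y)%R] by rewrite nb; exists (d z y).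
have [|W [oW Wz cW]] := polish_regular pX (open_interior [set v | (d z v < d z y)%R]) (z := z).
  exact: nz.
exists W; split=> // /cW/interior_subset /=; by rewrite ltxx.
Qed.

End Polish.

(** * Transfinite approximations and the games they win *)

Section PartialMaps.
Local Open Scope group_scope.
Variables (G : set Sinf) (Gsub : subgroup G) (Gcl : closed G).
Variables (X : topologicalType) (act : Sinf -> X -> X).
Hypothesis actC : continuous_action G act.
Variables (M : Type) (x : X).
Implicit Types (s : set (nat * nat)) (a b c : V M) (z : X).

Let G1 : G 1. Proof. by case: Gsub. Qed.
Let GM f g : G f -> G g -> G (f * g). Proof. by case: Gsub => _ + _; exact. Qed.
Let GV f : G f -> G f^-1. Proof. by case: Gsub => _ _; exact. Qed.

Definition porb s : set X := [set act f x | f in VG G s].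

Definition ext s n m m' k : set (nat * nat) := s `|` [set (n, m); (m', k)].

(* Transfinite approximations, from the side of [x], of the set of those
   [act f x'] for which [x'] looks like [x] and [f] extends [s].  They only refer
   to the orbit of [x], so that they can be coded from [F1_graph x]. *)
Inductive Bst : V M -> set (nat * nat) -> X -> Prop :=
| Bst_intro b s z : closure (porb s) z ->
    (forall c n k, c ∈ b -> exists m m', Bst c (ext s n m m' k) z) -> Bst b s z.

Lemma BstE b s z : Bst b s z <-> closure (porb s) z /\
  forall c n k, c ∈ b -> exists m m', Bst c (ext s n m m' k) z.
Proof. by split=> [[]|[cl h]] //; exact: Bst_intro. Qed.

Lemma Bst_closure b s z : Bst b s z -> closure (porb s) z.
Proof. by case/BstE. Qed.

Lemma Bst_anti b b' s z : (forall c, c ∈ b -> c ∈ b') -> Bst b' s z -> Bst b s z.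
Proof.
by move=> bb' /BstE[cl h]; apply/BstE; split=> // c n k /bb'; exact: h.
Qed.

Lemma VG_sub s s' : s `<=` s' -> VG G s' `<=` VG G s.
Proof. by move=> ss' f [Gf fs]; split=> // p /ss'; exact: fs. Qed.

Lemma porb_sub s s' : s `<=` s' -> porb s' `<=` porb s.
Proof. by move=> ss' _ [f /(VG_sub ss') Vf <-]; exists f. Qed.

Lemma Bst_mono b s s' z : s `<=` s' -> Bst b s' z -> Bst b s z.
Proof.
elim/(well_founded_ind (@vmem_wf M)): b s s' => b IH s s' ss' /BstE[cl h].
apply/BstE; split; first exact: closure_subset (porb_sub ss') _ cl.
move=> c n k cb; have [m [m' B]] := h c n k cb; exists m, m'.
by apply: IH B => //; apply: setSU.
Qed.

Lemma Bst_sub c b s z : c ∈ b -> Bst b s z -> Bst c s z.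
Proof.
move=> cb /BstE[_ h]; have [m [m' B]] := h c 0 0 cb.
by apply: Bst_mono B; exact: subsetUl.
Qed.

Definition shift f s : set (nat * nat) := [set (p.1, papp f p.2) | p in s].

Lemma closure_shift f s z : G f -> closure (porb s) z ->
  closure (porb (shift f s)) (act f z).
Proof.
move=> Gf /(act_closure actC Gf); apply: closure_subset.
move=> _ [_ [g [Gg gs] <-] <-]; exists (f * g); last by rewrite (actM actC).
split=> [|_ [p ps <-]]; first exact: GM.
by rewrite pappM /= gs.
Qed.

Lemma Bst_shift b s z f : G f -> Bst b s z -> Bst b (shift f s) (act f z).
Proof.
move=> Gf; elim/(well_founded_ind (@vmem_wf M)): b s => b IH s /BstE[cl h].
apply/BstE; split; first exact: closure_shift.
move=> c n k cb; have [m [m' B]] := h c n (papp f^-1 k) cb.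
exists (papp f m), m'; move: (IH _ cb _ B); apply: Bst_mono.
move=> p [[q sq <-]|[->|->]].
- by exists q => //; left.
- by exists (n, m) => //; right; left.
- by exists (m', papp f^-1 k); [right; right|rewrite /= pappKV].
Qed.

Lemma Bst_refl b s f : VG G s f -> Bst b s (act f x).
Proof.
elim/(well_founded_ind (@vmem_wf M)): b s => b IH s Vf.
apply/BstE; split; first by apply: subset_closure; exists f.
move=> c n k cb; exists (papp f n), (papp f^-1 k); apply: IH => //.
case: Vf => Gf fs; split=> // p [/fs//|[->|->]] //=; exact: pappKV.
Qed.

Lemma Bst_invariant b : invariant_under act G (Bst b set0).
Proof.
move=> f z Gf /(Bst_shift Gf); rewrite /shift image_set0; exact.
Qed.

Lemma closure_VG s z : closure (porb s) z -> exists g, VG G s g.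
Proof. by move=> /(_ setT filterT)[_ [[g Vg _] _]]; exists g. Qed.

(** Each pair of [l] costs one stage of a descending chain and puts its first entry into the domain
    and its second into the range. *)
Lemma Bst_iter (P : nat -> V M) l s z : (forall i, P i ∈ P i.+1) ->
  Bst (P (size l)) s z -> exists s', [/\ s `<=` s', Bst (P 0) s' z &
    forall p, p \in l -> (exists m, s' (p.1, m)) /\ exists m', s' (m', p.2)].
Proof.
move=> hP; elim: l s => [|[n k] l IH] s /=; first by move=> B; exists s; split=> // p.
move=> /BstE[_ /(_ _ n k (hP _))[m [m' /IH[s' [ss' B hl]]]]].
exists s'; split=> // [p sp|p]; first by apply: ss'; left.
rewrite inE => /predU1P[->|/hl //]; split.
- by exists m; apply: ss'; right; left.
- by exists m'; apply: ss'; right; right.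
Qed.

(** The finite part of [g] with range [c]; its extensions in [G] form the coset [Vst c * g]. *)
Definition gr (g : Sinf) (c : seq nat) : set (nat * nat) :=
  [set (papp g^-1 n, n) | n in [set` c]].

Lemma porb_gr g (c : seq nat) : G g -> porb (gr g c) = orb G act c (act g x).
Proof.
move=> Gg; apply/seteqP; split=> [_ [f [Gf fs] <-]|_ [h [Gh hc] <-]].
  exists (f * g^-1).
    split=> [|n nc]; first by apply: GM => //; exact: GV.
    by rewrite pappM; apply: (fs (papp g^-1 n, n)); exists n.
  rewrite -(actM actC) //; last by apply: GM => //; exact: GV.
  by rewrite -mulgA mulVg mulg1.
exists (h * g); last by rewrite (actM actC).
by split=> [|_ [n /= nc <-]]; [exact: GM|rewrite pappM pappKV hc].
Qed.

Lemma VG_gr g (c : seq nat) g2 : G g -> VG G (gr g c) g2 ->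
  forall n, n \in c -> papp g2^-1 n = papp g^-1 n.
Proof.
move=> Gg [_ g2s] n nc; apply: (@papp_injective g2).
by rewrite pappKV (g2s (papp g^-1 n, n)) //; exists n.
Qed.

Variable lev : V M -> nat -> V M.
Hypothesis levS : forall b i, lev b i ∈ lev b i.+1.
Hypothesis lev0 : forall b a i, b ∈ a -> lev b i ∈ lev a 0.

Lemma Bst_game a g (c : seq nat) z : G g -> closure (porb (gr g c)) z ->
  (forall b i, b ∈ a -> Bst (lev b i) (gr g c) z) ->
  game G act a c (act g x) z.
Proof.
elim/(well_founded_ind (@vmem_wf M)): a g c z => a IH g c z Gg cl hB.
have step b g' (c' : seq nat) z' : b ∈ a -> G g' -> Bst (lev b 0) (gr g' c') z' ->
    game G act b c' (act g' x) z'.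
  move=> ba Gg' B; apply: IH => //; first exact: Bst_closure B.
  by move=> b' i bb'; apply: Bst_sub B; exact: lev0.
constructor; first by rewrite -porb_gr.
move=> b c' ba cc'; split.
- move=> _ [h [Gh hc] <-].
  pose g1 := h * g; have Gg1 : G g1 by exact: GM.
  (* Forth: the points [g1^-1 n] must enter the domain; the zeros are padding for the range. If [g2]
     in [G] extends the resulting map, then [g1 * g2^-1] fixes [c] and shifts that map to one
     containing [gr g1 c'], so it provides the reply. *)
  have := hB b (size [seq (papp g1^-1 n, 0) | n <- c']) ba.
  move=> /(Bst_iter (levS b))[s' [ss' B hs']].
  have [g2 [Gg2 g2s]] := closure_VG (Bst_closure B).
  have Vg2 : VG G (gr g c) g2 by split=> // p /ss'; exact: g2s.
  pose f := g1 * g2^-1; have Gf : G f by apply: GM => //; exact: GV.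
  exists (act f z).
    exists f => //; split=> // n nc.
    by rewrite !pappM (VG_gr Gg Vg2) // pappKV hc.
  rewrite -(actM actC) //; apply: step => //.
  apply: Bst_mono (Bst_shift Gf B) => _ [n /= nc <-].
  have [|[m sm] _] := hs' (papp g1^-1 n, 0); first by apply/mapP; exists n.
  exists (papp g1^-1 n, m) => //=; congr pair.
  by have /= <- := g2s _ sm; rewrite pappM pappV pappKV.
- move=> _ [h [Gh hc] <-].
  (* Back: [h] fixes [c], so shifting leaves the position unchanged. It remains to bring [c'] into
     the range, and any extension [g2] in [G] of the new map gives the reply [act g2 x]. *)
  have := hB b (size [seq (0, n) | n <- c']) ba => /(Bst_shift Gh).
  have -> : shift h (gr g c) = gr g c.
    apply/seteqP; split=> [_ [_ [n /= nc <-] <-]|_ [n /= nc <-]].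
      by rewrite /= hc //; exists n.
    exists (papp g^-1 n, n); first by exists n.
    by rewrite /= hc.
  move=> /(Bst_iter (levS b))[s' [ss' B hs']].
  have [g2 [Gg2 g2s]] := closure_VG (Bst_closure B).
  have Vg2 : VG G (gr g c) g2 by split=> // p /ss'; exact: g2s.
  exists (act g2 x).
    rewrite -porb_gr //; by exists g2.
  apply: step => //; apply: Bst_mono B => _ [n /= nc <-].
  have [|_ [m sm]] := hs' (0, n); first by apply/mapP; exists n.
  have /= g2m := g2s _ sm; by rewrite -{1}g2m pappV.
Qed.

Hypothesis sep : forall z y : X, z <> y ->
  exists W, [/\ open W, W z & ~ closure W y].

Lemma closure_limit y (s : nat -> set (nat * nat)) :
  (forall i, exists m m', s i.+1 = ext (s i) i m m' i) ->
  (forall i, closure (porb (s i)) y) -> exists2 g, G g & act g x = y.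
Proof.
move=> hs hcl.
have [m hm] := choice hs; have [m' hm'] := choice hm.
have mono i j : (i <= j)%N -> s i `<=` s j.
  elim: j => [|j IH]; first by rewrite leqn0 => /eqP->.
  rewrite leq_eqVlt => /predU1P[->//|/IH ij] p /ij; rewrite hm'; by left.
have sm i j : (i < j)%N -> s j (i, m i) /\ s j (m' i, i).
  by move=> ij; split; apply: (mono i.+1) => //; rewrite hm'; right; [left|right].
have [f hf] := choice (fun i => closure_VG (hcl i)).
have fs i p : s i p -> papp (f i) p.1 = p.2 by case: (hf i) => _; exact.
have [g Gg gm] : exists2 g, G g & forall n, papp g n = m n.
  apply: (perm_limit Gcl (f := f)).
  - by move=> i; case: (hf i).
  - by move=> i j /sm[/fs].
  - by move=> n; exists (m' n), n.+1 => j /sm[_ /fs].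
exists g => //; apply: contrapT => ne.
have [W [oW Wg nW]] := sep ne.
have [c hc] := act_near Gsub actC Gg oW Wg.
(* From stage [N] on, every [h] extending [s N] agrees with [g] on the preimages of [c]. Then
   [h * g^-1] fixes [c] and [act h x] stays in [W], although such points accumulate at [y]. *)
apply: nW; pose N := \max_(n <- c) (papp g^-1 n).+1.
apply: closure_subset (hcl N) => _ [h [Gh hhs] <-].
have -> : h = (h * g^-1) * g by rewrite -mulgA mulVg mulg1.
rewrite (actM actC) //; last by apply: GM => //; exact: GV.
apply: hc; split=> [|n nc]; first by apply: GM => //; exact: GV.
have nN : (papp g^-1 n < N)%N.
  by rewrite /N (big_rem n) //= leq_maxl.
rewrite pappM; have [/hhs /= -> _] := sm _ _ nN.
by rewrite -gm pappKV.
Qed.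

End PartialMaps.

(** * Ordinals and multicodes *)

Section Ordinals.
Variable M : Type.
Implicit Types a b c : V M.

Lemma is_ord_set a : is_ord a -> is_set a. Proof. by case=> -[]. Qed.

Lemma is_ord_trans a b c : is_ord a -> b ∈ a -> c ∈ b -> c ∈ a.
Proof. by case=> -[_ h] _; exact: h. Qed.

Lemma is_ord_mem a b : is_ord a -> b ∈ a -> is_ord b.
Proof.
move=> oa ba; have [_ h] := oa; split; first exact: h.
by move=> c cb; apply: h; exact: is_ord_trans cb.
Qed.

Lemma is_ord_vempty : is_ord (@vempty M).
Proof.
by split; [split; first exact: is_set_vempty|]; move=> y; [move=> z|];
  move=> h; case: (vmem_vempty h).
Qed.

Lemma is_set_vsucc a : is_set (vsucc a). Proof. exact: is_set_vunion. Qed.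

Lemma mem_vsucc a : a ∈ vsucc a. Proof. by apply/vmem_vsucc; right. Qed.

Lemma is_ord_vsucc a : is_ord a -> is_ord (vsucc a).
Proof.
move=> oa; split; first split; first exact: is_set_vsucc.
- move=> y z /vmem_vsucc[ya|->] zy; apply/vmem_vsucc; left => //.
  exact: is_ord_trans zy.
- by move=> y /vmem_vsucc[/(is_ord_mem oa)|->]; [case|case: oa].
Qed.

Lemma is_succ_vsucc a : is_ord a -> is_succ (vsucc a).
Proof. by move=> oa; exists a => // z; exact: vmem_vsucc. Qed.

Lemma vsucc_vempty : vsucc (@vempty M) = vone.
Proof.
apply: vext; [exact: is_set_vsucc|exact: is_set_vupair|].
move=> z; rewrite vmem_vsucc vmem_vone; split=> [[/vmem_vempty|]//|]; by right.
Qed.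

Lemma is_ord_vone : is_ord (@vone M).
Proof. by rewrite -vsucc_vempty; exact/is_ord_vsucc/is_ord_vempty. Qed.

Lemma is_ord_total a b : is_ord a -> is_ord b -> [\/ a ∈ b, a = b | b ∈ a].
Proof.
elim/(well_founded_ind (@vmem_wf M)): a b => a IHa b oa.
elim/(well_founded_ind (@vmem_wf M)): b => b IHb ob.
have [|nab] := pselect (a ∈ b); first by constructor 1.
have [|nba] := pselect (b ∈ a); first by constructor 3.
constructor 2; apply: vext; [exact: is_ord_set|exact: is_ord_set|].
move=> z; split=> [za|zb].
- have [//|e|bz] := IHa z za b (is_ord_mem oa za) ob.
    by case: nba; rewrite -e.
  by case: nba; exact: is_ord_trans bz.
- have [az|e|//] := IHb z zb (is_ord_mem ob zb).
    by case: nab; exact: is_ord_trans az.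
  by case: nab; rewrite e.
Qed.

Lemma is_ord_sub a b c : is_ord a -> is_ord b -> ~ b ∈ a -> c ∈ a -> c ∈ b.
Proof.
move=> oa ob nba ca; have [ab|<- //|//] := is_ord_total oa ob.
exact: is_ord_trans ca.
Qed.

Lemma is_ord_vunion a : (forall c, c ∈ a -> is_ord c) -> is_ord (vunion a).
Proof.
move=> h; have mem z : z ∈ vunion a -> is_ord z.
  by move=> /vmem_vunion[w /h ow]; exact: is_ord_mem.
split; last by move=> y /mem[].
split; first exact: is_set_vunion.
move=> y z /vmem_vunion[w wa yw] zy; apply/vmem_vunion; exists w => //.
exact: is_ord_trans (h _ wa) yw zy.
Qed.

(** A bounded substitute for [is_succ], usable in a case distinction inside a Sigma-recursion. *)
Definition succb b : Prop := exists2 c, c ∈ b & forall d, d ∈ b -> d ∈ c \/ d = c.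

Lemma succbP b : is_ord b -> succb b -> exists2 c, c ∈ b & b = vsucc c.
Proof.
move=> ob [c cb h]; exists c => //.
apply: vext; [exact: is_ord_set|exact: is_set_vsucc|].
move=> z; rewrite vmem_vsucc; split; first exact: h.
by move=> [zc|-> //]; exact: is_ord_trans zc.
Qed.

Lemma succb_vsucc c : succb (vsucc c).
Proof. by exists c => [|d /vmem_vsucc//]; exact: mem_vsucc. Qed.

Lemma vunion_vsucc c : is_ord c -> vunion (vsucc c) = c.
Proof.
move=> oc; apply: vext; [exact: is_set_vunion|exact: is_ord_set|].
move=> z; rewrite vmem_vunion; split=> [[w /vmem_vsucc[wc|->] zw] //|zc].
  exact: is_ord_trans zw.
by exists c => //; exact: mem_vsucc.
Qed.

Lemma limit_vsucc b c : is_ord b -> ~ succb b -> c ∈ b -> vsucc c ∈ b.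
Proof.
move=> ob nsb cb; have oc := is_ord_mem ob cb.
have [sb|e|bs] := is_ord_total (is_ord_vsucc oc) ob; first by [].
  by case: nsb; rewrite -e; exact: succb_vsucc.
move: bs => /vmem_vsucc[bc|e]; last by case: (@vmem_irrefl _ c); rewrite -{2}e.
by case: (vmem_asym bc).
Qed.

Lemma limit_iter b c n : is_ord b -> ~ succb b -> c ∈ b -> iter n (@vsucc M) c ∈ b.
Proof. by move=> ob nsb cb; elim: n => //= n; exact: limit_vsucc. Qed.

Lemma is_limitP b : is_ord b -> b <> vempty -> ~ succb b -> is_limit b.
Proof.
move=> ob bn nsb; split=> // -[y oy h]; apply: nsb; exists y; first by apply/h; right.
by move=> d /h.
Qed.

Lemma vempty_mem b : is_ord b -> b <> vempty -> vempty ∈ b.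
Proof.
move=> ob bn; have [|e|h] := is_ord_total is_ord_vempty ob; first by [].
  by case: bn.
by case: (vmem_vempty h).
Qed.

Lemma is_ord_iter n b : is_ord b -> is_ord (iter n (@vsucc M) b).
Proof. by move=> ob; elim: n => //= n; exact: is_ord_vsucc. Qed.

Lemma countable_vempty : countable (elts (@vempty M)).
Proof.
have -> : elts (@vempty M) = set0; last exact: countable0.
by apply/seteqP; split=> // z h; case: (vmem_vempty h).
Qed.

Lemma countable_vsucc b : countable (elts b) -> countable (elts (vsucc b)).
Proof.
move=> cb; apply: sub_countable (_ : countable (b |` elts b)).
  by apply: subset_card_le => z /vmem_vsucc[|->]; [right|left].
by apply: countable_setU => //; exact: countable1.
Qed.

End Ordinals.

(** * Shapes of multicodes and the sets they determine *)

Section Codes.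
Variables (M : Type) (om : nat -> V M).
Implicit Types (a b c u v : V M) (f : V M -> V M).
Let Om := vset om.

Lemma mem_om n : om n ∈ Om. Proof. by apply/vmem_vset; exists n. Qed.

Lemma fun_on_vlam a f : fun_on (vlam a f) a.
Proof.
split; first exact: is_set_vrep.
- by move=> z /vmem_vlam[y ya ->]; exists y, (f y).
- move=> y ya; exists (f y); split; first exact/vpair_vlam.
  by move=> v /vpair_vlam[].
Qed.

Lemma rng_vlam a f v : rng (vlam a f) v <-> exists2 y, y ∈ a & v = f y.
Proof.
split=> [[y /vpair_vlam[]]|[y ya ->]]; first by exists y.
by exists y; apply/vpair_vlam.
Qed.

Lemma BSigma_fun a u : BSigma om a u -> exists d,
  fun_on u d /\ exists i, i ∈ d.
Proof.
case=> [{}u fu _|{}a {}u oa a1 [[_ fu]|[_ fu]] _].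
- by exists Om; split=> //; exists (om 0); exact: mem_om.
- by exists a; split=> //; exists vone.
- by exists Om; split=> //; exists (om 0); exact: mem_om.
Qed.

Lemma BSigma_rng a u : BSigma om a u -> exists y, rng u y.
Proof.
by move=> /BSigma_fun[d [[_ _ h] [i /h[y [iy _]]]]]; exists y, i.
Qed.

Lemma BSigma_mem a u z : BSigma om a u -> z ∈ u -> exists x y, z = vpair x y.
Proof. by move=> /BSigma_fun[d [[_ h _] _]] /h[x [y [_ ->]]]; exists x, y. Qed.

(** All members of a code are ordered pairs, whereas [vpair vempty v] has the member [vone], which
    is not one. *)
Lemma BSigma_npair a u v : BSigma om a u -> u <> vpair vempty v.
Proof.
move=> bu e; have [|x [y /vone_neq_vpair//]] := @BSigma_mem a u vone bu.
by rewrite e; apply/vmem_vupair; left.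
Qed.

Lemma BSigma_nempty a u : BSigma om a u -> u <> vempty /\ u <> vone.
Proof.
move=> bu; have [y [x xy]] := BSigma_rng bu.
split=> e; move: xy; rewrite e; first by move=> h; case: (vmem_vempty h).
by move=> /vmem_vone/esym/vempty_neq_vpair.
Qed.

Lemma BSigma_ord a u : BSigma om a u -> is_ord a /\ (vone = a \/ vone ∈ a).
Proof.
by case=> [{}u _ _|{}a {}u oa a1 _ _]; split; [exact: is_ord_vone|left| |right].
Qed.

Lemma BSigma_inv a u : BSigma om a u ->
  (a = vone /\ forall y, rng u y -> y = vempty \/ y = vone) \/
  (vone ∈ a /\ forall y, rng u y -> exists2 b, b ∈ a & BPi om b y \/ BSigma om b y).
Proof. by case=> [{}u _ h|{}a {}u _ a1 _ h]; [left|right]. Qed.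

Lemma BSigma_one_gt1 a u : BSigma om vone u -> BSigma om a u -> ~ vone ∈ a.
Proof.
move=> b1 ba a1; have [y uy] := BSigma_rng ba.
have [[_ /(_ _ uy) v1]|[h _]] := BSigma_inv b1; last exact: vmem_irrefl h.
have [[e _]|[_ /(_ _ uy)[b _ [bp|bs]]]] := BSigma_inv ba.
- by move: a1; rewrite e; exact: vmem_irrefl.
- case: bp v1 => b' u' _ [e|e]; first exact: (vempty_neq_vpair (esym e)).
  exact: (vone_neq_vpair (esym e)).
- by have [n0 n1] := BSigma_nempty bs; case: v1.
Qed.

Section Decode.
Variables (X : Type) (A : nat -> set X).

Lemma decodes_inv u B : decodes om A u B ->
  [\/ BSigma om vone u /\
        B = \bigcup_(n in [set n | vpair (om n) vone ∈ u]) A n,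
      exists a u' B', [/\ BSigma om a u', decodes om A u' B', u = vpair vempty u' & B = ~` B']
    | exists a (F : V M -> set X), [/\ vone ∈ a, BSigma om a u,
        forall u', rng u u' -> decodes om A u' (F u') &
        B = \bigcup_(u' in rng u) F u']].
Proof.
case=> [{}u b1|a u' B' b d|a {}u F a1 b d].
- by constructor 1.
- by constructor 2; exists a, u', B'.
- by constructor 3; exists a, F.
Qed.

(** [decodes_gt1] attaches sets to codes, but unions below are taken over indices, and several
    indices may carry the same code; uniqueness reconciles the two. *)
Lemma decodes_unique u B B' : decodes om A u B -> decodes om A u B' -> B = B'.
Proof.
move=> d; elim: d B' => [{}u b1|a u' {}B b _ IH|a {}u F a1 b _ IH] B'
  /decodes_inv[[b1' ->]|[a' [u1 [B1 [b' d' e ->]]]]|[a' [F' [a1' b' d' ->]]]] //.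
- by case: (BSigma_npair b1 e).
- by case: (BSigma_one_gt1 b1 b').
- by case: (BSigma_npair b1' (erefl _)).
- by have [_ e'] := vpair_inj e; rewrite (IH B1) // e'.
- by case: (BSigma_npair b' (erefl _)).
- by case: (BSigma_one_gt1 b1' b).
- by case: (BSigma_npair b e).
- by apply: eq_bigcupr => u' uu'; apply: IH => //; exact: d'.
Qed.

Lemma decodes_vlam a d f (F : V M -> set X) : vone ∈ a -> BSigma om a (vlam d f) ->
  (forall v, v ∈ d -> decodes om A (f v) (F v)) ->
  decodes om A (vlam d f) (\bigcup_(v in elts d) F v).
Proof.
move=> a1 b h.
have /choice[F' hF'] u : exists B, rng (vlam d f) u -> decodes om A u B.
  have [/rng_vlam[v vd ->]|n] := pselect (rng (vlam d f) u).
    by exists (F v) => _; exact: h.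
  by exists set0.
have -> : \bigcup_(v in elts d) F v = \bigcup_(u in rng (vlam d f)) F' u.
  have FF' v : v ∈ d -> F v = F' (f v).
    move=> vd; apply: decodes_unique (h _ vd) _; apply: hF'.
    by apply/rng_vlam; exists v.
  apply/seteqP; split=> [z [v vd]|z [_ /rng_vlam[v vd ->]]].
    by rewrite (FF' v vd) => Fz; exists (f v) => //; apply/rng_vlam; exists v.
  by rewrite -FF' // => Fz; exists v.
exact: decodes_gt1 a1 b hF'.
Qed.

Lemma BSigma_vlam_om r f : is_ord r -> vone = r \/ vone ∈ r ->
  (forall n, exists2 b, b ∈ vsucc r & BPi om b (f (om n)) \/ BSigma om b (f (om n))) ->
  BSigma om (vsucc r) (vlam Om f).
Proof.
move=> or r1 h; apply: BSigma_gt1; first exact: is_ord_vsucc.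
- by apply/vmem_vsucc; case: r1; [right|left].
- by right; split; [exact: is_succ_vsucc|exact: fun_on_vlam].
- by move=> u' /rng_vlam[_ /vmem_vset[n ->] ->].
Qed.

Lemma code_vlam_om r f (F : nat -> set X) : is_ord r -> vone = r \/ vone ∈ r ->
  (forall n, exists2 b, b ∈ vsucc r & BPi om b (f (om n)) \/ BSigma om b (f (om n))) ->
  (forall n, decodes om A (f (om n)) (F n)) ->
  injective om ->
  BSigma om (vsucc r) (vlam Om f) /\ decodes om A (vlam Om f) (\bigcup_n F n).
Proof.
move=> or r1 h dF oi; have b := BSigma_vlam_om or r1 h; split=> //.
have -> : \bigcup_n F n = \bigcup_(v in elts Om)
    [set z | exists2 n, v = om n & F n z].
  apply/seteqP; split=> [z [n _ Fz]|z [v _ [n _ Fz]]]; last by exists n.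
  by exists (om n); [exact: mem_om|exists n].
apply: decodes_vlam b _ => [|v /vmem_vset[n ->]].
  by apply/vmem_vsucc; case: r1; [right|left].
suff -> : [set z | exists2 n0, om n = om n0 & F n0 z] = F n by [].
by apply/seteqP; split=> [z [m /oi->]|z Fz] //; exists n.
Qed.

End Decode.
End Codes.

(** * The levels [omega * a + i] *)

Section Levels.
Variables (M : Type) (L : language) (S : structure M L).
Hypothesis KP : KPU S.
Notation obj := (@obj M L S).
Notation SF := (@SF M L S).
Variables (om : nat -> V M) (om_omega : realizes_omega S om).
Implicit Types a b c v : V M.
Let Om := vset om.
Let Lt := vimg (fun p => vpair (om p.1) (om p.2)) [set p : nat * nat | (p.1 < p.2)%N].

Let oi : injective om. Proof. by case: om_omega. Qed.
Let oOm : obj Om. Proof. by right; case: om_omega. Qed.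
Let oLt : obj Lt. Proof. by right; case: om_omega. Qed.

Definition predOm v : V M := vsep Om (fun u => vpair u v ∈ Lt).

Lemma mem_predOm n u : u ∈ predOm (om n) <-> exists2 i, (i < n)%N & u = om i.
Proof.
rewrite vmem_vsep /Lt vmem_vimg; split=> [[_ [[i j] /= ij /vpair_inj[-> /oi ->]]]|[i lin ->]].
  by exists i.
by split; [exact: mem_om|exists (i, n)].
Qed.

Lemma predOm_wf : well_founded (fun u v => u ∈ predOm v).
Proof.
have accn n : Acc (fun u v => u ∈ predOm v) (om n).
  elim/ltn_ind: n => n IH; constructor => u /mem_predOm[i lin ->]; exact: IH.
by move=> v; constructor => u /vmem_vsep[/vmem_vset[i ->] _].
Qed.

(** Iterating the successor from outside yields each ordinal [c + n] but not the sequence of them as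
    an object of [S]. Recursion along the coded order makes it Sigma in the numeral, so the supremum
    [c + omega] exists in [S]. *)
Definition plus c v : V M := vrec (fun c _ g => vcup c (vrng g)) predOm_wf c v.

Lemma plusE c n z : z ∈ plus c (om n) <->
  z ∈ c \/ exists2 i, (i < n)%N & z = plus c (om i).
Proof.
rewrite {1}/plus vrecE vmem_vcup vmem_vrng_lam; split=> -[h|]; try by left.
- by move=> [_ /mem_predOm[i lin ->] ->]; right; exists i.
- by move=> [i lin ->]; right; exists (om i) => //; apply/mem_predOm; exists i.
Qed.

Lemma plus_iter c n : is_set c -> plus c (om n) = iter n (@vsucc M) c.
Proof.
have sp m : is_set (plus c (om m)) by rewrite /plus vrecE; exact: is_set_vunion.
move=> sc; elim: n => [|n IH]; apply: vext => //=.
- by move=> z; rewrite plusE; split=> [[//|[]//]|]; left.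
- exact: is_set_vsucc.
move=> z; rewrite vmem_vsucc -IH !plusE; split=> [[zc|[i]]|[[zc|[i lin ->]]|->]].
- by left; left.
- by rewrite ltnS leq_eqVlt => /predU1P[->|lin] ->; [right|left; right; exists i].
- by left.
- by right; exists i => //; exact: ltnW.
- by right; exists n.
Qed.

Lemma SF_plus : SF (fun e => plus (e 0) (e 1)).
Proof.
apply: SF_vrec => //; first by sdef_with fail.
by rewrite /predOm; sdef_with fail.
Qed.

Definition addw c : V M := vunion (vrep Om (plus c)).

Lemma SF_addw : SF (fun e => addw (e 0)).
Proof. by rewrite /addw; sdef_with ltac:(apply: (SF_app2 KP SF_plus)). Qed.

Lemma mem_addw c z : z ∈ addw c <-> exists n, z ∈ plus c (om n).
Proof.
rewrite vmem_vunion; split=> [[_ /vmem_vrep[_ /vmem_vset[n ->] ->] zn]|[n zn]].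
  by exists n.
by exists (plus c (om n)) => //; apply/vmem_vrep; exists (om n) => //; exact: mem_om.
Qed.

(* [omega * a] *)
Definition mulw a : V M :=
  vrec (fun _ _ g => vunion (vrep (vrng g) addw)) (@vmem_wf M) vempty a.

Lemma SF_mulw : SF (fun e => mulw (e 0)).
Proof.
have H : SF (fun e => vrec (fun _ _ g => vunion (vrep (vrng g) addw))
    (@vmem_wf M) (e 0) (e 1)).
  apply: SF_vrec => //; last exact: SF_var.
  by sdef_with ltac:(apply: (SF_app1 KP SF_addw)).
apply: (SF_app2 KP (f := vrec _ (@vmem_wf M)) (g := fun=> vempty) (h := fun e => e 0)) => //.
- by apply: SF_const; exact: obj_empty.
- exact: SF_var.
Qed.

Lemma mem_mulw a z : z ∈ mulw a <->
  exists2 b, b ∈ a & exists n, z ∈ plus (mulw b) (om n).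
Proof.
rewrite {1}/mulw vrecE vmem_vunion; split.
  move=> [_ /vmem_vrep[_ /vmem_vrng_lam[b ba ->] ->] /mem_addw[n zn]].
  by exists b => //; exists n.
move=> [b ba [n zn]]; exists (addw (mulw b)); last by apply/mem_addw; exists n.
by apply/vmem_vrep; exists (mulw b) => //; apply/vmem_vrng_lam; exists b.
Qed.

Lemma is_set_mulw a : is_set (mulw a).
Proof. by rewrite /mulw vrecE; exact: is_set_vunion. Qed.

Definition lev b i : V M := iter i (@vsucc M) (mulw b).

Lemma levS b i : lev b i ∈ lev b i.+1.
Proof. exact: mem_vsucc. Qed.

Lemma lev0 b a i : b ∈ a -> lev b i ∈ lev a 0.
Proof.
move=> ba; apply/mem_mulw; exists b => //; exists i.+1.
by rewrite plus_iter; [exact: mem_vsucc|exact: is_set_mulw].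
Qed.

Lemma is_ord_mulw a : is_ord a -> is_ord (mulw a).
Proof.
elim/(well_founded_ind (@vmem_wf M)): a => a IH oa.
have mem z : z ∈ mulw a -> exists2 w, is_ord w & z ∈ w /\ forall y, y ∈ w -> y ∈ mulw a.
  move=> /mem_mulw[b ba [n zn]]; exists (plus (mulw b) (om n)).
    rewrite plus_iter; last exact: is_set_mulw.
    by apply: is_ord_iter; apply: IH => //; exact: is_ord_mem ba.
  by split=> // y yn; apply/mem_mulw; exists b => //; exists n.
split; last by move=> y /mem[w ow [yw _]]; case: (is_ord_mem ow yw).
split; first exact: is_set_mulw.
by move=> y z /mem[w ow [yw h]] zy; apply: h; exact: is_ord_trans zy.
Qed.

Lemma countable_iter n b : countable (elts b) -> countable (elts (iter n (@vsucc M) b)).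
Proof. by move=> cb; elim: n => //= n; exact: countable_vsucc. Qed.

Lemma countable_elts_sub a b : (forall z, z ∈ a -> z ∈ b) ->
  countable (elts b) -> countable (elts a).
Proof. by move=> ab; apply: sub_countable; exact: subset_card_le. Qed.

Lemma countable_mulw a : is_ord a -> countable (elts a) -> countable (elts (mulw a)).
Proof.
elim/(well_founded_ind (@vmem_wf M)): a => a IH oa ca.
apply: sub_countable (_ : countable (\bigcup_(b in elts a) \bigcup_n elts (lev b n))).
  apply: subset_card_le => z /mem_mulw[b ba [n]].
  rewrite plus_iter; last exact: is_set_mulw.
  by move=> zn; exists b => //; exists n.
apply: bigcup_countable => // b ba; apply: bigcup_countable => // n _.
apply: countable_iter; apply: IH => //; first exact: is_ord_mem ba.
by apply: countable_elts_sub ca => z; exact: is_ord_trans.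
Qed.

Lemma obj_succ b : obj b -> obj (vsucc b).
Proof.
move=> ob; have H : SF (fun e => vsucc (e 0)) by sdef_with fail.
by have := H.1 (fun=> b); apply.
Qed.

Lemma obj_iter n b : obj b -> obj (iter n (@vsucc M) b).
Proof. by move=> ob; elim: n => //= n; exact: obj_succ. Qed.

Lemma lev_univ b i : b ∈ univ S -> is_ord b -> countable (elts b) ->
  [/\ lev b i ∈ univ S, is_ord (lev b i) & countable (elts (lev b i))].
Proof.
move=> bS ob cb; have ol : is_ord (lev b i) by apply: is_ord_iter; exact: is_ord_mulw.
split=> //; last by apply: countable_iter; exact: countable_mulw.
apply: obj_set; last exact: is_ord_set.
apply: obj_iter; have := (SF_mulw.1 (fun=> b)); apply => _; exact: obj_univ.
Qed.

End Levels.

(** * Codes for the approximations *)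

Lemma Sfin_set0 : Sfin set0.
Proof. by split=> //; exact: finite_set0. Qed.

Lemma VG_Sfin G s : Sfin s -> (exists f, VG G s f) <-> SfinG G s.
Proof.
move=> [fs _ _]; split=> [[f [Gf sf]]|[f [d [Gf _ ->]]]]; last first.
  by exists f; split=> // _ [n dn <-].
exists f, [set p.1 | p in s]; split=> //; first exact: finite_image.
apply/seteqP; split=> [[n m] snm|_ [_ [[n m] snm <-] <-]] /=.
  by exists n; [exists (n, m)|have /= -> := sf _ snm].
by have /= -> := sf _ snm.
Qed.

Lemma VG_ext_Sfin G s n m m' k f : Sfin s -> VG G (ext s n m m' k) f ->
  Sfin (ext s n m m' k).
Proof.
move=> [fs _ _] [_ sf]; split.
- by rewrite finite_setU; split=> //; exact: finite_set2.
- by move=> i j j' /sf /= <- /sf.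
- by move=> i i' j /sf /= <- /sf /= /esym; exact: papp_injective.
Qed.

Section Borel.
Variable X : topologicalType.
Implicit Types B : set X.

Lemma borelC B : <<s (@open X) >> B -> <<s (@open X) >> (~` B).
Proof. by move=> mB; rewrite -setTD; exact: sigma_algebraCD. Qed.

Lemma borelT : <<s (@open X) >> [set: X].
Proof.
have m0 : <<s (@open X) >> (set0 : set X) by exact: sigma_algebra0.
by have := borelC m0; rewrite setC0.
Qed.

Lemma borel_bigcap (F : nat -> set X) :
  (forall i, <<s (@open X) >> (F i)) -> <<s (@open X) >> (\bigcap_i F i).
Proof.
move=> h; rewrite -[X in <<s _ >> X]setCK setC_bigcap; apply: borelC.
by apply: sigma_algebra_bigcup => i; exact: borelC.
Qed.

Lemma borel_bigcap_countable (I : Type) (D : set I) (F : I -> set X) :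
  countable D -> (forall i, D i -> <<s (@open X) >> (F i)) ->
  <<s (@open X) >> (\bigcap_(i in D) F i).
Proof.
move=> /countable_injP[f fi] h.
have -> : \bigcap_(i in D) F i =
    \bigcap_n [set z | forall i, D i -> f i = n -> F i z].
  apply/seteqP; split=> z hz; first by move=> n _ i Di _; exact: hz.
  by move=> i Di; exact: (hz (f i)).
apply: borel_bigcap => n.
have [[i [Di fin]]|no] := pselect (exists i, D i /\ f i = n).
  suff -> : [set z | forall i, D i -> f i = n -> F i z] = F i by exact: h.
  apply/seteqP; split=> z; first by move=> hz; exact: hz.
  by move=> Fz j Dj fj; have -> : j = i by apply: fi; rewrite ?inE // fin.
have -> : [set z | forall i, D i -> f i = n -> F i z] = setT; last exact: borelT.
  by apply/seteqP; split=> // z _ i Di fin; case: no; exists i.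
Qed.

End Borel.

Section Names.
Variables (M : Type) (om : nat -> V M) (oi : injective om).
Variables (G : set Sinf).
Variables (X : topologicalType) (act : Sinf -> X -> X) (A : nat -> set X).
Hypothesis Abasis : basis (range A).
Variable x : X.
Let Ff := F1_graph G act A om x.
Let pm (s : set (nat * nat)) := pmap_copy om s.
Let F1x s := F1 G act A om x s.

Lemma mem_pmap_copy s z : z ∈ pm s <-> exists2 p, s p & z = vpair (om p.1) (om p.2).
Proof. exact: vmem_vimg. Qed.

Lemma pmap_copy_inj : injective (@pmap_copy M om).
Proof.
suff h s s' : pm s = pm s' -> s `<=` s'.
  by move=> s s' e; apply/seteqP; split; apply: h.
move=> e [n m] snm; have : vpair (om n) (om m) ∈ pm s.
  by apply/mem_pmap_copy; exists (n, m).
by rewrite e => /mem_pmap_copy[[n' m'] snm' /vpair_inj[/oi -> /oi ->]].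
Qed.

Lemma F1_mem s l : Sfin s -> om l ∈ F1x s <-> porb G act x s `&` A l !=set0.
Proof.
move=> ss; rewrite /F1x /F1; case: asboolP => sG.
  by rewrite vmem_vimg; split=> [[l' h /oi->]|h] //; exists l.
split=> [h|[z [[f Vf _] _]]]; first by case: (vmem_vempty h).
by case: sG; apply/VG_Sfin => //; exists f.
Qed.

Lemma F1_closure s z : Sfin s -> closure (porb G act x s) z <->
  forall l, A l z -> om l ∈ F1x s.
Proof.
move=> ss; split=> [cz l Alz|h W nW].
  apply/F1_mem => //; apply: cz; apply: open_nbhs_nbhs; split=> //.
  by apply: Abasis.1; exists l.
have [_ [[l _ <-] /= Alz] AW] := Abasis.2 z _ nW.
have [w [sw Aw]] := (F1_mem l ss).1 (h _ Alz).
by exists w; split=> //; exact: AW.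
Qed.

Lemma is_set_F1 s : is_set (F1x s).
Proof. by rewrite /F1x /F1; case: ifP => _; exact: is_set_vimg. Qed.

Lemma vpair_F1 a b : vpair a b ∈ Ff <-> exists2 s, Sfin s & a = pm s /\ b = F1x s.
Proof.
rewrite /Ff /F1_graph vmem_vimg; split=> [[s ss /vpair_inj[-> ->]]|[s ss [-> ->]]]; by exists s.
Qed.

Lemma vapp_F1 s : Sfin s -> vapp Ff (pm s) = F1x s.
Proof.
move=> ss; apply: vapp_unique; first exact: is_set_F1.
  by apply/vpair_F1; exists s.
by move=> y /vpair_F1[s' ss' [/pmap_copy_inj <-]].
Qed.

End Names.

(** * Multicodes of the approximations, computed from the table of one point *)

Section Tables.
Variables (M : Type) (L : language) (S : structure M L).
Hypothesis KP : KPU S.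
Notation obj := (@obj M L S).
Notation val := (@valuation M L S).
Notation SF := (@SF M L S).
Variables (om : nat -> V M) (oi : injective om).
Hypothesis omS : vset om ∈ univ S.
Variables (G : set Sinf) (Gsub : subgroup G).
Variables (X : topologicalType) (act : Sinf -> X -> X).
Hypothesis actC : continuous_action G act.
Variables (A : nat -> set X).
Hypothesis Abasis : basis (range A).
Variable x : X.
Let Ff := F1_graph G act A om x.
Hypothesis FfS : Ff ∈ univ S.
Let Om := vset om.
Let pm (s : set (nat * nat)) := pmap_copy om s.
Let F1x s := F1 G act A om x s.

Let pm_inj : injective pm := pmap_copy_inj oi.
Let F1x_closure s z : Sfin s -> closure (porb G act x s) z <->
  forall l, A l z -> om l ∈ F1x s := @F1_closure M om oi G X act A Abasis x s z.
Let vpair_F1x a b : vpair a b ∈ Ff <-> exists2 s, Sfin s & a = pm s /\ b = F1x s :=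
  @vpair_F1 M om G X act A x a b.
Let vapp_F1x s : Sfin s -> vapp Ff (pm s) = F1x s := @vapp_F1 M om oi G X act A x s.

Definition Sf := vsep (vunion (vunion Ff))
  (fun a => exists2 b, b ∈ vunion (vunion Ff) & vpair a b ∈ Ff).

Lemma mem_Sf a : a ∈ Sf <-> exists2 s, Sfin s & a = pm s.
Proof.
rewrite vmem_vsep; split=> [[_ [b _ /vpair_F1x[s ss [-> _]]]]|[s ss ->]].
  by exists s.
have h : vpair (pm s) (F1x s) ∈ Ff by apply/vpair_F1x; exists s.
by have [? ?] := mem_vpair_field h; split=> //; exists (F1x s).
Qed.

Lemma mem_Sf_pm s : pm s ∈ Sf <-> Sfin s.
Proof. by rewrite mem_Sf; split=> [[s' ss /pm_inj->]|ss] //; exists s. Qed.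

Let oFf : obj Ff. Proof. exact: obj_univ. Qed.
Let oOm : obj Om. Proof. exact: obj_univ. Qed.

Lemma obj_Sf : obj Sf.
Proof.
have H : SF (fun=> Sf) by rewrite /Sf; sdef_with fail.
by have := H.1 (fun=> Om); apply.
Qed.

Lemma obj_vone : obj vone.
Proof.
have H : SF (fun=> vone) by rewrite /vone; sdef_with fail.
by have := H.1 (fun=> Om); apply.
Qed.

Let oSf := obj_Sf.
Let o1 := obj_vone.

Definition extV s n m m' k : V M := vcup s (vupair (vpair n m) (vpair m' k)).

Lemma extV_pm s n m m' k :
  extV (pm s) (om n) (om m) (om m') (om k) = pm (ext s n m m' k).
Proof.
apply: vext; [exact: is_set_vunion|exact: is_set_vimg|].
move=> z; rewrite vmem_vcup vmem_vupair !mem_pmap_copy; split.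
- move=> [[p sp ->]|[->|->]].
  + by exists p => //; left.
  + by exists (n, m) => //; right; left.
  + by exists (m', k) => //; right; right.
- by move=> [p [sp|[->|->]] ->]; [left; exists p|right; left|right; right].
Qed.

(* A code of [X], standing for the complement of [Bst b s] when [s] is not in
   [Sfin]. *)
Definition top_code : V M := vlam Om (fun=> vone).

Definition getU U s : V M := if `[< s ∈ Sf >] then vapp U s else top_code.

(** The complement of the closure of [porb s] is the union of the [A l] missing [porb s], so the
    code is the negated characteristic function of [F1 s]. *)
Definition code0 : V M := vlam Sf (fun s =>
  vlam Om (fun l => if `[< l ∈ vapp Ff s >] then vempty else vone)).

(** [U] codes complements at the previous stage. The four unions, over [n], [k], [m] and [m'], raise
    the rank by four; the two complements cost nothing. *)
Definition codeS U : V M := vlam Sf (fun s =>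
  vlam Om (fun n => vlam Om (fun k => vpair vempty
    (vlam Om (fun m => vlam Om (fun m' =>
      vpair vempty (getU U (extV s n m m' k)))))))).

Definition codeL g b : V M := vlam Sf (fun s => vlam b (fun c => vapp (vapp g c) s)).

(* Multicodes indexed by an ordinal other than [omega] are only available at
   limit stages, with that very ordinal as the index set. *)
Definition Fcode (_ b g : V M) : V M :=
  if `[< b = vempty >] then code0
  else if `[< succb b >] then codeS (vapp g (vunion b))
  else codeL g b.

Lemma SF_Fcode : SF (fun e => Fcode (e 0) (e 1) (e 2)).
Proof.
rewrite /Fcode /succb /code0 /codeS /codeL /getU /top_code /extV.
sdef_with fail.
Qed.

Definition Ucode : V M -> V M := vrec Fcode (@vmem_wf M) vempty.

Lemma obj_Ucode b : obj b -> obj (Ucode b).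
Proof.
move=> ob; have H := SF_vrec KP (@vmem_wf M) SF_Fcode (SF_var S 0).
have := H.1 (scons vempty (fun=> b)); apply => -[|n] //; exact: obj_empty.
Qed.

Lemma UcodeE b : Ucode b = Fcode vempty b (vlam b Ucode).
Proof. by rewrite {1}/Ucode vrecE. Qed.

Lemma is_set_Ucode b : is_set (Ucode b).
Proof.
rewrite UcodeE /Fcode; case: ifP => _; first exact: is_set_vrep.
by case: ifP => _; exact: is_set_vrep.
Qed.

Let Bx := @Bst G X act M x.

Lemma Bst_vempty s z : Bx vempty s z <-> closure (porb G act x s) z.
Proof.
split=> [/Bst_closure//|cz]; apply/BstE; split=> // c n k h.
by case: (vmem_vempty h).
Qed.

Lemma ext_sub s n m m' k : s `<=` ext s n m m' k.
Proof. by move=> p; left. Qed.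

Lemma Bst_vsucc c s z : is_ord c ->
  Bx (vsucc c) s z <-> forall n k, exists m m', Bx c (ext s n m m' k) z.
Proof.
move=> oc; split=> [/BstE[_ h] n k|h]; first exact/h/mem_vsucc.
apply/BstE; split.
  have [m [m' /Bst_closure]] := h 0 0; apply: closure_subset.
  exact/porb_sub/ext_sub.
move=> d n k /vmem_vsucc[dc|-> //]; have [m [m' B]] := h n k.
exists m, m'; exact: Bst_sub B.
Qed.

Lemma Bst_limit b s z : is_ord b -> b <> vempty -> ~ succb b ->
  Bx b s z <-> forall c, c ∈ b -> Bx c s z.
Proof.
move=> ob bn nsb; split=> [B c cb|h]; first exact: Bst_sub B.
apply/BstE; split; first exact: Bst_closure (h _ (vempty_mem ob bn)).
move=> c n k cb; have /BstE[_ h'] := h _ (limit_vsucc ob nsb cb).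
exact/h'/mem_vsucc.
Qed.

Lemma top_code_ok : BSigma om vone top_code /\ decodes om A top_code setT.
Proof.
have b1 : BSigma om vone top_code.
  apply: BSigma_one; first exact: fun_on_vlam.
  by move=> y /rng_vlam[_ _ ->]; right.
split=> //; have := decodes_one A b1; congr decodes.
apply/seteqP; split=> // z _; have [_ [[l _ <-] /= Alz] _] := Abasis.2 z _ filterT.
by exists l => //=; apply/vpair_vlam; split=> //; exact: mem_om.
Qed.

Lemma code0_ok s : Sfin s ->
  BSigma om vone (vapp code0 (pm s)) /\
  decodes om A (vapp code0 (pm s)) (~` Bx vempty s).
Proof.
move=> ss; rewrite vapp_vlam; [|exact/mem_Sf_pm|exact: is_set_vrep].
set u := vlam _ _; have b1 : BSigma om vone u.
  apply: BSigma_one; first exact: fun_on_vlam.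
  by move=> y /rng_vlam[l _ ->]; case: ifP => _; [left|right].
split=> //; have := decodes_one A b1; congr decodes.
have uP n : vpair (om n) vone ∈ u <-> ~ om n ∈ F1x s.
  rewrite vpair_vlam vapp_F1x //; case: asboolP => h; split=> //.
  - move=> [_ e]; have : (vempty : V M) ∈ vone by apply/vmem_vone.
    by rewrite e => /vmem_vempty.
  - by split=> //; exact: mem_om.
apply/seteqP; split=> [z [n /uP nF An] /Bst_vempty /(F1x_closure _ ss)/(_ _ An)//|z].
move=> nB; apply: contrapT => h; apply/nB/Bst_vempty/F1x_closure => // l Al.
by apply: contrapT => /uP ul; apply: h; exists l.
Qed.

Lemma codeS_ok U c r s : is_ord c -> is_ord r -> vone = r \/ vone ∈ r ->
  (forall t, Sfin t -> BSigma om r (vapp U (pm t)) /\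
     decodes om A (vapp U (pm t)) (~` Bx c t)) ->
  Sfin s -> BSigma om (iter 4 (@vsucc M) r) (vapp (codeS U) (pm s)) /\
    decodes om A (vapp (codeS U) (pm s)) (~` Bx (vsucc c) s).
Proof.
move=> oc or r1 hU ss.
have r1' k : vone = iter k (@vsucc M) r \/ vone ∈ iter k (@vsucc M) r.
  elim: k => //= k; case=> [->|?]; right; first exact: mem_vsucc.
  by apply/vmem_vsucc; left.
have or' k : is_ord (iter k (@vsucc M) r) by exact: is_ord_iter.
rewrite vapp_vlam; [|exact/mem_Sf_pm|exact: is_set_vrep].
have get n m m' k : exists2 b, b ∈ vsucc r &
    BSigma om b (getU U (extV (pm s) (om n) (om m) (om m') (om k))) /\
    decodes om A (getU U (extV (pm s) (om n) (om m) (om m') (om k)))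
      (~` Bx c (ext s n m m' k)).
  rewrite extV_pm /getU; case: asboolP => [/mem_Sf_pm te|nte].
    by exists r; [exact: mem_vsucc|exact: hU].
  exists vone; first by apply/vmem_vsucc; case: r1 => [e|]; [right|left].
  have -> : ~` Bx c (ext s n m m' k) = setT; last exact: top_code_ok.
  apply/seteqP; split=> // z _ /Bst_closure/closure_VG[f Vf]; apply: nte.
  by apply/mem_Sf_pm; exact: VG_ext_Sfin Vf.
have -> : ~` Bx (vsucc c) s = \bigcup_n \bigcup_k
    ~` (\bigcup_m \bigcup_m' ~` ~` Bx c (ext s n m m' k)).
  apply/seteqP; split=> z.
    move=> /= nB; apply: contrapT => h; apply: nB; apply/Bst_vsucc => // n k.
    apply: contrapT => h'; apply: h; exists n => //; exists k => // -[m _ [m' _]].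
    by rewrite setCK => B; apply: h'; exists m, m'.
  move=> [n _ [k _ h]] /(Bst_vsucc _ _ oc)/(_ n k)[m [m' B]]; apply: h.
  by exists m => //; exists m' => //; rewrite setCK.
have lam k f (F : nat -> set X) :=
  @code_vlam_om M om X A (iter k (@vsucc M) r) f F (or' k) (r1' k).
pose f1 n k m m' := vpair vempty (getU U (extV (pm s) n m m' k)).
have h1 n m k : BSigma om (iter 1 (@vsucc M) r) (vlam Om (f1 (om n) (om k) (om m))) /\
   decodes om A (vlam Om (f1 (om n) (om k) (om m))) (\bigcup_m' ~` ~` Bx c (ext s n m m' k)).
  apply: (lam 0) => // m'; have [b br [bs d]] := get n m m' k.
    by exists b => //; left; exact: BPi_compl.
  exact: decodes_compl bs d.
have h2 n k : BSigma om (iter 2 (@vsucc M) r) (vlam Om (fun m => vlam Om (f1 (om n) (om k) m))) /\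
   decodes om A (vlam Om (fun m => vlam Om (f1 (om n) (om k) m)))
     (\bigcup_m \bigcup_m' ~` ~` Bx c (ext s n m m' k)).
  apply: (lam 1) => // m; have [bs d] := h1 n m k => //.
  by exists (iter 1 (@vsucc M) r); [exact: mem_vsucc|right].
pose f3 n k := vpair vempty (vlam Om (fun m => vlam Om (f1 n k m))).
have h3 n : BSigma om (iter 3 (@vsucc M) r) (vlam Om (f3 (om n))) /\
   decodes om A (vlam Om (f3 (om n)))
     (\bigcup_k ~` \bigcup_m \bigcup_m' ~` ~` Bx c (ext s n m m' k)).
  apply: (lam 2) => // k; have [bs d] := h2 n k.
    by exists (iter 2 (@vsucc M) r); [exact: mem_vsucc|left; exact: BPi_compl].
  exact: decodes_compl bs d.
apply: (lam 3 (fun n => vlam Om (f3 n))) => // n; have [bs d] := h3 n => //.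
by exists (iter 3 (@vsucc M) r); [exact: mem_vsucc|right].
Qed.

(** The excess [r] counts the steps since the last limit: at a limit [b] the codes of all smaller
    stages, each with a finite excess, still have rank below [b], so the excess returns to 0. It
    does not depend on [s], since [codeS] combines codes of different maps. *)
Lemma Ucode_ok b : is_ord b -> exists r, forall s, Sfin s ->
  BSigma om (iter r (@vsucc M) b) (vapp (Ucode b) (pm s)) /\
  decodes om A (vapp (Ucode b) (pm s)) (~` Bx b s).
Proof.
elim/(well_founded_ind (@vmem_wf M)): b => b IH ob.
rewrite UcodeE /Fcode; case: asboolP => [->|bn].
  by exists 1 => s ss; rewrite /= vsucc_vempty; exact: code0_ok.
case: asboolP => [sb|nsb].
  have [c cb bE] := succbP ob sb; have oc := is_ord_mem ob cb.
  have [r hr] := IH c cb oc.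
  exists (r + 3)%N => s ss.
  have -> : vunion b = c by rewrite bE vunion_vsucc.
  rewrite vapp_vlam //; last exact: is_set_Ucode.
  have [or r1] := BSigma_ord (hr _ Sfin_set0).1.
  (* Of the four successors added by [codeS], one is absorbed by passing from [c] to [b]. *)
  have -> : iter (r + 3) (@vsucc M) b = iter 4 (@vsucc M) (iter r (@vsucc M) c).
    by rewrite -iterD bE -iterSr addnC.
  by rewrite bE; exact: codeS_ok.
have /choice[r hr] c : exists r, c ∈ b -> forall s, Sfin s ->
    BSigma om (iter r (@vsucc M) c) (vapp (Ucode c) (pm s)) /\
    decodes om A (vapp (Ucode c) (pm s)) (~` Bx c s).
  have [cb|] := pselect (c ∈ b); last by exists 0.
  by have [r hr] := IH c cb (is_ord_mem ob cb); exists r.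
exists 0 => s ss /=; rewrite vapp_vlam; [|exact/mem_Sf_pm|exact: is_set_vrep].
set u := vlam _ _.
have uE : u = vlam b (fun c => vapp (Ucode c) (pm s)).
  by apply: eq_vlam => c cb; rewrite vapp_vlam //; exact: is_set_Ucode.
have v1 : vone ∈ b by rewrite -vsucc_vempty; apply: limit_vsucc => //; exact: vempty_mem.
have bu : BSigma om b u.
  apply: BSigma_gt1 => //; first by left; split; [exact: is_limitP|exact: fun_on_vlam].
  rewrite uE => y /rng_vlam[c cb ->]; exists (iter (r c) (@vsucc M) c).
    exact: limit_iter.
  by right; case: (hr c cb s ss).
split=> //; rewrite uE in bu *.
have -> : ~` Bx b s = \bigcup_(c in elts b) ~` Bx c s.
  apply/seteqP; split=> z.
    move=> /= nB; apply: contrapT => h; apply: nB; apply/Bst_limit => // c cb.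
    by apply: contrapT => nc; apply: h; exists c.
  by move=> [c cb nB] /(Bst_limit _ _ ob bn nsb)/(_ _ cb).
by apply: decodes_vlam v1 bu _ => c cb; case: (hr c cb s ss).
Qed.

Lemma Bst_borel b s : is_ord b -> countable (elts b) ->
  <<s (@open X) >> (Bx b s).
Proof.
elim/(well_founded_ind (@vmem_wf M)): b s => b IH s ob cb.
have -> : Bx b s = ~` ~` closure (porb G act x s) `&`
    \bigcap_(c in elts b) \bigcap_n \bigcap_k \bigcup_m \bigcup_m' Bx c (ext s n m m' k).
  rewrite setCK; apply/seteqP; split=> z.
    move=> /BstE[cl h]; split=> // c cb' n _ k _.
    by have [m [m' B]] := h c n k cb'; exists m => //; exists m'.
  move=> [cl h]; apply/BstE; split=> // c n k cb'.
  by have [m _ [m' _ B]] := h c cb' n I k I; exists m, m'.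
rewrite -bigcap2E; apply: borel_bigcap => -[|[|i]] /=.
- apply: borelC; apply: sub_sigma_algebra; apply: closed_openC; exact: closed_closure.
- apply: borel_bigcap_countable => // c cb'.
  do 2!apply: borel_bigcap => ?; do 2!apply: sigma_algebra_bigcup => ?.
  apply: IH => //; first exact: is_ord_mem cb'.
  by apply: countable_elts_sub cb => z; exact: is_ord_trans.
- exact: borelT.
Qed.

Lemma Bst_constructible b : b ∈ univ S -> is_ord b -> countable (elts b) ->
  constructible om S A (Bx b set0).
Proof.
move=> bS ob cb; split; first exact: Bst_borel.
have [r /(_ _ Sfin_set0)[bs d]] := Ucode_ok ob.
exists (vpair vempty (vapp (Ucode b) (pm set0))), (iter r (@vsucc M) b); split.
- have H : SF (fun e => vpair vempty (vapp (e 0) (e 1))) by sdef_with fail.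
  have := H.1 (scons (Ucode b) (fun=> pm set0)); apply => -[|n] /=.
    exact/obj_Ucode/obj_univ.
  by apply: obj_mem oSf _; apply/mem_Sf_pm; exact: Sfin_set0.
- have oi' : is_ord (iter r (@vsucc M) b) by exact: is_ord_iter.
  split=> //; apply: obj_set; last exact: is_ord_set.
  exact/(obj_iter KP)/obj_univ.
- exact: countable_iter.
- by right; exact: BPi_compl.
- by rewrite -[Bx b set0]setCK; exact: decodes_compl bs d.
Qed.

Lemma same_Bst y b : same_constructible G act A om S x y ->
  b ∈ univ S -> is_ord b -> countable (elts b) -> Bx b set0 y.
Proof.
move=> xy bS ob cb; apply/(xy (Bx b set0)).
- exact: Bst_invariant.
- exact: Bst_constructible.
- rewrite -{1}(action1 actC x); apply: Bst_refl => //; split=> //.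
  by case: Gsub.
Qed.

(** * Two codable points *)

Section SecondPoint.
Variable y : X.
Let Fy := F1_graph G act A om y.
Hypothesis FyS : Fy ∈ univ S.
Hypothesis Ainv : forall l, exists2 c : set nat, finite_set c &
  invariant_under act (VG G (id_on c)) (A l).
Let oFy : obj Fy. Proof. exact: obj_univ. Qed.

Definition idV d : Prop := forall q, q ∈ d -> exists2 n, n ∈ Om & q = vpair n n.

(** Recovers the indices of the basic sets containing [y] from its table: [A l] is to meet [V_c y]
    for all finite [c]. For a [c] under whose stabiliser [A l] is invariant, a point of [V_c y] in
    [A l] can be moved back to [y]. *)
Definition Ny : V M := vsep Om (fun l => forall d, d ∈ Sf -> ~ idV d \/ l ∈ vapp Fy d).

Lemma idV_pm s : idV (pm s) <-> forall p, s p -> p.1 = p.2.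
Proof.
split=> [h [n m] snm|h q].
  have [|_ /vmem_vset[k ->] /vpair_inj[/oi -> /oi ->]] // := h (vpair (om n) (om m)).
  by apply/mem_pmap_copy; exists (n, m).
move=> /mem_pmap_copy[[n m] /h /= -> ->]; exists (om m) => //; exact: mem_om.
Qed.

Lemma id_on_Sfin c : finite_set c -> Sfin (id_on c).
Proof.
move=> fc; split; first exact: finite_image.
- by move=> n m m' [i _ [<- <-]] [j _ [<- <-]].
- by move=> n n' m [i _ [<- <-]] [j _ [<- <-]].
Qed.

Lemma mem_Ny l : om l ∈ Ny <-> A l y.
Proof.
have [_ _ GV] := Gsub.
rewrite vmem_vsep; split=> [[_ h]|Al].
  have [c fc ic] := Ainv l; have sc := id_on_Sfin fc.
  have [|nid|] := h (pm (id_on c)); first exact/mem_Sf_pm.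
    by case: nid; apply/idV_pm => _ [n _ <-].
  rewrite (vapp_F1 oi) // => /(F1_mem oi) -/(_ sc)[z [[f [Gf fc'] <-] Af]].
  rewrite -(actK Gsub actC y Gf); apply: ic => //; split; first exact: GV.
  by move=> p pc; have := fc' _ pc; case: pc => n _ <- /= e; rewrite -{1}e pappV.
split; first exact: mem_om.
move=> d /mem_Sf[s ss ->]; have [/idV_pm h|] := pselect (idV (pm s)); [right|by left].
rewrite (vapp_F1 oi) //; apply/(F1_mem oi) => //; exists y; split=> //.
exists 1%g; last exact: (action1 actC).
by split=> [|p /h <-]; first by case: Gsub.
Qed.

Lemma obj_Ny : obj Ny.
Proof.
have H : SF (fun=> Ny) by rewrite /Ny /idV; sdef_with fail.
by have := H.1 (fun=> Om); apply.
Qed.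
Let oNy := obj_Ny.

(** Negates the clause defining [Bst] at [y]. The point enters only through [Ny], so the recursion
    takes place in [S]; extensions outside [Sf] count as excluded. *)
Definition Fexcl (_ b g : V M) : V M := vsep Sf (fun s =>
  ~ (forall l, l ∈ Ny -> l ∈ vapp Ff s) \/
  exists2 c, c ∈ b & exists2 n, n ∈ Om & exists2 k, k ∈ Om &
    forall m, m ∈ Om -> forall m', m' ∈ Om ->
      ~ extV s n m m' k ∈ Sf \/ extV s n m m' k ∈ vapp g c).

Lemma SF_Fexcl : SF (fun e => Fexcl (e 0) (e 1) (e 2)).
Proof. by rewrite /Fexcl /extV; sdef_with fail. Qed.

Definition excl : V M -> V M := vrec Fexcl (@vmem_wf M) vempty.

Lemma SF_excl : SF (fun e => excl (e 0)).
Proof.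
apply: (SF_app2 KP (f := vrec Fexcl (@vmem_wf M)) (g := fun=> vempty) (h := fun e => e 0)).
- by apply: SF_vrec => //; [exact: SF_Fexcl|exact: SF_var].
- by apply: SF_const; exact: obj_empty.
- exact: SF_var.
Qed.

Lemma mem_excl b s : Sfin s -> pm s ∈ excl b <-> ~ Bx b s y.
Proof.
elim/(well_founded_ind (@vmem_wf M)): b s => b IH s ss.
have exclb c : is_set (excl c) by rewrite /excl vrecE; exact: is_set_vsep.
rewrite {1}/excl vrecE vmem_vsep mem_Sf_pm.
have clE : (forall l, l ∈ Ny -> l ∈ vapp Ff (pm s)) <-> closure (porb G act x s) y.
  rewrite (F1x_closure _ ss) vapp_F1x //; split=> h l; first by move=> /mem_Ny/h.
  move=> lN; have /vmem_vsep[/vmem_vset[i li] _] := lN.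
  by move: lN; rewrite li => /mem_Ny/h.
have stepE c n k : c ∈ b -> (forall m, m ∈ Om -> forall m', m' ∈ Om ->
      ~ extV (pm s) (om n) m m' (om k) ∈ Sf \/
      extV (pm s) (om n) m m' (om k) ∈ vapp (vlam b excl) c) <->
    ~ exists m m', Bx c (ext s n m m' k) y.
  move=> cb; rewrite vapp_vlam //; split.
    move=> h [m [m' B]]; have [] := h _ (mem_om om m) _ (mem_om om m'); rewrite extV_pm.
      apply; apply/mem_Sf_pm; have [f Vf] := closure_VG (Bst_closure B).
      exact: VG_ext_Sfin Vf.
    move=> ht; have /mem_Sf_pm se : pm (ext s n m m' k) ∈ Sf.
      by move: ht; rewrite /excl vrecE => /vmem_vsep[].
    by move: ht => /(IH c cb _ se).
  move=> h _ /vmem_vset[m ->] _ /vmem_vset[m' ->]; rewrite extV_pm.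
  have [se|] := pselect (Sfin (ext s n m m' k)); last by move=> nse; left => /mem_Sf_pm.
  by right; apply/IH => // B; apply: h; exists m, m'.
rewrite clE; split=> [[_ [ncl|[c cb [_ /vmem_vset[n ->]
  [_ /vmem_vset[k ->] /(stepE _ _ _ cb)]]]]]|nB].
- by move=> /Bst_closure.
- by move=> h /BstE[_ /(_ c n k cb)].
- split=> //; apply: contrapT => /not_orP[/contrapT cl h]; apply/nB/BstE; split=> //.
  move=> c n k cb; apply: contrapT => h'; apply: h; exists c => //.
  exists (om n); first exact: mem_om.
  by exists (om k); [exact: mem_om|exact/stepE].
Qed.

Definition unseparated s : Prop := Sfin s /\ forall b,
  b ∈ univ S -> is_ord b -> countable (elts b) -> Bx b s y.

(** Otherwise each extension is excluded at some countable stage. A countable stage [c0] of [S]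
    dominating one such stage for every extension contradicts that [y] satisfies stage [vsucc c0] at
    [s]. *)
Lemma unseparated_ext s n k : unseparated s -> exists m m', unseparated (ext s n m m' k).
Proof.
move=> [ss hs]; apply: contrapT => no.
pose Z := vsep Sf (fun t => exists2 m, m ∈ Om & exists2 m', m' ∈ Om &
   t = extV (pm s) (om n) m m' (om k)).
have oom i : obj (om i) by apply: obj_mem oOm _; exact: mem_om.
have ops : obj (pm s) by apply: obj_mem oSf _; exact/mem_Sf_pm.
have ZS : Z ∈ univ S.
  apply: obj_set; last exact: is_set_vsep.
  have on := oom n; have ok := oom k.
  have H : SF (fun=> Z) by rewrite /Z /extV; sdef_with fail.
  by have := H.1 (fun=> Om); apply.
have memZ t : t ∈ Z <-> exists2 q, Sfin (ext s n q.1 q.2 k) & t = pm (ext s n q.1 q.2 k).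
  rewrite vmem_vsep; split.
    move=> [tS [_ /vmem_vset[m ->] [_ /vmem_vset[m' ->] tE]]].
    by exists (m, m'); rewrite -?extV_pm //; apply/mem_Sf_pm; rewrite -extV_pm -tE.
  move=> [[m m'] /= se ->]; split; first exact/mem_Sf_pm.
  exists (om m); first exact: mem_om.
  by exists (om m'); [exact: mem_om|rewrite extV_pm].
have wit t : t ∈ Z -> exists c, [/\ c ∈ univ S, is_ord c, countable (elts c) & t ∈ excl c].
  move=> /memZ[[m m'] /= se ->]; apply: contrapT => h; apply: no; exists m, m'.
  split=> // c cS oc cc; apply: contrapT => nB; apply: h; exists c; split=> //.
  exact/mem_excl.
(* Countability has to be dropped in order to collect, so the ordinals in [D] may be uncountable. *)
have [D [DS D1 D2]] : exists D, [/\ D ∈ univ S,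
    forall t, t ∈ Z -> exists2 b, b ∈ D & is_ord b /\ t ∈ excl b &
    forall b, b ∈ D -> exists2 t, t ∈ Z & is_ord b /\ t ∈ excl b].
  apply: (S1_coll KP (P := fun _ t b => is_ord b /\ t ∈ excl b) (e := fun=> Om)) => //.
  - apply: S1_and => //; last first.
      by sdef_with ltac:(apply: (SF_app1 KP SF_excl)).
    apply: (S1_iff (Q := fun e => (is_set (e 0) /\
        forall a, a ∈ e 0 -> forall b, b ∈ a -> b ∈ e 0) /\
        forall c, c ∈ e 0 -> is_set c /\
        forall a, a ∈ c -> forall b, b ∈ a -> b ∈ c)); last by sdef_with fail.
    move=> e _; split=> [[[s0 h] h']|[[s0 h] h']].
      split; first by split=> // a ae b ba; exact: h ae ba.
      by move=> c /h'[sc hc]; split=> // a ac b ba; exact: hc ac ba.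
    split; first by split=> // a b ae ba; exact: h ae _ ba.
    by move=> c /h'[sc hc]; split=> // a b ac ba; exact: hc ac _ ba.
  - by move=> t /wit[c [cS oc _ tc]]; exists c => //; exact: obj_univ.
pose bs := vunion D.
have obs : is_ord bs by apply: is_ord_vunion => c /D2[t _ []].
have bsS : bs ∈ univ S by exact: union_univ.
(* The smaller of the collected ordinal and the countable witness is both countable and contained in
   [bs]. *)
have wit' t : exists c, t ∈ Z -> [/\ is_ord c, countable (elts c), t ∈ excl c &
    forall z, z ∈ c -> z ∈ bs].
  have [tZ|] := pselect (t ∈ Z); last by exists vempty.
  have [c1 [_ oc1 cc1 tc1]] := wit t tZ; have [b bD [ob tb]] := D1 t tZ.
  have sub c : (forall z, z ∈ c -> z ∈ b) -> forall z, z ∈ c -> z ∈ bs.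
    by move=> cb z /cb zb; apply/vmem_vunion; exists b.
  have [bc1|nbc1] := pselect (b ∈ c1).
    exists b => _; split=> //; last exact: sub.
    by apply: countable_elts_sub cc1 => z; exact: is_ord_trans.
  exists c1 => _; split=> //; apply: sub => z; exact: is_ord_sub.
have [cf hcf] := choice wit'.
pose c0 := vsep bs (fun z => exists2 t, t ∈ Z & z ∈ cf t).
have mem0 z : z ∈ c0 <-> exists2 t, t ∈ Z & z ∈ cf t.
  rewrite vmem_vsep; split=> [[]//|[t tZ zt]]; split; last by exists t.
  by have [_ _ _] := hcf t tZ; apply.
have oc0 : is_ord c0.
  split; last by move=> z /mem0[t /hcf[oc _ _ _] zt]; case: (is_ord_mem oc zt).
  split; first exact: is_set_vsep.
  move=> a z /mem0[t tZ at'] za; apply/mem0; exists t => //.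
  by have [oc _ _ _] := hcf t tZ; exact: is_ord_trans za.
(* [c0] was separated by a choice made outside [S]. It is nevertheless in [S], being an ordinal
   contained in the ordinal [bs], hence a member of [bs] or equal to it. *)
have c0S : c0 ∈ univ S.
  have [h|->//|h] := is_ord_total oc0 obs.
    apply: obj_set; last exact: is_set_vsep.
    by apply: obj_mem h; exact: obj_univ.
  by move: h => /vmem_vsep[h]; case: (vmem_irrefl h).
have cc0 : countable (elts c0).
  pose T := [set q : nat * nat | pm (ext s n q.1 q.2 k) ∈ Z].
  apply: sub_countable (_ : countable
      (\bigcup_(q in T) elts (cf (pm (ext s n q.1 q.2 k))))).
    apply: subset_card_le => z /mem0[t tZ zt]; have /memZ[q _ tE] := tZ.
    by exists q; rewrite /T /= -tE.
  by apply: bigcup_countable => // q /hcf[].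
have BS : Bx (vsucc c0) s y.
  apply: hs; [|exact: is_ord_vsucc|exact: countable_vsucc].
  apply: obj_set; last exact: is_set_vsucc.
  exact/(obj_succ KP)/obj_univ.
have [m [m' B]] := (Bst_vsucc s y oc0).1 BS n k.
have se : Sfin (ext s n m m' k).
  by have [f Vf] := closure_VG (Bst_closure B); exact: VG_ext_Sfin Vf.
have tZ : pm (ext s n m m' k) ∈ Z by apply/memZ; exists (m, m').
have [_ _ /(mem_excl _ se) nB _] := hcf _ tZ; apply: nB.
by apply: Bst_anti B => z zt; apply/mem0; exists (pm (ext s n m m' k)).
Qed.

End SecondPoint.
End Tables.

Unset Implicit Arguments.
Set Strict Implicit.

Theorem theorem7 (R : realType) (M : Type) (L : language) (S : structure M L)
    (S_admissible : admissible S)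
    (om : nat -> V M) (om_omega : realizes_omega S om)
    (G : set Sinf) (G_subgroup : subgroup G) (G_closed : closed G)
    (X : topologicalType) (X_polish : polish R X)
    (act : Sinf -> X -> X) (act_cont : continuous_action G act)
    (A : nat -> set X) (A_basis : basis (range A))
    (A_inv : forall l, exists2 c : set nat, finite_set c &
       invariant_under act (VG G (id_on c)) (A l))
    (Imp_Sigma : Sigma_definable3 S (Imp_copy G act A om)) :
  (forall x : X, codable G act A om S x ->
     forall y : X, same_constructible G act A om S x y ->
     forall o a : V M, is_ordinal_of S o ->
       is_ord a -> countable (elts a) -> a <> vempty -> a ∈ o \/ a = o ->
     forall B : set X, invariant_under act G B -> Sigma0 a B -> (B x <-> B y))
  /\
  (forall x y : X, codable G act A om S x -> codable G act A om S y ->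
     same_constructible G act A om S x y ->
     exists2 g : Sinf, G g & act g x = y).
Proof.
have KP : KPU S by [].
have [oi omS _] := om_omega.
have [G1 _ _] := G_subgroup.
have BstP x y b : codable G act A om S x -> same_constructible G act A om S x y ->
    b ∈ univ S -> is_ord b -> countable (elts b) -> Bst G act x b set0 y.
  move=> [_ FxS] xy; exact: (same_Bst KP oi omS G_subgroup act_cont A_basis FxS).
have emptyP x y : codable G act A om S x -> same_constructible G act A om S x y ->
    closure (porb G act x set0) y.
  move=> cx xy; apply: Bst_closure (BstP x y vempty cx xy _ _ _).
  - exact: univ_empty.
  - exact: is_ord_vempty.
  - exact: countable_vempty.
split.
- move=> x cx y xy o a [oo onS omin] oa ca _ ao B iB sB.
  (* Only ordinals below [a] have to lie in [S], which is why [a] may be the ordinal [o] itself. *)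
  have inS b : b ∈ a -> [/\ b ∈ univ S, is_ord b & countable (elts b)].
    move=> ba; have ob : is_ord b by exact: is_ord_mem oa ba.
    split=> //; last by apply: countable_elts_sub ca => z; exact: is_ord_trans.
    have bo : b ∈ o by case: ao => [ao|<- //]; exact: is_ord_trans oo ao ba.
    apply: contrapT => bS; case: (omin b ob bS) => [e|ob'].
      by move: bo; rewrite e; exact: vmem_irrefl.
    exact: vmem_asym bo ob'.
  have gr0 : gr 1%g [::] = set0 by apply/seteqP; split=> // p [n /=].
  apply: (game_invariant G_subgroup G_closed act_cont (polish_regular X_polish) _ sB iB).
  rewrite -{1}(action1 act_cont x).
  apply: (Bst_game G_subgroup act_cont (lev := lev om_omega)) => //.
  + exact: levS.
  + exact: lev0.
  + by rewrite gr0; exact: emptyP.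
  + move=> b i /inS[bS ob cb]; rewrite gr0.
    have [lS lo lc] := lev_univ KP om_omega i bS ob cb.
    exact: BstP.
- move=> x y cx cy xy.
  have [_ FxS] := cx; have [_ FyS] := cy.
  pose sim := unseparated S G act x y.
  have step s n : sim s -> exists q, sim (ext s n q.1 q.2 n).
    move=> /(unseparated_ext KP oi omS G_subgroup act_cont A_basis FxS FyS A_inv n n).
    by move=> [m [m' h]]; exists (m, m').
  have /choice[f hf] p : exists q, sim p.1 -> sim (ext p.1 p.2 q.1 q.2 p.2).
    have [/step-/(_ p.2)[q hq]|] := pselect (sim p.1); first by exists q.
    by exists (0, 0).
  (* Step [j] puts [j] into both domain and range, so the union of the chain is total and onto. *)
  pose s := fix s i := if i is j.+1
    then ext (s j) j (f (s j, j)).1 (f (s j, j)).2 j else set0.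
  have hs i : sim (s i).
    elim: i => [|i IH] /=; last exact: (hf (s i, i)).
    by split; [exact: Sfin_set0|move=> b; exact: BstP].
  apply: (closure_limit G_subgroup G_closed act_cont (polish_separated X_polish) (s := s)).
  + by move=> i; exists (f (s i, i)).1, (f (s i, i)).2.
  + move=> i; have [_ h] := hs i; apply: Bst_closure (h vempty _ _ _).
    * exact: univ_empty.
    * exact: is_ord_vempty.
    * exact: countable_vempty.
Qed.
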